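(* Let $g\in\mathcal{L}$, let $n\ge1$, $\mathbb{A}=(A_1,\dots,A_n)\in\mathcal{P}^n$ and $\omega\in\Delta_n$. If $\sigma_g(\omega;\mathbb{A})\ge I$, then $$\sigma_{g_p}(\omega;\mathbb{A}^p)\ge I\qquad\text{for all } p\ge1,$$ where $g_p(x):=p\,g(x^{1/p})$ and $\mathbb{A}^p=(A_1^p,\dots,A_n^p)$. Moreover, for all $p\ge 1$ and $\lambda\in[0,1]$, the representing function of the $\lambda$-weighted operator mean $\sigma_{g_p}$ is $$f_{p,\lambda}(x):=f_\lambda(x^{1/p})^p\qquad (x>0),$$ where $f_\lambda$ is the representing function of the $\lambda$-weighted operator mean $\sigma_g$.
   Context: $\mathcal{H}$ is a Hilbert space, $I$ is the identity operator, $\mathcal{P}$ is the set of invertible positive semi-definite bounded operators on $\mathcal{H}$, and $A\ge B$ for self-adjoint $A,B$ means $A-B$ is positive semi-definite. $\Delta_n=\{(w_1,\dots,w_n)\in(0,1)^n:\sum_i w_i=1\}$ (for $n=1$ the weight is $1$). A real-valued function $g$ on $(0,\infty)$ is operator monotone if $B\le A$ implies $g(B)\le g(A)$ for all self-adjoint bounded operators $A,B$ on a Hilbert space with spectra in $(0,\infty)$ (for every Hilbert space). $\mathcal{L}$ denotes the set of all operator monotone functions $g$ on $(0,\infty)$ with $g(1)=0$, $g'(1)=1$; one has $g_p\in\mathcal{L}$ for $g\in\mathcal{L}$ and $p\ge1$. For $g\in\mathcal{L}$, $\omega=(w_1,\dots,w_n)\in\Delta_n$ and $\mathbb{A}\in\mathcal{P}^n$,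 $\sigma_g(\omega;\mathbb{A})$ denotes the solution $X\in\mathcal{P}$, which exists and is unique (a known theorem of Pálfia), of the generalized Karcher equation $$\sum_{i=1}^n w_i\,g(X^{-1/2}A_iX^{-1/2})=0 .$$ For $h\in\mathcal{L}$ and $\lambda\in[0,1]$, the representing function of the $\lambda$-weighted operator mean $\sigma_h$ is the function on $(0,\infty)$ whose value at $x$ is $\sigma_h((1-\lambda,\lambda);1,x)$, i.e. the unique $y>0$ with $(1-\lambda)h(1/y)+\lambda h(x/y)=0$ (this equation also defines it for $\lambda=0,1$). *)

(* Defs.v *)
From HB Require Import structures.
From mathcomp Require Import all_boot all_order all_algebra.
From mathcomp Require Import sesquilinear complex.
From mathcomp Require Import all_classical all_reals all_analysis.

Set Implicit Arguments.
Unset Strict Implicit.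
Unset Printing Implicit Defensive.

Import Order.TTheory GRing.Theory Num.Theory.
Import numFieldNormedType.Exports.

Local Open Scope classical_set_scope.
Local Open Scope complex_scope.
Local Open Scope ring_scope.

(* Complex Hilbert spaces. The form hdot is linear in its first argument and
   conjugate-linear in its second one. *)
HB.mixin Record NormedModule_isHilbert (R : realType) H
    of CompleteNormedModule R[i] H := {
  hdot : {dot H for (@Num.conj R[i])} ;
  hdot_norm : forall x : H, `|x| ^+ 2 = hdot x x
}.

#[short(type="hilbertType")]
HB.structure Definition Hilbert (R : realType) :=
  {H of NormedModule_isHilbert R H & CompleteNormedModule R[i] H}.

Section operators.
Context {R : realType} {H : hilbertType R}.
Implicit Types (A B X : H -> H) (f g : R -> R).

Definition bounded_operator A : Prop :=
  linear A /\ exists M : R[i], forall x, `|A x| <= M * `|x|.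

Definition selfadjoint A : Prop := forall x y, hdot (A x) y = hdot x (A y).

(* The order of R[i] is the partial order in which 0 <= z implies that z is
   real. *)
Definition psd A : Prop := forall x, 0 <= hdot (A x) x.

Definition op_le A B : Prop := psd (fun x => B x - A x).

Definition op_invertible A : Prop :=
  exists B, [/\ bounded_operator B, cancel A B & cancel B A].

Definition spectrum A : set R[i] :=
  [set z | ~ op_invertible (fun x => A x - z *: x)].

Definition posinv : set (H -> H) :=
  [set A | [/\ bounded_operator A, psd A & op_invertible A]].

Definition poly_op (q : {poly R}) A : H -> H :=
  fun x => \sum_(k < size q) (q`_k)%:C *: iter k A x.

(* Continuous functional calculus of a bounded self-adjoint A (whose spectrum
   is real): f(A) is the limit in operator norm of q(A) for real polynomials q
   converging to f uniformly on the spectrum of A. *)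
Definition is_fcalc f A B : Prop :=
  forall e : R, 0 < e -> exists q : {poly R},
    (forall t : R, spectrum A t%:C -> `|q.[t] - f t| <= e) /\
    (forall x, `|poly_op q A x - B x| <= e%:C * `|x|).

Definition fcalc f A : H -> H := get [set B | is_fcalc f A B].

Definition op_pow (p : R) A : H -> H := fcalc (fun t => t `^ p) A.

End operators.

(* Continuity is not assumed, since the instances with H finite-dimensional,
   where fcalc applies to every g, already force g to be continuous on the
   positive half-line. *)
Definition operator_monotone (R : realType) (g : R -> R) : Prop :=
  forall (H : hilbertType R) (A B : H -> H),
    bounded_operator A -> selfadjoint A -> (forall z, spectrum A z -> 0 < z) ->
    bounded_operator B -> selfadjoint B -> (forall z, spectrum B z -> 0 < z) ->
    op_le B A -> op_le (fcalc g B) (fcalc g A).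

(* Elements of the class are total functions, of which only the values on the
   positive half-line matter. *)
Definition classL (R : realType) : set (R -> R) :=
  [set g | [/\ operator_monotone g, g 1 = 0 & is_derive (1 : R) (1 : R) g 1]].

(* w i < 1 is automatic for n >= 2; for n = 1 the weight is 1. *)
Definition weights (R : realType) (n : nat) : set ('I_n -> R) :=
  [set w | (forall i, 0 < w i) /\ \sum_(i < n) w i = 1].

(* X = sigma_g(w; A). A relation rather than a function of g, w and A: for g in
   classL, weights w and A i in posinv, existence and uniqueness of the solution
   X of the generalized Karcher equation is a theorem of Palfia. *)
Definition is_sigma (R : realType) (H : hilbertType R) (g : R -> R) (n : nat)
    (w : 'I_n -> R) (A : 'I_n -> H -> H) (X : H -> H) : Prop :=
  posinv X /\
  forall x : H, \sum_(i < n) (w i)%:C *: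
    fcalc g (op_pow (- 2^-1) X \o A i \o op_pow (- 2^-1) X) x = 0.

Definition g_ (R : realType) (p : R) (g : R -> R) : R -> R :=
  fun x => p * g (x `^ p^-1).

(* The value at x is sigma_h((1 - lambda, lambda); 1, x) in the scalar case. *)
Definition repr_fun (R : realType) (h : R -> R) (lambda : R) : R -> R :=
  fun x => get [set y | 0 < y /\
                        (1 - lambda) * h (y^-1) + lambda * h (x / y) = 0].

(* Main.v *)
From HB Require Import structures.
Require Import Defs.
From mathcomp Require Import all_boot all_order all_algebra.
From mathcomp Require Import sesquilinear complex.
From mathcomp Require Import all_classical all_reals all_analysis.
From mathcomp Require Import ring lra.

(** Write K = X^(-1/2), where X >= I solves the Karcher equation of g. Then K is
a contraction, and Hansen's inequality (K A^p K)^(1/p) >= K A K ([hansen])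
together with the monotony of g gives

  sum_i w_i g_p(B_i) >= p sum_i w_i g(K A_i K) = 0,   B_i = K A_i^p K.

So X is a subsolution of the Karcher equation of g_p for the operators A_i^p.
The other half is a comparison principle ([karcher_contraction]): a subsolution
X lies below every solution Y. Hence I <= X <= Y, for all p >= 1 at once.

For the comparison principle put h = g_p and M = X^(1/2) Y^(-1/2), so that the
equation of Y reads sum_i w_i h(M^* B_i M) = 0, and X <= Y says that M is a
contraction. If mu = |M| were larger than 1, then K = M / mu would be a
contraction of norm 1, and M^* B_i M = mu^2 K^* B_i K would dominate K^* (c B_i) K
with room to spare for any c between 1 and mu^2. Jensen's operator inequality
([operator_jensen]) then gives

  K^* h(c B_i) K + h(eps) (1 - K^* K) <= h(M^* B_i M)

for a small eps > 0. As h is strictly increasing, h(c B_i) >= h(B_i) + d for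
some d > 0, and summing over i leaves d K^* K <= |h(eps)| (1 - K^* K). This
bounds |K| away from 1, a contradiction.

Three properties of operator monotone functions enter. They follow
from the definition by a choice of the operators compared:
- Jensen's inequality, by the unitary dilation of a contraction;
- continuity and concavity, by Jensen's inequality on the complex line: the
  functional calculus only reaches functions that polynomials approximate on
  the spectrum, so that continuity comes before anything else;
- strict monotony of g: h and the dual function - h(1/x) are both operator
  monotone, hence concave, so that h is constant as soon as it is constant on
  an interval, and g'(1) = 1 excludes this ([opmon_const]).

That g_p is operator monotone, and Hansen's inequality, both rest on the
Loewner-Heinz inequality ([loewner_heinz]), which is proved by Pedersen's
midpoint argument. The functional calculus rests on one fact
([poly_op_psd]): a real polynomial that is nonnegative on the spectrum of A
is positive semi-definite at A.

The claim on representing functions is scalar: y |-> y^p maps the zeros of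
(1 - lambda) g(1/y) + lambda g(z/y), z = x^(1/p), onto those of the same
expression for g_p and x; the zero exists by the intermediate value theorem and
is unique because g is strictly increasing. *)

Set Implicit Arguments.
Unset Strict Implicit.
Unset Printing Implicit Defensive.

Import Order.TTheory GRing.Theory Num.Theory.
Import numFieldNormedType.Exports.

Local Open Scope classical_set_scope.
Local Open Scope complex_scope.
Local Open Scope ring_scope.

Local Notation Re := complex.Re.
Local Notation Im := complex.Im.

(** * Real inner products and Hilbert spaces *)

(** The discriminant argument behind Cauchy-Schwarz, shared by the inner product
and by the form of a positive operator. The case c = 0 is included because such
a form may vanish on nonzero vectors. *)
Lemma quadratic_discr (R : realFieldType) (a b c : R) : 0 <= c ->
  (forall t, 0 <= a + 2 * t * b + t ^+ 2 * c) -> b ^+ 2 <= a * c.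
Proof.
move=> c0 h; have [c1|c1] := ltP 0 c.
  have := h (- b / c).
  have -> : a + 2 * (- b / c) * b + (- b / c) ^+ 2 * c = (a * c - b ^+ 2) / c.
    by field; rewrite gt_eqF.
  by rewrite pmulr_lge0 ?invr_gt0 // subr_ge0.
have {c0 c1}c0 : c = 0 by apply/eqP; rewrite eq_le c0 c1.
rewrite c0 mulr0 in h *.
have [->|b0] := eqVneq b 0; first by rewrite expr0n.
have := h (- (a + 1) / (2 * b)); rewrite mulr0 addr0.
have -> : a + 2 * (- (a + 1) / (2 * b)) * b = -1 by field.
by rewrite ler0N1.
Qed.

Lemma ReD (R : realType) (z w : R[i]) : Re (z + w) = Re z + Re w.
Proof. by case: z; case: w. Qed.
Lemma ReN (R : realType) (z : R[i]) : Re (- z) = - Re z.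
Proof. by case: z. Qed.
Lemma ReZ (R : realType) (a : R) (z : R[i]) : Re (a%:C * z) = a * Re z.
Proof. by case: z => x y /=; rewrite mul0r subr0. Qed.
Lemma cRe_conj (R : realType) (z : R[i]) : Re (Num.conj z) = Re z.
Proof. by case: z. Qed.

(** The real part of a complex inner product determines it, by Re <x, i y> =
Im <x, y>, and keeps all order and norm estimates inside R. *)
Section real_form.
Context {R : realType} {M : lmodType R[i]} (f : {dot M for (@Num.conj R[i])}).
Definition rform (x y : M) : R := Re (f x y).
Local Notation "<< x , y >>" := (rform x y).

Lemma rformC x y : <<x, y>> = <<y, x>>.
Proof. by rewrite /rform hermC expr0 mul1r cRe_conj. Qed.
Lemma rformDl x y z : <<x + y, z>> = <<x, z>> + <<y, z>>.
Proof. by rewrite /rform linearDl ReD. Qed.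
Lemma rformNl x z : <<- x, z>> = - <<x, z>>.
Proof. by rewrite /rform linearNl ReN. Qed.
Lemma rformZl (a : R) x z : <<a%:C *: x, z>> = a * <<x, z>>.
Proof. by rewrite /rform linearZl_LR ReZ. Qed.
Lemma rformDr x y z : <<z, x + y>> = <<z, x>> + <<z, y>>.
Proof. by rewrite !(rformC z) rformDl. Qed.
Lemma rformNr x z : <<z, - x>> = - <<z, x>>.
Proof. by rewrite !(rformC z) rformNl. Qed.
Lemma rformZr (a : R) x z : <<z, a%:C *: x>> = a * <<z, x>>.
Proof. by rewrite !(rformC z) rformZl. Qed.
Lemma rform0l x : <<0, x>> = 0.
Proof. by rewrite /rform linear0l. Qed.
Lemma rformxxE x : f x x = <<x, x>>%:C.
Proof. by rewrite /rform RRe_real // ger0_real // dnorm_ge0. Qed.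
Lemma rform_ge0 x : 0 <= <<x, x>>.
Proof. by rewrite -ler0c -rformxxE dnorm_ge0. Qed.
Lemma rform_eq0 x : (<<x, x>> == 0) = (x == 0).
Proof. by rewrite -(dnorm_eq0 f) rformxxE (inj_eq (@complexI _)). Qed.
Lemma rform_CS x y : <<x, y>> ^+ 2 <= <<x, x>> * <<y, y>>.
Proof.
apply: quadratic_discr; first exact: rform_ge0.
move=> t; apply: le_trans (rform_ge0 (x + t%:C *: y)) _.
rewrite !(rformDl, rformDr, rformZl, rformZr) (rformC y x).
by rewrite le_eqVlt; apply/orP; left; apply/eqP; ring.
Qed.

Definition rnorm x : R := Num.sqrt <<x, x>>.
Lemma rnorm_sqr x : rnorm x ^+ 2 = <<x, x>>.
Proof. by rewrite sqr_sqrtr ?rform_ge0. Qed.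
Lemma rnorm_ge0 x : 0 <= rnorm x. Proof. exact: sqrtr_ge0. Qed.
Lemma rnormD x y : rnorm (x + y) <= rnorm x + rnorm y.
Proof.
rewrite -ler_sqr ?nnegrE ?addr_ge0 ?rnorm_ge0 // sqrrD !rnorm_sqr.
rewrite rformDl !rformDr (rformC y).
have : <<x, y>> <= rnorm x * rnorm y.
  apply: le_trans (ler_norm _) _.
  rewrite -ler_sqr ?nnegrE ?mulr_ge0 ?rnorm_ge0 // exprMn !rnorm_sqr.
  by rewrite real_normK ?num_real // rform_CS.
lra.
Qed.
Lemma rnormZ (a : R[i]) x : (rnorm (a *: x))%:C = `|a| * (rnorm x)%:C.
Proof.
have e : <<a *: x, a *: x>> = (Re a ^+ 2 + Im a ^+ 2) * <<x, x>>.
  apply: complexI; rewrite -rformxxE rmorphM /= -rformxxE add_Re2_Im2.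
  exact: dnormZ.
by rewrite /rnorm e sqrtrM ?addr_ge0 ?sqr_ge0 // rmorphM /= normc_def.
Qed.
Lemma rnorm_eq0 x : rnorm x = 0 -> x = 0.
Proof.
move=> h; apply/eqP; rewrite -rform_eq0 -rnorm_sqr h expr0n //.
Qed.
End real_form.

(** Completeness is asked in terms of the inner product alone, for Cauchy
filters. An instance thus mentions neither norm nor topology, which are built
from [ip]. *)
HB.factory Record Lmodule_isHilbert (R : realType) M & GRing.Lmodule R[i] M := {
  ip : M -> M -> R[i];
  ip_linearl : forall z a x y, ip (a *: x + y) z = a * ip x z + ip y z;
  ip_herm : forall x y, ip x y = Num.conj (ip y x);
  ip_gt0 : forall x, x != 0 -> 0 < ip x x;
  ip_complete : forall F : set_system M, ProperFilter F ->
    (forall e : R, 0 < e -> exists x, F [set y | Re (ip (x - y) (x - y)) < e]) ->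
    exists l, forall e : R, 0 < e -> F [set y | Re (ip (l - y) (l - y)) < e]
}.

HB.builders Context R M & Lmodule_isHilbert R M.

Fact ip_zmodl u' : zmod_morphism (ip ^~ u').
Proof.
move=> x y; have := ip_linearl u' (-1) y x.
by rewrite scaleN1r addrC => ->; rewrite mulN1r addrC.
Qed.
Fact ip_zmodr u : zmod_morphism (ip u).
Proof. by move=> x y; rewrite ip_herm ip_zmodl rmorphB /= -!ip_herm. Qed.
Fact ip0l z : ip 0 z = 0.
Proof. by rewrite -(subrr 0) ip_zmodl subrr. Qed.
Fact ip_scall u' : scalable_for *%R (ip ^~ u').
Proof. by move=> a x; rewrite -[a *: x]addr0 ip_linearl ip0l addr0. Qed.
Fact ip_scalr u : scalable_for (Num.conj \; *%R) (ip u).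
Proof. by move=> a x; rewrite /= ip_herm ip_scall rmorphM /= -ip_herm. Qed.
HB.instance Definition _ := isBilinear.Build _ _ _ _ _ _ ip ip_zmodl ip_zmodr ip_scall ip_scalr.
Fact ip_hermitian x y : ip x y = (-1) ^+ false * Num.conj (ip y x).
Proof. by rewrite expr0 mul1r -ip_herm. Qed.
HB.instance Definition _ := isHermitianSesquilinear.Build _ _ _ _ ip ip_hermitian.
HB.instance Definition _ := isDotProduct.Build _ _ ip ip_gt0.

Let dot : {dot M for Num.conj} := ip.
Let norm (x : M) : R[i] := (rnorm dot x)%:C.

Fact normD x y : norm (x + y) <= norm x + norm y.
Proof. by rewrite -rmorphD /= lecR rnormD. Qed.
Fact normZ a x : norm (a *: x) = `|a| * norm x.
Proof. exact: rnormZ. Qed.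
Fact norm_eq0 x : norm x = 0 -> x = 0.
Proof. by move=> /complexI /rnorm_eq0. Qed.
HB.instance Definition _ := Lmodule_isNormed.Build R[i] M normD normZ norm_eq0.

Fact complete (F : set_system M) : ProperFilter F -> cauchy F -> cvg F.
Proof.
move=> FF /cauchyP Fc.
have [|l Fl] := @ip_complete F FF.
  move=> e e0; have [|x Fx] := Fc (Num.sqrt e)%:C; first by rewrite ltcR sqrtr_gt0.
  exists x; apply: filterS Fx => y /=; rewrite -ball_normE /=.
  by rewrite ltcR ltr_sqrt.
apply/cvg_ex; exists l; apply/cvgrPdist_lt => e e0.
have [Re0 eE] : 0 < Re e /\ e = (Re e)%:C.
  by rewrite -ltcR RRe_real ?gtr0_real.
have := Fl (Re e ^+ 2); rewrite exprn_gt0 // => /(_ isT).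
apply: filterS => y /= yl; rewrite eE ltcR.
rewrite -ltr_sqr ?nnegrE ?rnorm_ge0 ?ltW // rnorm_sqr //.
Qed.
HB.instance Definition _ := Uniform_isComplete.Build M complete.

Fact dot_norm x : `|x| ^+ 2 = dot x x.
Proof. by rewrite /Num.norm /= -rmorphXn rnorm_sqr rformxxE. Qed.
HB.instance Definition _ := NormedModule_isHilbert.Build R M dot_norm.
HB.end.

Section real_inner_product.
Context {R : realType} {H : hilbertType R}.
Implicit Types (x y z : H) (t : R).

Definition rdot x y : R := Re (hdot x y).
Definition nrm x : R := Num.sqrt (rdot x x).
Local Notation "''[' x , y ]" := (rdot x y) : ring_scope.

Lemma rdotC x y : '[x, y] = '[y, x].
Proof. exact: rformC. Qed.
Lemma rdotDl x y z : '[x + y, z] = '[x, z] + '[y, z].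
Proof. exact: rformDl. Qed.
Lemma rdotNl x z : '[- x, z] = - '[x, z].
Proof. exact: rformNl. Qed.
Lemma rdotZl t x z : '[t%:C *: x, z] = t * '[x, z].
Proof. exact: rformZl. Qed.
Lemma rdotDr x y z : '[z, x + y] = '[z, x] + '[z, y].
Proof. exact: rformDr. Qed.
Lemma rdotNr x z : '[z, - x] = - '[z, x].
Proof. exact: rformNr. Qed.
Lemma rdotZr t x z : '[z, t%:C *: x] = t * '[z, x].
Proof. exact: rformZr. Qed.
Lemma rdot0l x : '[0, x] = 0.
Proof. exact: rform0l. Qed.
Lemma rdotxxE x : hdot x x = '[x, x]%:C.
Proof. exact: rformxxE. Qed.
Lemma rdot_ge0 x : 0 <= '[x, x].
Proof. exact: rform_ge0. Qed.
Lemma rdot_eq0 x : ('[x, x] == 0) = (x == 0).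
Proof. exact: rform_eq0. Qed.
Lemma rdot_CS x y : '[x, y] ^+ 2 <= '[x, x] * '[y, y].
Proof. exact: rform_CS. Qed.

Lemma nrm_sqr x : nrm x ^+ 2 = '[x, x].
Proof. exact: rnorm_sqr. Qed.
Lemma nrm_ge0 x : 0 <= nrm x.
Proof. exact: sqrtr_ge0. Qed.
Lemma nrmD x y : nrm (x + y) <= nrm x + nrm y.
Proof. exact: rnormD. Qed.
Lemma hnormE x : `|x| = (nrm x)%:C.
Proof.
apply/eqP; rewrite -(eqrXn2 (ltn0Sn 1)) ?normr_ge0 ?ler0c ?nrm_ge0 //.
by rewrite hdot_norm -rmorphXn nrm_sqr rdotxxE.
Qed.
Lemma nrmZ (a : R[i]) x : nrm (a *: x) = Re `|a| * nrm x.
Proof.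
by rewrite -[LHS]/(Re (nrm (a *: x))%:C) [X in Re X](rnormZ hdot) mulrC ReZ mulrC.
Qed.
Lemma hnorm_lt x t : 0 <= t -> (`|x| < t%:C) = ('[x, x] < t ^+ 2).
Proof. by move=> t0; rewrite hnormE ltcR -nrm_sqr ltr_sqr ?nnegrE ?nrm_ge0. Qed.
End real_inner_product.

Local Notation "''[' x , y ]" := (rdot x y) : ring_scope.

(** * The complex line and the direct sum of two copies of a Hilbert space *)

Lemma norm_lt_sqr (R : realDomainType) (x e : R) : 0 <= e ->
  (`|x| < e) = (x ^+ 2 < e ^+ 2).
Proof.
by move=> e0; rewrite -[X in _ = (X < _)]real_normK ?num_real // ltr_sqr ?nnegrE ?normr_ge0.
Qed.
Section complex_line.
Variable R : realType.
(** An alias, on which the norm built from the inner product does not meet the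
norm that R[i] already carries. *)
Definition cplx := R[i].
HB.instance Definition _ := GRing.Lmodule.copy cplx (R[i]^o).
Definition cip (x y : cplx) : R[i] := (x : R[i]) * Num.conj (y : R[i]).
Lemma cip_linearl z a x y : cip (a *: x + y) z = a * cip x z + cip y z.
Proof. by rewrite /cip mulrDl -mulrA. Qed.
Lemma cip_herm x y : cip x y = Num.conj (cip y x).
Proof. by rewrite /cip rmorphM /= conjCK mulrC. Qed.
Lemma cip_gt0 x : x != 0 -> 0 < cip x x.
Proof. by move=> x0; rewrite /cip mul_conjC_gt0. Qed.
Lemma cipE x : Re (cip x x) = Re (x : R[i]) ^+ 2 + Im (x : R[i]) ^+ 2.
Proof. by rewrite /cip -normCK -add_Re2_Im2. Qed.
Lemma cip_complete (F : set_system cplx) : ProperFilter F ->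
    (forall e : R, 0 < e -> exists x, F [set y | Re (cip (x - y) (x - y)) < e]) ->
    exists l, forall e : R, 0 < e -> F [set y | Re (cip (l - y) (l - y)) < e].
Proof.
move=> FF Fc.
have cauchy_coord (p : cplx -> R) : (forall x y, p (x - y) = p x - p y) ->
    (forall x, p x ^+ 2 <= Re (cip x x)) -> cvg (p x @[x --> F]).
  move=> pB ple; apply: cauchy_cvg; apply: cauchy_exP => e e0.
  have [|x Fx] := Fc (e ^+ 2); first by rewrite exprn_gt0.
  exists (p x); suff: F [set y | ball (p x) e (p y)] by [].
  apply: filterS Fx => y /=; rewrite -ball_normE /=.
  by move=> /(le_lt_trans (ple _)); rewrite pB norm_lt_sqr // ltW.
have cRe := cauchy_coord (@Re R).
have cIm := cauchy_coord (@Im R).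
have {}cRe : cvg (Re x @[x --> F]).
  apply: cRe => [[a b] [c d]//|x]; rewrite cipE lerDl sqr_ge0 //.
have {}cIm : cvg (Im x @[x --> F]).
  apply: cIm => [[a b] [c d]//|x]; rewrite cipE lerDr sqr_ge0 //.
exists (Complex (lim (Re x @[x --> F])) (lim (Im x @[x --> F]))) => e e0.
have e2 : 0 < Num.sqrt (e / 2) by rewrite sqrtr_gt0 divr_gt0.
have /cvgrPdist_lt/(_ _ e2) h1 := cRe.
have /cvgrPdist_lt/(_ _ e2) h2 := cIm.
apply: filterS2 h1 h2 => -[a b] /= h1 h2.
have hs (u : R) : `|u| < Num.sqrt (e / 2) -> u ^+ 2 < e / 2.
  by rewrite norm_lt_sqr ?sqrtr_ge0 // sqr_sqrtr // divr_ge0 // ltW.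
by have := hs _ h1; have := hs _ h2; rewrite !expr2; lra.
Qed.
HB.instance Definition _ :=
  Lmodule_isHilbert.Build R cplx cip_linearl cip_herm cip_gt0 cip_complete.
End complex_line.

Section direct_sum.
Context {R : realType}.
(** An alias, on which the Hilbert norm does not meet the maximum norm of a
product. *)
Definition dsum (H : hilbertType R) := (H * H)%type.
Variable H : hilbertType R.
HB.instance Definition _ := GRing.Lmodule.copy (dsum H) (H * H)%type.
Definition dip (x y : dsum H) : R[i] := hdot x.1 y.1 + hdot x.2 y.2.
Lemma dip_linearl z a x y : dip (a *: x + y) z = a * dip x z + dip y z.
Proof. by rewrite /dip /= !linearDl !linearZl_LR /=; ring. Qed.
Lemma dip_herm x y : dip x y = Num.conj (dip y x).
Proof. by rewrite /dip rmorphD (hermC _ x.1) (hermC _ x.2) !expr0 !mul1r. Qed.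
Lemma dip_gt0 x : x != 0 -> 0 < dip x x.
Proof.
move=> x0; rewrite lt_def addr_ge0 ?dnorm_ge0 // andbT /dip paddr_eq0 ?dnorm_ge0 //.
rewrite !(dnorm_eq0 hdot); apply: contraNN x0.
by case: x => x1 x2 /= /andP[/eqP -> /eqP ->].
Qed.
Lemma dip_complete (F : set_system (dsum H)) : ProperFilter F ->
    (forall e : R, 0 < e -> exists x, F [set y | Re (dip (x - y) (x - y)) < e]) ->
    exists l, forall e : R, 0 < e -> F [set y | Re (dip (l - y) (l - y)) < e].
Proof.
move=> FF Fc.
have dipE x : Re (dip x x) = '[x.1, x.1] + '[x.2, x.2] by rewrite ReD.
have cauchy_coord (p : dsum H -> H) : (forall x y, p (x - y) = p x - p y) ->
    (forall x, '[p x, p x] <= Re (dip x x)) ->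
    exists l : H, forall e : R, 0 < e -> F [set y | '[l - p y, l - p y] < e].
  move=> pB ple; have /cvg_ex[l pl] : cvg (p x @[x --> F]).
    apply: cauchy_cvg; apply: cauchy_exP => e e0.
    have [|x Fx] := Fc (Re e ^+ 2).
      by rewrite exprn_gt0 // -ltcR RRe_real ?gtr0_real.
    exists (p x); suff: F [set y | ball (p x) e (p y)] by [].
    apply: filterS Fx => y /= xy; rewrite -ball_normE /=.
    have := le_lt_trans (ple _) xy; rewrite pB => {}xy.
    have eE : e = (Re e)%:C by rewrite RRe_real ?gtr0_real.
    by rewrite eE hnorm_lt // -lecR -eE ltW.
  exists l => e e0; have e2 : 0 < (Num.sqrt e)%:C :> R[i] by rewrite ltcR sqrtr_gt0.
  have /cvgrPdist_lt/(_ _ e2) := pl.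
  apply: filterS => y /=; rewrite hnorm_lt ?sqrtr_ge0 //.
  by rewrite sqr_sqrtr ?ltW.
have [|x|l1 h1] := cauchy_coord fst; first by [].
  by rewrite dipE lerDl rdot_ge0.
have [|x|l2 h2] := cauchy_coord snd; first by [].
  by rewrite dipE lerDr rdot_ge0.
exists (l1, l2) => e e0; have e2 : 0 < e / 2 by rewrite divr_gt0.
apply: filterS2 (h1 _ e2) (h2 _ e2) => y /= {}h1 {}h2.
by rewrite dipE /=; lra.
Qed.
HB.instance Definition _ :=
  Lmodule_isHilbert.Build R (dsum H) dip_linearl dip_herm dip_gt0 dip_complete.
End direct_sum.
Lemma hdot_dsum (R : realType) (H : hilbertType R) (x y : dsum H) :
  hdot x y = hdot x.1 y.1 + hdot x.2 y.2.
Proof. by []. Qed.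

(** * Bounded operators *)

Section completeness.
Context {R : realType} {H : hilbertType R}.
Implicit Types (x y z : H) (A B K : H -> H) (t : R).

Lemma nrmN x : nrm (- x) = nrm x.
Proof. by rewrite /nrm rdotNl rdotNr opprK. Qed.
Lemma nrmBC x y : nrm (x - y) = nrm (y - x).
Proof. by rewrite -nrmN opprB. Qed.
Lemma nrm_real t x : nrm (t%:C *: x) = `|t| * nrm x.
Proof.
by rewrite nrmZ normc_def /= expr0n addr0 sqrtr_sqr.
Qed.
Lemma nrm0 : nrm (0 : H) = 0.
Proof. by rewrite /nrm rdot0l sqrtr0. Qed.
Lemma nrm_eq0 x : (nrm x == 0) = (x == 0).
Proof. by rewrite -(rdot_eq0 x) -nrm_sqr sqrf_eq0. Qed.
Lemma nrm_gt0 x : (0 < nrm x) = (x != 0).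
Proof. by rewrite lt_def nrm_eq0 nrm_ge0 andbT. Qed.
Lemma nrm_tri y x z : nrm (x - z) <= nrm (x - y) + nrm (y - z).
Proof. by rewrite -[x - z](subrKA y) nrmD. Qed.
Lemma nrm_CS x y : `|'[x, y]| <= nrm x * nrm y.
Proof.
rewrite -ler_sqr ?nnegrE ?mulr_ge0 ?nrm_ge0 // exprMn !nrm_sqr.
by rewrite real_normK ?num_real // rdot_CS.
Qed.

Lemma hilbert_complete (u : nat -> H) :
  (forall e : R, 0 < e -> exists N, forall n m, (N <= n)%N -> (N <= m)%N ->
     nrm (u n - u m) <= e) ->
  exists l, forall e : R, 0 < e -> exists N, forall n, (N <= n)%N ->
     nrm (u n - l) <= e.
Proof.
move=> uc.
have real_pos (e : R[i]) : 0 < e -> 0 < Re e /\ e = (Re e)%:C.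
  by move=> e0; rewrite -ltcR RRe_real ?gtr0_real.
have : cvg (u @ \oo).
  apply: cauchy_cvg; apply: cauchy_exP => e /real_pos [e0 ->].
  have [|N uN] := uc (Re e / 2); first by rewrite divr_gt0.
  exists (u N), N => // n /= Nn; rewrite -ball_normE /= hnormE ltcR.
  by apply: le_lt_trans (uN _ _ _ _) _ => //; lra.
move=> /cvg_ex[l ul]; exists l => e e0.
have /cvgrPdist_lt/(_ e%:C) := ul; rewrite ltcR e0 => /(_ isT)[N _ uN].
exists N => n Nn; have := uN n Nn; rewrite /= hnormE ltcR nrmBC; exact: ltW.
Qed.

Lemma geometric_small (r e : R) : 0 <= r < 1 -> 0 < e ->
  exists n, forall m, (n <= m)%N -> r ^+ m <= e.
Proof.
move=> /andP[r0 r1] e0; have /cvgrPdist_lt/(_ e e0) : r ^+ n @[n --> \oo] --> (0 : R).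
  by apply: cvg_expr; rewrite ger0_norm.
move=> [n _ h]; exists n => m /h /=; rewrite sub0r normrN ger0_norm ?exprn_ge0 //; exact: ltW.
Qed.

Lemma contraction_fixpoint (phi : H -> H) (r : R) : 0 <= r < 1 ->
  (forall x y, nrm (phi x - phi y) <= r * nrm (x - y)) -> exists x, phi x = x.
Proof.
move=> /andP[r0 r1] hphi; pose u n := iter n phi 0.
have r1' : 0 < 1 - r by lra.
have [C C0 Ce] : exists2 C : R, 0 <= C & C = r * C + nrm (phi 0).
  exists (nrm (phi 0) / (1 - r)); first by rewrite divr_ge0 ?nrm_ge0 // ltW.
  by field; rewrite gt_eqF.
have uC m : nrm (u m - u 0) <= C.
  elim: m => [|m IH]; first by rewrite subrr nrm0.
  apply: le_trans (nrm_tri (u 1) _ _) _ => /=.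
  apply: le_trans (lerD (hphi (u m) (u 0)) (lexx _)) _.
  by rewrite [phi 0 - 0]subr0 [leRHS]Ce lerD2r ler_wpM2l.
have udist n m : nrm (u (n + m)%N - u n) <= C * r ^+ n.
  elim: n => [|n IH]; first by rewrite add0n expr0 mulr1 uC.
  apply: le_trans (hphi _ _) _; rewrite exprS mulrCA.
  by rewrite ler_wpM2l.
have udist2 N n : (N <= n)%N -> nrm (u n - u N) <= C * r ^+ N.
  by move=> Nn; rewrite -(subnKC Nn).
have small (e : R) : 0 < e -> exists N, C * r ^+ N <= e.
  move=> e0; have C1 : 0 < C + 1 by rewrite ltr_wpDl.
  have [| |N h] := @geometric_small r (e / (C + 1)); first by rewrite r0.
    by rewrite divr_gt0.
  exists N; apply: le_trans (ler_wpM2l C0 (h N (leqnn _))) _.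
  by rewrite mulrA ler_pdivrMr // mulrC ler_pM2l //; lra.
have [|l ul] := @hilbert_complete u.
  move=> e e0; have [|N hN] := small (e / 2); first by rewrite divr_gt0.
  exists N => n m Nn Nm; apply: le_trans (nrm_tri (u N) _ _) _.
  by have := udist2 _ _ Nn; have := udist2 _ _ Nm; rewrite (nrmBC (u N) (u m)); lra.
exists l; apply/eqP; rewrite -subr_eq0 -nrm_eq0 eq_le nrm_ge0 andbT.
apply/ler_addgt0Pl => e e0; rewrite addr0.
have [|N hN] := ul (e / 2); first by rewrite divr_gt0.
apply: le_trans (nrm_tri (u N.+1) _ _) _.
have h1 := hN N.+1 (leqnSn _).
have := hphi l (u N) => /=.
have := hN N (leqnn _); rewrite (nrmBC l).
have := @ler_wpM2r _ (nrm (u N - l)) (nrm_ge0 _) r 1; rewrite mul1r => /(_ (ltW r1)).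
rewrite [u N.+1]/= in h1 *.
lra.
Qed.
End completeness.

Lemma cIm_conj (R : realType) (z : R[i]) : Im (Num.conj z) = - Im z.
Proof. by case: z. Qed.
Lemma rcM (R : realType) (a b : R) : (a * b)%:C = a%:C * b%:C.
Proof. exact: rmorphM. Qed.
Lemma Re_normK (R : realType) (a : R[i]) : (Re `|a|)%:C = `|a|.
Proof. by rewrite RRe_real ?normr_real. Qed.

Section linear_ops.
Context {R : realType} {V : lmodType R[i]}.
Variables (A : V -> V) (linA : linear A).
Lemma op0 : A 0 = 0.
Proof. by have := linA (-1) 0 0; rewrite scaler0 addr0 scaleN1r addNr. Qed.
Lemma opD x y : A (x + y) = A x + A y.
Proof. by have := linA 1 x y; rewrite !scale1r. Qed.
Lemma opZ a x : A (a *: x) = a *: A x.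
Proof. by have := linA a x 0; rewrite op0 !addr0. Qed.
Lemma opN x : A (- x) = - A x.
Proof. by rewrite -scaleN1r opZ scaleN1r. Qed.
Lemma opB x y : A (x - y) = A x - A y.
Proof. by rewrite opD opN. Qed.
Lemma op_sum n (F : 'I_n -> V) : A (\sum_(i < n) F i) = \sum_(i < n) A (F i).
Proof. exact: (big_morph A opD op0). Qed.
End linear_ops.

Section operators.
Context {R : realType} {H : hilbertType R}.
Implicit Types (x y z : H) (A B K : H -> H) (t : R).

(** Adjoints only occur in explicit pairs, which spares their construction
from a representation theorem. *)
Definition adjoint_pair K (K' : H -> H) := forall x y, '[K x, y] = '[x, K' y].

Lemma bounded_nrmP A : bounded_operator A <->
  linear A /\ exists2 M : R, 0 < M & forall x, nrm (A x) <= M * nrm x.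
Proof.
split=> [[lA [M hM]]|[lA [M M0 hM]]]; split=> //; last first.
  by exists M%:C => x; rewrite !hnormE -rmorphM lecR.
exists (Re `|M| + 1) => [|x].
  by rewrite ltr_wpDl // -ler0c Re_normK.
have h : `|A x| <= `|M| * `|x|.
  have h0 : 0 <= M * `|x| := le_trans (normr_ge0 _) (hM x).
  by rewrite -(normr_id x) -normrM ger0_norm.
apply: (@le_trans _ _ (Re `|M| * nrm x)); last by rewrite ler_wpM2r ?nrm_ge0 // lerDl.
by rewrite -lecR rcM Re_normK -!hnormE.
Qed.

Lemma Im_hdot x y : Im (hdot x y) = '[x, (Complex 0 1) *: y].
Proof.
rewrite /rdot linearZr_LR /=; case: (hdot x y) => a b /=.
by rewrite mul0r sub0r mulN1r opprK.
Qed.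

Lemma selfadjoint_pairP A : linear A -> selfadjoint A <-> adjoint_pair A A.
Proof.
move=> lA; split=> sA x y; first by rewrite /rdot sA.
apply/eqP; rewrite eq_complex; apply/andP; split; apply/eqP; first exact: sA.
by rewrite !Im_hdot sA opZ.
Qed.

(** Polarisation: the form of A is real at x + y and at x + i y, which settles
the imaginary and the real part of <A x, y> - <x, A y>. *)
Lemma psd_selfadjoint A : linear A -> psd A -> selfadjoint A.
Proof.
move=> lA pA.
have im0 x y : Im (hdot (A x) y + hdot (A y) x) = 0.
  have := ger0_Im (pA (x + y)).
  rewrite opD // linearDl !linearDr /=.
  have := ger0_Im (pA x); have := ger0_Im (pA y).
  case: (hdot (A x) x) (hdot (A x) y) (hdot (A y) x) (hdot (A y) y)
    => [? ?] [? ?] [? ?] [? ?] /=; lra.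
move=> x y; rewrite [RHS]hermC expr0 mul1r.
have := im0 x y; have := im0 x (Complex 0 1 *: y).
rewrite opZ // linearZl_LR linearZr_LR /=.
case: (hdot (A x) y) (hdot (A y) x) => [a b] [c d] /= e1 e2.
apply/eqP; rewrite eq_complex /=; apply/andP; split; apply/eqP; lra.
Qed.

Lemma selfadjoint_psdP A : linear A -> selfadjoint A ->
  psd A <-> forall x, 0 <= '[A x, x].
Proof.
move=> lA sA; split=> h x.
  by have := h x; rewrite lecE => /andP[_].
rewrite lecE h andbT; have := sA x x; rewrite [RHS]hermC expr0 mul1r.
by move=> /(congr1 (@Im R)); rewrite cIm_conj => h'; apply/eqP => /=; lra.
Qed.

Lemma bounded_id : bounded_operator (@id H).
Proof. by apply/bounded_nrmP; split=> //; exists 1 => // x; rewrite mul1r. Qed.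

Lemma bounded_comp A B :
  bounded_operator A -> bounded_operator B -> bounded_operator (A \o B).
Proof.
move=> /bounded_nrmP[lA [M M0 hM]] /bounded_nrmP[lB [N N0 hN]].
apply/bounded_nrmP; split; first by move=> a x y; rewrite /= lB lA.
exists (M * N) => [|x]; first exact: mulr_gt0.
by apply: le_trans (hM _) _; rewrite -mulrA ler_pM2l.
Qed.

Lemma bounded_add A B : bounded_operator A -> bounded_operator B ->
  bounded_operator (fun x => A x + B x).
Proof.
move=> /bounded_nrmP[lA [M M0 hM]] /bounded_nrmP[lB [N N0 hN]].
apply/bounded_nrmP; split.
  by move=> a x y /=; rewrite lB lA scalerDr addrACA.
exists (M + N) => [|x]; first exact: addr_gt0.
by apply: le_trans (nrmD _ _) _; rewrite mulrDl lerD.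
Qed.

Lemma bounded_scale a A : bounded_operator A -> bounded_operator (fun x => a *: A x).
Proof.
move=> /bounded_nrmP[lA [M M0 hM]]; apply/bounded_nrmP; split.
  by move=> b x y /=; rewrite lA scalerDr !scalerA mulrC.
have a0 : 0 <= Re `|a| by rewrite -ler0c Re_normK.
exists (Re `|a| * M + 1) => [|x]; first by rewrite ltr_wpDl // mulr_ge0 // ltW.
rewrite nrmZ mulrDl -mulrA; apply: le_trans (ler_wpM2l a0 (hM x)) _.
by rewrite lerDl mul1r nrm_ge0.
Qed.

Lemma bounded_shift A (z : R[i]) : bounded_operator A -> bounded_operator (fun x => A x - z *: x).
Proof.
move=> bA; have := bounded_add bA (bounded_scale (- z) bounded_id).
by congr bounded_operator; apply/funext => x; rewrite scaleNr.
Qed.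

Lemma op_invertible_of A (c : R) : linear A -> (forall y, exists x, A x = y) ->
  0 < c -> (forall x, c * nrm x <= nrm (A x)) -> op_invertible A.
Proof.
move=> lA /choice[B hB] c0 hc.
have Ainj x y : A x = A y -> x = y.
  move=> e; apply/eqP; rewrite -subr_eq0 -nrm_eq0 eq_le nrm_ge0 andbT.
  by have := hc (x - y); rewrite opB // e subrr nrm0 pmulr_rle0.
exists B; split=> [||x]; last exact: hB.
  apply/bounded_nrmP; split.
    by move=> a x y; apply: Ainj; rewrite lA !hB.
  exists c^-1 => [|x]; first by rewrite invr_gt0.
  by rewrite -ler_pdivrMl ?invr_gt0 // invrK -[in leRHS](hB x).
by move=> x; apply: Ainj; rewrite hB.
Qed.

Lemma op_invertible_below A : op_invertible A ->
  exists2 c : R, 0 < c & forall x, c * nrm x <= nrm (A x).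
Proof.
move=> [B [/bounded_nrmP[lB [M M0 hM]] AB BA]]; exists M^-1 => [|x].
  by rewrite invr_gt0.
by rewrite ler_pdivrMl // -[in leLHS](AB x).
Qed.

Lemma op_invertible_comp A B : op_invertible A -> op_invertible B -> op_invertible (A \o B).
Proof.
move=> [A' [bA AA A'A]] [B' [bB BB B'B]]; exists (B' \o A'); split.
- exact: bounded_comp.
- by move=> x /=; rewrite AA BB.
- by move=> x /=; rewrite B'B A'A.
Qed.

Lemma op_invertible_scale a A : bounded_operator A -> a != 0 ->
  op_invertible A -> op_invertible (fun x => a *: A x).
Proof.
move=> [lA _] a0 [A' [bA AA A'A]]; exists (A' \o ( *:%R a^-1)); split.
- by apply: bounded_comp bA (bounded_scale _ bounded_id).
- by move=> x /=; rewrite scalerA mulVf // scale1r AA.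
- by move=> x /=; rewrite A'A scalerA mulfV // scale1r.
Qed.

(** Lax-Milgram. A coercive operator is bounded below, hence injective with
bounded inverse on its range; it is onto because A x = y is the fixed point
equation of x |-> x - t (A x - y), a contraction for small t. *)
Lemma coercive_invertible A (c : R) : bounded_operator A -> 0 < c ->
  (forall x, c * '[x, x] <= '[A x, x]) -> op_invertible A.
Proof.
move=> /bounded_nrmP[lA [M M0 hM]] c0 hc.
have below x : c * nrm x <= nrm (A x).
  have [->|x0] := eqVneq x 0; first by rewrite op0 // nrm0 mulr0.
  have xp : 0 < nrm x by rewrite nrm_gt0.
  rewrite -(ler_pM2r xp) -mulrA -expr2 nrm_sqr; apply: le_trans (hc x) _.
  exact: le_trans (ler_norm _) (nrm_CS _ _).
apply: (op_invertible_of lA _ c0 below) => y.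
(* This t minimises the bound 1 - 2 t c + t^2 M^2 for the squared norm of
   1 - t A. *)
pose t := c / M ^+ 2; have t0 : 0 < t by rewrite divr_gt0 ?exprn_gt0.
pose phi x := x - t%:C *: A x + t%:C *: y.
pose r2 := 1 - c ^+ 2 / M ^+ 2.
have sq x : '[x - t%:C *: A x, x - t%:C *: A x] <= r2 * '[x, x].
  rewrite !(rdotDl, rdotDr, rdotNl, rdotNr, rdotZl, rdotZr) (rdotC x (A x)).
  have h1 := hc x.
  have h2 : '[A x, A x] <= M ^+ 2 * '[x, x].
    rewrite -!nrm_sqr -exprMn ler_sqr ?nnegrE ?mulr_ge0 ?nrm_ge0 ?hM // ltW //.
  have := ler_wpM2l (ltW t0) h1; have := ler_wpM2l (sqr_ge0 t) h2.
  have -> : t ^+ 2 * (M ^+ 2 * '[x, x]) = t * (c * '[x, x]).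
    by rewrite /t; field; rewrite gt_eqF.
  have -> : r2 * '[x, x] = '[x, x] - t * (c * '[x, x]).
    by rewrite /t /r2; field; rewrite gt_eqF.
  rewrite expr2; lra.
(* The bound r2 is negative only if H is trivial; 0 is then a contraction
   factor. *)
have [r /andP[r0 r1] hr] : exists2 r : R, 0 <= r < 1 &
    forall x, nrm (x - t%:C *: A x) <= r * nrm x.
  have [r20|r20] := lerP 0 r2.
    exists (Num.sqrt r2) => [|x].
      rewrite sqrtr_ge0 /= -[ltRHS]sqrtr1 ltr_sqrt // /r2 ltrBlDr ltrDl.
      by rewrite divr_gt0 ?exprn_gt0.
    by rewrite /nrm -sqrtrM // ler_wsqrtr // sq.
  exists 0 => [|x]; first by rewrite lexx ltr01.
  rewrite mul0r /nrm -sqrtr0 ler_wsqrtr //.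
  by apply: le_trans (sq _) _; rewrite nmulr_rle0 // rdot_ge0.
have [||x hx] := @contraction_fixpoint R H phi r; first by rewrite r0.
  move=> x x'; rewrite /phi.
  rewrite opprD addrACA subrr addr0.
  have -> : x - t%:C *: A x - (x' - t%:C *: A x') = (x - x') - t%:C *: A (x - x').
    by rewrite (opB lA) scalerBr !opprB addrACA [RHS]addrACA; congr (_ + _); exact: addrC.
  exact: hr.
exists x; move: hx; rewrite /phi -addrA => /eqP; rewrite -subr_eq0 addrAC subrr add0r addrC.
rewrite -scalerBr scaler_eq0 subr_eq0 => /orP[|/eqP->//].
by rewrite (inj_eq (@complexI _) t 0) gt_eqF.
Qed.
End operators.

(** * The spectrum of a self-adjoint operator *)

Section spectrum_bounds.
Context {R : realType} {H : hilbertType R}.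
Implicit Types (x y z : H) (A B K : H -> H) (t : R).

Definition hermop A : Prop := bounded_operator A /\ selfadjoint A.

Lemma hermopP A : hermop A <-> bounded_operator A /\ adjoint_pair A A.
Proof.
by split=> -[bA sA]; split=> //; apply/selfadjoint_pairP => //; case: bA.
Qed.

Lemma op_invertible_ext A B : A =1 B -> op_invertible A -> op_invertible B.
Proof. by move=> /funext ->. Qed.

Lemma selfadjoint_Im0 A x : selfadjoint A -> Im (hdot (A x) x) = 0.
Proof.
move=> sA; have := sA x x; rewrite [RHS]hermC expr0 mul1r.
move=> /(congr1 (@Im R)); rewrite cIm_conj; lra.
Qed.

(** Multiplication of A - z by i Im z makes the operator coercive, because A
then contributes an imaginary number to the quadratic form. *)
Lemma shift_invertible_im A (z : R[i]) : hermop A -> Im z != 0 ->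
  op_invertible (fun x => A x - z *: x).
Proof.
move=> [bA sA] z0.
pose u : R[i] := Complex 0 (Im z).
have u0 : u != 0 by rewrite eq_complex /= eqxx z0.
pose B x := u *: (A x - z *: x).
have bB : bounded_operator B by exact/bounded_scale/bounded_shift.
have : op_invertible B.
  apply: (@coercive_invertible _ _ _ (Im z ^+ 2)) => //.
    by rewrite exprn_even_gt0 //= z0.
  move=> x; have lA := bA.1.
  have -> : '[B x, x] = Im z ^+ 2 * '[x, x]; last exact: lexx.
  rewrite /B /rdot linearZl_LR linearBl linearZl_LR /= rdotxxE.
  have := selfadjoint_Im0 x sA.
  rewrite /u; move: '[x, x] => r.
  case: (hdot (A x) x) (z) => a b [z1 z2] /= ->; rewrite expr2; ring.
move=> /(op_invertible_scale bB (a := u^-1)); rewrite invr_eq0 => /(_ u0).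
by apply: op_invertible_ext => x; rewrite /B scalerA mulVf // scale1r.
Qed.

Lemma spectrum_real A (z : R[i]) : hermop A -> spectrum A z -> z = (Re z)%:C.
Proof.
move=> hA; rewrite /spectrum /=; apply: contra_notP => h.
apply: shift_invertible_im hA _; apply: contra_notN h => /eqP z0.
by apply/eqP; rewrite eq_complex /= z0 !eqxx.
Qed.

Lemma spectrum_ge A (m t : R) : hermop A -> (forall x, m * '[x, x] <= '[A x, x]) ->
  spectrum A t%:C -> m <= t.
Proof.
move=> [bA sA] hm; rewrite /spectrum /=; apply: contra_notT; rewrite -ltNge => tm.
apply: (@coercive_invertible _ _ _ (m - t)); first exact: bounded_shift.
  by rewrite subr_gt0.
move=> x; rewrite rdotDl rdotNl rdotZl; have := hm x; lra.
Qed.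

Lemma spectrum_le A (m t : R) : hermop A -> (forall x, '[A x, x] <= m * '[x, x]) ->
  spectrum A t%:C -> t <= m.
Proof.
move=> [bA sA] hm; rewrite /spectrum /=; apply: contra_notT; rewrite -ltNge => tm.
have bB := bounded_scale (-1) (bounded_shift t%:C bA).
have : op_invertible (fun x => (-1) *: (A x - t%:C *: x)).
  apply: (@coercive_invertible _ _ _ (t - m)) => //.
    by rewrite subr_gt0.
  move=> x; rewrite scaleN1r rdotNl rdotDl rdotNl rdotZl; have := hm x; lra.
move=> /(op_invertible_scale bB (a := -1)); rewrite oppr_eq0 oner_eq0 => /(_ isT).
by apply: op_invertible_ext => x; rewrite scalerA mulrNN mulr1 scale1r.
Qed.

Lemma herm_bounds A : hermop A -> exists2 M : R, 0 < M & forall x, `|'[A x, x]| <= M * '[x, x].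
Proof.
move=> [/bounded_nrmP[lA [M M0 hM]] sA]; exists M => // x.
apply: le_trans (nrm_CS _ _) _; rewrite -nrm_sqr expr2 mulrA ler_wpM2r //.
exact: nrm_ge0.
Qed.

Lemma psd_CS A x y : hermop A -> (forall x, 0 <= '[A x, x]) ->
  '[A x, y] ^+ 2 <= '[A x, x] * '[A y, y].
Proof.
move=> /hermopP[[lA _] sA] h; apply: quadratic_discr => // t.
apply: le_trans (h (x + t%:C *: y)) _.
rewrite opD // opZ // !(rdotDl, rdotDr, rdotZl, rdotZr).
by rewrite (sA y x) (rdotC y (A x)) le_eqVlt; apply/orP; left; apply/eqP; ring.
Qed.

Lemma herm_shift A t : hermop A -> hermop (fun x => A x - t%:C *: x).
Proof.
move=> /hermopP[bA sA]; apply/hermopP; split; first exact: bounded_shift.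
by move=> x y; rewrite !(rdotDl, rdotDr, rdotNl, rdotNr, rdotZl, rdotZr) sA.
Qed.

(** An invertible operator is bounded below, whereas Cauchy-Schwarz for the form
of A gives |A x|^2 <= M <A x, x>. *)
Lemma psd_small_not_invertible A : hermop A -> (forall x, 0 <= '[A x, x]) ->
  (forall e : R, 0 < e -> exists2 x, '[x, x] = 1 & '[A x, x] <= e) ->
  ~ op_invertible A.
Proof.
move=> hA pA small /op_invertible_below[c c0 hc].
have [M M0 hM] := herm_bounds hA.
have [|x x1 xe] := small (c ^+ 2 / (2 * M)); first by rewrite divr_gt0 ?exprn_gt0 ?mulr_gt0.
have := hc x; rewrite -ler_sqr ?nnegrE ?mulr_ge0 ?nrm_ge0 ?(ltW c0) //.
rewrite exprMn !nrm_sqr x1 mulr1 => cA.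
have := psd_CS x (A x) hA pA.
have h2 := le_trans (ler_norm _) (hM (A x)).
have h3 : '[A x, x] * '[A (A x), A x] <= c ^+ 2 / (2 * M) * (M * '[A x, A x]).
  by rewrite ler_pM.
move=> h1; have {h1 h3} := le_trans h1 h3.
have -> : c ^+ 2 / (2 * M) * (M * '[A x, A x]) = c ^+ 2 / 2 * '[A x, A x].
  by field; rewrite gt_eqF.
have c2 : 0 < c ^+ 2 by rewrite exprn_gt0.
have Ap : 0 < '[A x, A x] by exact: lt_le_trans cA.
rewrite expr2 ler_pM2r //; lra.
Qed.

(** The infimum m of the form of A over the unit sphere is approached by unit
vectors, so [psd_small_not_invertible] applies to A - m. The vector [x0]
excludes the zero space, on which every spectrum is empty. *)
Lemma bottom_spectrum A x0 : hermop A -> x0 != 0 ->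
  exists2 m : R, spectrum A m%:C & forall x, m * '[x, x] <= '[A x, x].
Proof.
move=> hA x00; have [M M0 hM] := herm_bounds hA.
pose S := [set '[A x, x] | x in [set x | '[x, x] = 1]].
have lA := hA.1.1.
have normalize x : x != 0 -> exists u, [/\ '[u, u] = 1, 0 < nrm x & x = (nrm x)%:C *: u].
  move=> xn0; have xp : 0 < nrm x by rewrite nrm_gt0.
  exists ((nrm x)^-1%:C *: x); split => //.
    by rewrite rdotZl rdotZr -nrm_sqr expr2; field; rewrite gt_eqF.
  by rewrite scalerA -rcM mulfV ?gt_eqF // scale1r.
have S0 : S !=set0 by have [u [u1 _ _]] := normalize _ x00; exists '[A u, u], u.
have Slb : has_lbound S.
  exists (- M) => _ [x /= x1 <-]; have := hM x; rewrite x1 mulr1.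
  by rewrite ler_norml => /andP[].
have mlb x : inf S * '[x, x] <= '[A x, x].
  have [->|xn0] := eqVneq x 0; first by rewrite (op0 lA) !rdot0l mulr0.
  have [u [u1 xp ->]] := normalize _ xn0.
  rewrite (opZ lA) !(rdotZl, rdotZr) u1.
  have := ge_inf Slb (ex_intro2 _ _ u u1 erefl).
  by rewrite mulr1 mulrCA ler_pM2l // mulrC ler_pM2l.
exists (inf S) => //; rewrite /spectrum /=.
apply: psd_small_not_invertible; first exact: herm_shift.
  by move=> x; rewrite rdotDl rdotNl rdotZl subr_ge0.
move=> e e0; have [_ [x /= x1 <-] xe] := inf_adherent e0 (conj S0 Slb).
exists x => //; rewrite rdotDl rdotNl rdotZl x1; lra.
Qed.

End spectrum_bounds.

(** * Polynomials of an operator *)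

Section poly_calculus.
Context {R : realType} {H : hilbertType R}.
Implicit Types (x y : H) (A B K : H -> H) (t : R).

(** Complex coefficients let polynomials split into linear factors. *)
Definition cpoly_op (q : {poly R[i]}) A : H -> H :=
  fun x => \sum_(k < size q) q`_k *: iter k A x.

Lemma poly_opE (q : {poly R}) A : poly_op q A = cpoly_op (map_poly (real_complex R) q) A.
Proof.
apply/funext => x; rewrite /poly_op /cpoly_op size_map_inj_poly //; last exact: complexI.
by apply: eq_bigr => k _; rewrite coef_map.
Qed.

Lemma cpoly_op_wide (n : nat) (q : {poly R[i]}) A x : (size q <= n)%N ->
  cpoly_op q A x = \sum_(k < n) q`_k *: iter k A x.
Proof.
move=> qn; rewrite /cpoly_op (big_ord_widen n (fun k => q`_k *: iter k A x) qn).
rewrite big_mkcond; apply: eq_bigr => k _; case: ltnP => // h.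
by rewrite nth_default // scale0r.
Qed.

Lemma cpoly_opC c A x : cpoly_op c%:P A x = c *: x.
Proof.
by rewrite (@cpoly_op_wide 1) ?size_polyC_leq1 // big_ord1 coefC.
Qed.

Lemma cpoly_opD p q A x : cpoly_op (p + q) A x = cpoly_op p A x + cpoly_op q A x.
Proof.
have h := size_polyD p q.
rewrite (cpoly_op_wide _ _ h) (cpoly_op_wide _ _ (leq_maxl _ (size q))).
rewrite (cpoly_op_wide _ _ (leq_maxr (size p) _)) -big_split /=.
by apply: eq_bigr => k _; rewrite coefD scalerDl.
Qed.

Section linear.
Variables (A : H -> H) (lA : linear A).

Lemma cpoly_opMX p x : cpoly_op (p * 'X) A x = A (cpoly_op p A x).
Proof.
rewrite (@cpoly_op_wide (size p).+1) ?(leq_trans (size_polyMleq _ _)) ?size_polyX ?addn2 //.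
rewrite big_ord_recl coefMX /= scale0r add0r /cpoly_op (op_sum lA).
by apply: eq_bigr => k _; rewrite coefMX /= (opZ lA).
Qed.

Lemma cpoly_opM p q x : cpoly_op (p * q) A x = cpoly_op p A (cpoly_op q A x).
Proof.
elim/poly_ind: p x => [|p c IH] x.
  by rewrite mul0r -[0]/(0%:P) !cpoly_opC !scale0r.
rewrite mulrDl -mulrA -(commr_polyX q) mulrA !cpoly_opD cpoly_opMX IH.
rewrite cpoly_opMX mul_polyC; congr (_ + _).
rewrite cpoly_opC (cpoly_op_wide _ _ (size_scale_leq _ _)) /cpoly_op scaler_sumr.
by apply: eq_bigr => k _; rewrite coefZ scalerA.
Qed.

Lemma cpoly_op_shift (z : R[i]) x : cpoly_op ('X - z%:P) A x = A x - z *: x.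
Proof.
by rewrite -polyCN cpoly_opD cpoly_opC scaleNr -['X]mul1r cpoly_opMX -[1]/(1%:P) cpoly_opC scale1r.
Qed.

(** p(A) is a multiple of the product of the operators A - z over the roots z of
p, each of which is invertible. *)
Lemma cpoly_op_invertible (p : {poly R[i]}) : bounded_operator A -> p != 0 ->
  (forall z : R[i], root p z -> ~ spectrum A z) -> op_invertible (cpoly_op p A).
Proof.
move=> bA p0; have [rs pE] := closed_field_poly_normal p.
have lp0 : lead_coef p != 0 by rewrite lead_coef_eq0.
rewrite pE => hroot.
have {}hroot z : z \in rs -> op_invertible (fun x => A x - z *: x).
  move=> zrs; apply: contrapT; apply: hroot.
  by rewrite rootZ // root_prod_XsubC.
have : op_invertible (cpoly_op (\prod_(z <- rs) ('X - z%:P)) A).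
  elim: rs hroot {pE} => [_|z rs IH hroot].
    rewrite big_nil; exists id; split => [|x|x]; first exact: bounded_id.
      by rewrite -[1]/(1%:P) cpoly_opC scale1r.
    by rewrite -[1]/(1%:P) cpoly_opC scale1r.
  rewrite big_cons.
  apply: (@op_invertible_ext _ _ ((fun x => A x - z *: x) \o
      cpoly_op (\prod_(j <- rs) ('X - j%:P)) A)).
    by move=> x; rewrite cpoly_opM cpoly_op_shift.
  apply: op_invertible_comp; first by apply: hroot; rewrite mem_head.
  by apply: IH => w wrs; apply: hroot; rewrite in_cons wrs orbT.
move=> hinv; rewrite -mul_polyC.
have := op_invertible_comp (_ : op_invertible (fun x => lead_coef p *: x)) hinv.
move=> /(_ (op_invertible_scale bounded_id lp0 _)) h.
apply: op_invertible_ext (h _); first by move=> x; rewrite cpoly_opM cpoly_opC.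
by exists id; split => //; exact: bounded_id.
Qed.
End linear.

Lemma poly_op_bounded q A : bounded_operator A -> bounded_operator (poly_op q A).
Proof.
move=> bA; rewrite poly_opE; elim/poly_ind: (map_poly _ q) => [|p c IH].
  rewrite (_ : cpoly_op 0 A = fun x => 0 *: id x); last first.
    by apply/funext => x; rewrite -[0 in LHS]/(0%:P) cpoly_opC.
  exact/bounded_scale/bounded_id.
have := bounded_add (bounded_comp bA IH) (bounded_scale c bounded_id).
congr bounded_operator; apply/funext => x.
by rewrite cpoly_opD cpoly_opMX ?cpoly_opC //; case: bA.
Qed.

Lemma poly_opC c A x : poly_op c%:P A x = c%:C *: x.
Proof. by rewrite poly_opE map_polyC cpoly_opC. Qed.
Lemma poly_opD p q A x : poly_op (p + q) A x = poly_op p A x + poly_op q A x.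
Proof. by rewrite !poly_opE rmorphD cpoly_opD. Qed.
Lemma poly_opM p q A x : linear A -> poly_op (p * q) A x = poly_op p A (poly_op q A x).
Proof. by move=> lA; rewrite !poly_opE rmorphM cpoly_opM. Qed.
Lemma poly_opX A x : poly_op 'X A x = A x.
Proof.
by rewrite poly_opE map_polyX (@cpoly_op_wide 2) ?size_polyX // 2!big_ord_recl big_ord0
  !coefX /= scale0r scale1r add0r addr0.
Qed.
Lemma poly_opZ c p A x : linear A -> poly_op (c *: p) A x = c%:C *: poly_op p A x.
Proof. by move=> lA; rewrite -mul_polyC poly_opM // poly_opC. Qed.
Lemma poly_opB p q A x : linear A -> poly_op (p - q) A x = poly_op p A x - poly_op q A x.
Proof. by move=> lA; rewrite poly_opD -[- q]scaleN1r poly_opZ // rmorphN1 scaleN1r. Qed.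

Lemma poly_op_herm q A : hermop A -> hermop (poly_op q A).
Proof.
move=> /hermopP[bA sA]; apply/hermopP; split; first exact: poly_op_bounded.
elim/poly_ind: q => [|p c IH] x y.
  by rewrite -[0]/(0%:P) !poly_opC rdotZl rdotZr.
have lA := bA.1.
rewrite !poly_opD !poly_opC.
rewrite rdotDl rdotDr rdotZl rdotZr; congr (_ + _).
by rewrite poly_opM // poly_opX IH sA mulrC poly_opM // poly_opX.
Qed.

(** The half of the spectral mapping theorem that the functional calculus needs.
The bottom m of the spectrum of q(A) is a spectral value. If it were negative,
q - m would have no root in the spectrum of A, and [cpoly_op_invertible] would
make q(A) - m invertible. *)
Lemma poly_op_psd q A : hermop A -> (forall t, spectrum A t%:C -> 0 <= q.[t]) ->
  forall x, 0 <= '[poly_op q A x, x].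
Proof.
move=> hA hq x; have [->|x0] := eqVneq x 0.
  by rewrite rdotC rdot0l.
have [m mspec hm] := bottom_spectrum (poly_op_herm q hA) x0.
have [m0|m0] := leP 0 m; first by apply: le_trans (hm x); rewrite mulr_ge0 // rdot_ge0.
have bA := hA.1; have lA := bA.1; exfalso.
have shiftE y : cpoly_op (map_poly (real_complex R) (q - m%:P)) A y = poly_op q A y - m%:C *: y.
  by rewrite -poly_opE poly_opB // poly_opC.
have [q0|q0] := eqVneq (q - m%:P) 0.
  have [t tspec _] := bottom_spectrum hA x0.
  have := hq t tspec; have /eqP := q0; rewrite subr_eq0 => /eqP ->.
  by rewrite hornerC leNgt m0.
apply: mspec; apply: op_invertible_ext shiftE _.
apply: cpoly_op_invertible => //; first by rewrite map_poly_eq0.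
move=> z rz zspec; have zE := spectrum_real hA zspec.
move: rz zspec; rewrite zE => rz /hq qz.
move: rz; rewrite /root horner_map fmorph_eq0 hornerD hornerN hornerC subr_eq0 => /eqP e.
by move: qz; rewrite e leNgt m0.
Qed.

(** [poly_op_psd] for e^2 - q^2, as |q(A) x|^2 = <q(A)^2 x, x>. *)
Lemma poly_op_bound q A (e : R) : hermop A -> 0 <= e ->
  (forall t, spectrum A t%:C -> `|q.[t]| <= e) ->
  forall x, nrm (poly_op q A x) <= e * nrm x.
Proof.
move=> hA e0 hq x; have lA := hA.1.1.
have /hermopP[_ sq] := poly_op_herm q hA.
have := @poly_op_psd ((e ^+ 2)%:P - q * q) A hA _ x.
rewrite poly_opB // poly_opC poly_opM // rdotDl rdotNl rdotZl sq subr_ge0 -!nrm_sqr => h.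
rewrite -ler_sqr ?nnegrE ?mulr_ge0 ?nrm_ge0 // exprMn; apply: h => t /hq h.
rewrite hornerD hornerN hornerM hornerC subr_ge0 -expr2 -real_normK ?num_real //.
by rewrite ler_sqr ?nnegrE.
Qed.
End poly_calculus.

(** * The continuous functional calculus *)

(** For compact S this is continuity of f on S, in the form in which the
functional calculus uses it. *)
Definition approximable (R : realType) (f : R -> R) (S : set R) : Prop :=
  forall e : R, 0 < e -> exists q : {poly R}, forall t, S t -> `|q.[t] - f t| <= e.

Lemma approximable_sub (R : realType) (f : R -> R) (S S' : set R) :
  S' `<=` S -> approximable f S -> approximable f S'.
Proof. by move=> SS h e /h[q hq]; exists q => t /SS /hq. Qed.

Lemma ler_eps (R : realType) (a b c : R) : 0 <= c ->
  (forall e : R, 0 < e -> a <= b + e * c) -> a <= b.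
Proof.
move=> c0 h; apply/ler_addgt0Pr => e e0.
apply: le_trans (h (e / (c + 1)) _) _; first by rewrite divr_gt0 // ltr_wpDl.
rewrite lerD2l mulrAC ler_pdivrMr ?ltr_wpDl //; nra.
Qed.

Lemma ler_eps0 (R : realType) (a c : R) : 0 <= c ->
  (forall e : R, 0 < e -> a <= e * c) -> a <= 0.
Proof. by move=> c0 h; apply: (ler_eps c0) => e /h; rewrite add0r. Qed.

Definition rspec (R : realType) (H : hilbertType R) (A : H -> H) : set R :=
  [set t : R | spectrum A t%:C].

Section functional_calculus.
Context {R : realType} {H : hilbertType R}.
Implicit Types (x y : H) (A B F G : H -> H) (t : R) (f g : R -> R).

Lemma nrm_eps (x : H) (c : R) : 0 <= c ->
  (forall e : R, 0 < e -> nrm x <= e * c) -> x = 0.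
Proof.
move=> c0 h; apply/eqP; rewrite -nrm_eq0 eq_le nrm_ge0 andbT.
exact: (ler_eps0 c0).
Qed.

(** [is_fcalc] provides some polynomials near f whose values at A are near B.
By [poly_op_bound] every polynomial near f on the spectrum is as good, which
gives uniqueness of B. *)
Lemma fcalc_approx f A B q (e : R) : hermop A -> is_fcalc f A B -> 0 <= e ->
  (forall t, rspec A t -> `|q.[t] - f t| <= e) ->
  forall x, nrm (poly_op q A x - B x) <= e * nrm x.
Proof.
move=> hA hB e0 hq x; have lA := hA.1.1.
apply: (@ler_eps _ _ _ (2 * nrm x)); first by rewrite mulr_ge0 ?nrm_ge0.
move=> d d0; have [q' [hq' hx]] := hB d d0.
apply: le_trans (nrm_tri (poly_op q' A x) _ _) _.
have h1 : nrm (poly_op q A x - poly_op q' A x) <= (e + d) * nrm x.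
  rewrite -poly_opB //; apply: poly_op_bound => // [|t tA]; first by rewrite addr_ge0 // ltW.
  rewrite hornerD hornerN; have := hq t tA; have := hq' t tA.
  by rewrite !ler_norml; lra.
have h2 : nrm (poly_op q' A x - B x) <= d * nrm x.
  by rewrite -lecR rcM -!hnormE.
lra.
Qed.

Lemma is_fcalc_nrmP f A B : is_fcalc f A B <->
  forall e : R, 0 < e -> exists q : {poly R},
    (forall t, rspec A t -> `|q.[t] - f t| <= e) /\
    (forall x, nrm (poly_op q A x - B x) <= e * nrm x).
Proof.
by split=> h e /h[q [hq hx]]; exists q; split=> // x; have := hx x; rewrite !hnormE -rcM lecR.
Qed.

Lemma fcalc_uniq f A B B' : hermop A -> is_fcalc f A B -> is_fcalc f A B' -> B = B'.
Proof.
move=> hA hB /is_fcalc_nrmP hB'; apply/funext => x; apply/eqP; rewrite -subr_eq0; apply/eqP.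
apply: (@nrm_eps _ (2 * nrm x)); first by rewrite mulr_ge0 ?nrm_ge0.
move=> e e0; have [q [hq hx]] := hB' e e0.
apply: le_trans (nrm_tri (poly_op q A x) _ _) _; rewrite (nrmBC (B x)).
by have := fcalc_approx hA hB (ltW e0) hq x; have := hx x; lra.
Qed.

Lemma is_fcalc_get f A B : is_fcalc f A B -> is_fcalc f A (fcalc f A).
Proof. by move=> h; rewrite /fcalc; case: xgetP => [_ -> //|/(_ B)]. Qed.

Lemma fcalcE f A B : hermop A -> is_fcalc f A B -> fcalc f A = B.
Proof. by move=> hA hB; apply: fcalc_uniq hA (is_fcalc_get hB) hB. Qed.

(** By [poly_op_bound] the approximating polynomials form a Cauchy sequence of
operators, uniformly on the unit ball; the limit is taken pointwise. *)
Lemma is_fcalc_ex f A : hermop A -> approximable f (rspec A) -> is_fcalc f A (fcalc f A).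
Proof.
move=> hA happ; have lA := hA.1.1.
have inv0 n : 0 < n.+1%:R^-1 :> R by rewrite invr_gt0.
have [q hq] := choice (fun n : nat => happ n.+1%:R^-1 (inv0 n)).
have qdist (e : R) : 0 < e -> exists N, forall n, (N <= n)%N ->
    forall t, rspec A t -> `|(q n).[t] - f t| <= e.
  move=> e0; exists (Num.truncn e^-1) => n Nn t /(hq n) h; apply: le_trans h _.
  rewrite invf_ple ?posrE // ltW // (lt_le_trans (truncnS_gt _)) // ler_nat ltnS //.
have qq (e : R) : 0 < e -> exists N, forall n m, (N <= n)%N -> (N <= m)%N ->
    forall x, nrm (poly_op (q n) A x - poly_op (q m) A x) <= e * nrm x.
  move=> e0; have [|N hN] := qdist (e / 2); first by rewrite divr_gt0.
  exists N => n m nN mN x; rewrite -poly_opB //; apply: poly_op_bound => //; first exact: ltW.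
  move=> t tA; rewrite hornerD hornerN; have := hN n nN t tA; have := hN m mN t tA.
  by rewrite !ler_norml; lra.
have /choice[B hB] : forall x : H, exists l : H, forall e : R, 0 < e ->
    exists N, forall n, (N <= n)%N -> nrm (poly_op (q n) A x - l) <= e.
  move=> x; apply: (@hilbert_complete _ _ (fun n => poly_op (q n) A x)) => e e0.
  have [|N hN] := qq (e / (nrm x + 1)).
    by rewrite divr_gt0 // ltr_wpDl // nrm_ge0.
  exists N => n m nN mN; apply: le_trans (hN n m nN mN x) _.
  by rewrite mulrAC ler_pdivrMr ?ltr_wpDl ?nrm_ge0 //; have := nrm_ge0 x; nra.
apply: (@is_fcalc_get _ _ B); apply/is_fcalc_nrmP => e e0.
have [N1 h1] := qdist e e0; have [N2 h2] := qq e e0.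
exists (q (maxn N1 N2)); split=> [|x]; first by apply: h1; rewrite leq_maxl.
apply/ler_addgt0Pr => d d0; have [N3 h3] := hB x d d0.
apply: le_trans (nrm_tri (poly_op (q (maxn N2 N3)) A x) _ _) _.
by apply: lerD; [apply: h2|apply: h3]; rewrite ?leq_maxl ?leq_maxr.
Qed.

Lemma is_fcalc_herm f A B : hermop A -> is_fcalc f A B -> hermop B.
Proof.
move=> hA /is_fcalc_nrmP hB; apply/hermopP.
have lB : linear B.
  move=> a x y; apply/eqP; rewrite -subr_eq0; apply/eqP.
  apply: (@nrm_eps _ (nrm (a *: x + y) + Re `|a| * nrm x + nrm y)).
    by rewrite !addr_ge0 ?mulr_ge0 ?nrm_ge0 // -ler0c Re_normK.
  move=> e e0; have [q [_ hq]] := hB e e0.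
  have lq : linear (poly_op q A) := (poly_op_herm q hA).1.1.
  apply: le_trans (nrm_tri (poly_op q A (a *: x + y)) _ _) _.
  rewrite nrmBC mulrDr mulrDr -addrA lerD //.
  rewrite lq opprD addrACA -scalerBr; apply: le_trans (nrmD _ _) _.
  rewrite lerD // nrmZ mulrCA ler_wpM2l // -ler0c Re_normK //.
have sB : adjoint_pair B B.
  move=> x y; apply/eqP; rewrite -subr_eq0 -normr_le0.
  apply: (@ler_eps0 _ _ (2 * (nrm x * nrm y))).
    by rewrite !mulr_ge0 ?nrm_ge0.
  move=> e e0; have [q [_ hq]] := hB e e0.
  have /hermopP[_ sq] := poly_op_herm q hA.
  have -> : '[B x, y] - '[x, B y] = '[x, poly_op q A y - B y] - '[poly_op q A x - B x, y].
    by rewrite rdotDr rdotDl rdotNl rdotNr sq; ring.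
  apply: le_trans (ler_normB _ _) _.
  have h1 := le_trans (nrm_CS x (poly_op q A y - B y)) (ler_wpM2l (nrm_ge0 _) (hq y)).
  have h2 := le_trans (nrm_CS (poly_op q A x - B x) y) (ler_wpM2r (nrm_ge0 _) (hq x)).
  lra.
split=> //; apply/bounded_nrmP; split=> //.
have [q [_ hq]] := hB 1 ltr01.
have /bounded_nrmP[_ [M M0 hM]] := (poly_op_herm q hA).1.
exists (M + 1) => [|x]; first exact: addr_gt0.
have -> : B x = poly_op q A x - (poly_op q A x - B x) by rewrite opprB addrC subrK.
apply: le_trans (nrmD _ _) _; rewrite nrmN mulrDl lerD //.
Qed.

(** If q is within e of f on the spectrum, then q + e is nonnegative there and
[poly_op_psd] applies; e is arbitrary. *)
Lemma is_fcalc_psd f A B : hermop A -> is_fcalc f A B ->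
  (forall t, rspec A t -> 0 <= f t) -> forall x, 0 <= '[B x, x].
Proof.
move=> hA /is_fcalc_nrmP hB f0 x; rewrite -oppr_le0.
apply: (@ler_eps0 _ _ (2 * '[x, x])); first by rewrite mulr_ge0 ?rdot_ge0.
move=> e e0; have [q [hqf hq]] := hB e e0.
have := @poly_op_psd _ _ (q + e%:P) A hA _ x.
rewrite poly_opD poly_opC rdotDl rdotZl => h.
have {}h : 0 <= '[poly_op q A x, x] + e * '[x, x].
  apply: h => t tA; rewrite hornerD hornerC.
  by have := hqf t tA; have := f0 t tA; rewrite ler_norml; lra.
have := le_trans (nrm_CS (poly_op q A x - B x) x) (ler_wpM2r (nrm_ge0 _) (hq x)).
rewrite -mulrA -expr2 nrm_sqr rdotDl rdotNl ler_norml => /andP[]; lra.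
Qed.

Lemma is_fcalc_ext f g A B : (forall t, rspec A t -> f t = g t) ->
  is_fcalc f A B -> is_fcalc g A B.
Proof.
by move=> fg h e /h[q [hq hx]]; exists q; split=> // t tA; rewrite -fg // hq.
Qed.

Lemma is_fcalc_poly q A : is_fcalc (fun t => q.[t]) A (poly_op q A).
Proof.
apply/is_fcalc_nrmP => e e0; exists q; split=> [t _|x].
  by rewrite subrr normr0 ltW.
by rewrite subrr nrm0 mulr_ge0 ?nrm_ge0 // ltW.
Qed.

Lemma is_fcalc_id A : is_fcalc id A A.
Proof.
have := is_fcalc_poly 'X A; rewrite (_ : poly_op 'X A = A); last first.
  by apply/funext => x; rewrite poly_opX.
by apply: is_fcalc_ext => t _; rewrite hornerX.
Qed.

Lemma is_fcalc_cst c A : is_fcalc (fun=> c) A (fun x => c%:C *: x).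
Proof.
have := is_fcalc_poly c%:P A; rewrite (_ : poly_op c%:P A = fun x => c%:C *: x); last first.
  by apply/funext => x; rewrite poly_opC.
by apply: is_fcalc_ext => t _; rewrite hornerC.
Qed.

Lemma is_fcalc_add f g A F G : is_fcalc f A F -> is_fcalc g A G ->
  is_fcalc (fun t => f t + g t) A (fun x => F x + G x).
Proof.
move=> /is_fcalc_nrmP hF /is_fcalc_nrmP hG; apply/is_fcalc_nrmP => e e0.
have e2 : 0 < e / 2 by rewrite divr_gt0.
have [p [pf pF]] := hF _ e2; have [q [qg qG]] := hG _ e2.
exists (p + q); split=> [t tA|x].
  by rewrite hornerD; have := pf t tA; have := qg t tA; rewrite !ler_norml; lra.
rewrite poly_opD opprD addrACA; apply: le_trans (nrmD _ _) _.
by have := pF x; have := qG x; lra.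
Qed.

Lemma bounded_on_spec f A B : hermop A -> is_fcalc f A B ->
  exists2 C : R, 0 < C & forall t, rspec A t -> `|f t| <= C.
Proof.
move=> hA /is_fcalc_nrmP hB; have [q [hq _]] := hB 1 ltr01.
have [M M0 hM] := herm_bounds hA.
have [m hm] := poly_itv_bound q (- M) M.
exists (`|m| + 1) => [|t tA]; first by rewrite ltr_wpDl.
have tM : t \in `[- M, M].
  rewrite in_itv /=; apply/andP; split.
    apply: (spectrum_ge hA) tA => x; have := hM x; rewrite ler_norml => /andP[]; lra.
  by apply: (spectrum_le hA) tA => x; have := hM x; rewrite ler_norml => /andP[].
have h := hm t tM; have := hq t tA; have := ler_norm m.
have : `|f t| <= `|q.[t]| + `|q.[t] - f t|.
  by rewrite -[X in `|X| <= _](subKr q.[t]) ler_normB.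
lra.
Qed.
End functional_calculus.

Section functional_calculus_algebra.
Context {R : realType} {H : hilbertType R}.
Implicit Types (x y : H) (A B F G : H -> H) (t : R) (f g : R -> R).

Lemma is_fcalc_mul f g A F G : hermop A -> is_fcalc f A F -> is_fcalc g A G ->
  is_fcalc (fun t => f t * g t) A (F \o G).
Proof.
move=> hA fF gG; have lA := hA.1.1.
have [C C0 hC] := bounded_on_spec hA fF; have [D D0 hD] := bounded_on_spec hA gG.
have /bounded_nrmP[_ [M M0 hM]] := (is_fcalc_herm hA fF).1.
have /bounded_nrmP[_ [N N0 hN]] := (is_fcalc_herm hA gG).1.
have /bounded_nrmP[lF _] := (is_fcalc_herm hA fF).1.
move/is_fcalc_nrmP: fF => hF; move/is_fcalc_nrmP: gG => hG.
apply/is_fcalc_nrmP => e e0.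
pose d := Num.min 1 (e / (1 + C + D + M + N)).
have s0 : 0 < 1 + C + D + M + N by rewrite !addr_gt0.
have d0 : 0 < d by rewrite lt_min ltr01 divr_gt0.
have d1 : d <= 1 by rewrite ge_min lexx.
have de : d * (1 + C + D + M + N) <= e.
  by rewrite -ler_pdivlMr // ge_min lexx orbT.
have [p [pf pF]] := hF _ d0; have [q [qg qG]] := hG _ d0.
exists (p * q); split=> [t tA|x].
  rewrite hornerM.
  have -> : p.[t] * q.[t] - f t * g t =
     (p.[t] - f t) * (q.[t] - g t) + f t * (q.[t] - g t) + (p.[t] - f t) * g t by ring.
  apply: le_trans (ler_normD _ _) _; apply: le_trans (lerD (ler_normD _ _) (lexx _)) _.
  rewrite !normrM.
  have h1 := ler_pM (normr_ge0 _) (normr_ge0 _) (pf t tA) (qg t tA).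
  have h2 := ler_pM (normr_ge0 _) (normr_ge0 _) (hC t tA) (qg t tA).
  have h3 := ler_pM (normr_ge0 _) (normr_ge0 _) (pf t tA) (hD t tA).
  have := ler_wpM2l (ltW d0) d1.
  have := mulr_ge0 (ltW d0) (ltW M0); have := mulr_ge0 (ltW d0) (ltW N0).
  lra.
rewrite poly_opM // /=.
have -> : poly_op p A (poly_op q A x) - F (G x) =
   (poly_op p A (poly_op q A x) - F (poly_op q A x)) + F (poly_op q A x - G x).
  by rewrite (opB lF) addrA subrK.
apply: le_trans (nrmD _ _) _.
have h1 := le_trans (hM _) (ler_wpM2l (ltW M0) (qG x)).
have h2 : nrm (poly_op q A x) <= (d + N) * nrm x.
  rewrite -[poly_op q A x](subrK (G x)); apply: le_trans (nrmD _ _) _.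
  by rewrite mulrDl lerD.
have h3 := le_trans (pF _) (ler_wpM2l (ltW d0) h2).
apply: le_trans (lerD h3 h1) _.
have h4 := ler_wpM2r (nrm_ge0 x) de.
have h5 := ler_wpM2r (nrm_ge0 x) (ler_wpM2l (ltW d0) d1).
have := mulr_ge0 (mulr_ge0 (ltW d0) (ltW C0)) (nrm_ge0 x).
have := mulr_ge0 (mulr_ge0 (ltW d0) (ltW D0)) (nrm_ge0 x).
lra.
Qed.

Lemma is_fcalc_scale c f A F : hermop A -> is_fcalc f A F ->
  is_fcalc (fun t => c * f t) A (fun x => c%:C *: F x).
Proof. by move=> hA; exact: is_fcalc_mul hA (is_fcalc_cst c A). Qed.

Lemma is_fcalc_horner (q : {poly R}) f A F : hermop A -> is_fcalc f A F ->
  is_fcalc (fun t => q.[f t]) A (poly_op q F).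
Proof.
move=> hA fF; have lF := (is_fcalc_herm hA fF).1.1.
elim/poly_ind: q => [|p c IH].
  rewrite (_ : poly_op 0 F = fun x => 0%:C *: x); last first.
    by apply/funext => x; rewrite -[0 in LHS]/(0%:P) poly_opC.
  by apply: is_fcalc_ext (is_fcalc_cst 0 A) => t _; rewrite horner0.
rewrite (_ : poly_op (p * 'X + c%:P) F = fun x => (poly_op p F \o F) x + c%:C *: x); last first.
  by apply/funext => x; rewrite poly_opD poly_opM // poly_opX poly_opC.
apply: is_fcalc_ext (is_fcalc_add (is_fcalc_mul hA IH fF) (is_fcalc_cst c A)) => t _.
by rewrite hornerMXaddC.
Qed.

(** The set S stands in for the spectral mapping theorem: it contains both the
image under g of the spectrum of A and the spectrum of g(A). *)
Lemma is_fcalc_comp f g A G (S : set R) : hermop A -> is_fcalc g A G ->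
  (forall t, rspec A t -> S (g t)) -> rspec G `<=` S -> approximable f S ->
  is_fcalc (f \o g) A (fcalc f G).
Proof.
move=> hA gG gS GS happ; have hG := is_fcalc_herm hA gG.
have fG := is_fcalc_ex hG (approximable_sub GS happ).
apply/is_fcalc_nrmP => e e0; have e2 : 0 < e / 2 by rewrite divr_gt0.
have [q hq] := happ _ e2.
have hqG := fcalc_approx hG fG (ltW e2) (fun t tG => hq t (GS t tG)).
have /is_fcalc_nrmP/(_ _ e2)[r [hr hrG]] := is_fcalc_horner q hA gG.
exists r; split=> [t tA|x].
  have := hr t tA; have := hq _ (gS t tA) => /=; rewrite !ler_norml; lra.
apply: le_trans (nrm_tri (poly_op q G x) _ _) _.
by have := hqG x; have := hrG x; lra.
Qed.

Lemma is_fcalc_mono f g A F G : hermop A -> is_fcalc f A F -> is_fcalc g A G ->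
  (forall t, rspec A t -> f t <= g t) -> forall x, '[F x, x] <= '[G x, x].
Proof.
move=> hA fF gG fg x.
have := is_fcalc_psd hA (is_fcalc_add gG (is_fcalc_scale (-1) hA fF)) _ x.
rewrite rdotDl rdotZl mulN1r subr_ge0; apply => t /fg; lra.
Qed.

Lemma is_fcalc_ge f A F c : hermop A -> is_fcalc f A F ->
  (forall t, rspec A t -> c <= f t) -> forall x, c * '[x, x] <= '[F x, x].
Proof.
move=> hA fF fc x; rewrite -rdotZl.
exact: is_fcalc_mono hA (is_fcalc_cst c A) fF fc x.
Qed.
End functional_calculus_algebra.

(** An operator that intertwines A and B intertwines their iterates, hence their
polynomials, hence the limits of these. The two Hilbert spaces may differ, which
serves for coordinate embeddings. *)
Lemma fcalc_intertwine (R : realType) (H1 H2 : hilbertType R) (A : H1 -> H1)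
  (B : H2 -> H2) (K : H1 -> H2) (f : R -> R) (M : R) :
  hermop A -> hermop B -> linear K -> 0 <= M -> (forall x, nrm (K x) <= M * nrm x) ->
  (forall x, K (A x) = B (K x)) ->
  approximable f (rspec A `|` rspec B) ->
  forall x, K (fcalc f A x) = fcalc f B (K x).
Proof.
move=> hA hB lK M0 hM KAB happ x.
have fA : is_fcalc f A (fcalc f A).
  by apply: is_fcalc_ex => //; apply: approximable_sub happ; exact: subsetUl.
have fB : is_fcalc f B (fcalc f B).
  by apply: is_fcalc_ex => //; apply: approximable_sub happ; exact: subsetUr.
have Kiter k u : K (iter k A u) = iter k B (K u).
  by elim: k => //= k IH; rewrite KAB IH.
have KD u v : K (u + v) = K u + K v.
  by have := lK 1 u v; rewrite !scale1r.
have K0 : K 0 = 0 by apply: (addrI (K 0)); rewrite -KD !addr0.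
have KZ a u : K (a *: u) = a *: K u by have := lK a u 0; rewrite K0 !addr0.
have Kq q u : K (poly_op q A u) = poly_op q B (K u).
  rewrite /poly_op (big_morph K KD K0); apply: eq_bigr => k _.
  by rewrite KZ Kiter.
apply/eqP; rewrite -subr_eq0; apply/eqP.
apply: (@nrm_eps _ _ _ (2 * M * nrm x)); first by rewrite !mulr_ge0 ?nrm_ge0.
move=> e e0; have [q hq] := happ e e0.
apply: le_trans (nrm_tri (poly_op q B (K x)) _ _) _.
have hqA := fcalc_approx hA fA (ltW e0) (fun t tA => hq t (or_introl tA)).
have hqB := fcalc_approx hB fB (ltW e0) (fun t tB => hq t (or_intror tB)).
have h1 : nrm (K (fcalc f A x) - poly_op q B (K x)) <= M * (e * nrm x).
  rewrite nrmBC -Kq -[- K _]scaleN1r -KZ -KD scaleN1r.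
  by apply: le_trans (hM _) _; rewrite ler_wpM2l.
have h2 := le_trans (hqB (K x)) (ler_wpM2l (ltW e0) (hM x)).
lra.
Qed.

Section diagonal.
Context {R : realType} {H : hilbertType R}.
Definition diag_op (A B : H -> H) : dsum H -> dsum H := fun u => (A u.1, B u.2).

Lemma dsum_addE (u v : dsum H) : u + v = ((u.1 + v.1, u.2 + v.2) : dsum H).
Proof. by []. Qed.
Lemma dsum_scaleE a (u : dsum H) : a *: u = ((a *: u.1, a *: u.2) : dsum H).
Proof. by []. Qed.

Lemma rdot_dsum (u v : dsum H) : '[u, v] = '[u.1, v.1] + '[u.2, v.2].
Proof. by rewrite /rdot hdot_dsum ReD. Qed.

Lemma nrm_dsum_le (u : dsum H) : nrm u <= nrm u.1 + nrm u.2.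
Proof.
rewrite -ler_sqr ?nnegrE ?addr_ge0 ?nrm_ge0 // nrm_sqr rdot_dsum sqrrD !nrm_sqr.
by have := mulr_ge0 (nrm_ge0 u.1) (nrm_ge0 u.2); lra.
Qed.
Lemma nrm_fst_le (u : dsum H) : nrm u.1 <= nrm u.
Proof. by rewrite ler_wsqrtr // rdot_dsum lerDl rdot_ge0. Qed.
Lemma nrm_snd_le (u : dsum H) : nrm u.2 <= nrm u.
Proof. by rewrite ler_wsqrtr // rdot_dsum lerDr rdot_ge0. Qed.

Lemma diag_herm A B : hermop A -> hermop B -> hermop (diag_op A B).
Proof.
move=> /hermopP[/bounded_nrmP[lA [M M0 hM]] sA] /hermopP[/bounded_nrmP[lB [N N0 hN]] sB].
apply/hermopP; split; last by move=> u v; rewrite !rdot_dsum sA sB.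
apply/bounded_nrmP; split.
  by move=> a u v; rewrite /diag_op /= lA lB.
exists (M + N) => [|u]; first exact: addr_gt0.
apply: le_trans (nrm_dsum_le _) _; rewrite mulrDl lerD //=.
  by apply: le_trans (hM _) _; rewrite ler_pM2l // nrm_fst_le.
by apply: le_trans (hN _) _; rewrite ler_pM2l // nrm_snd_le.
Qed.

Lemma diag_rspec A B : rspec (diag_op A B) `<=` rspec A `|` rspec B.
Proof.
move=> t; rewrite /rspec /= /spectrum /=; apply: contra_notP => /not_orP[/contrapT iA /contrapT iB].
have [A' [/bounded_nrmP[lA [M M0 hM]] AA A'A]] := iA.
have [B' [/bounded_nrmP[lB [N N0 hN]] BB B'B]] := iB.
exists (diag_op A' B'); split.
- apply/bounded_nrmP; split.
    by move=> a u v; rewrite /diag_op /= lA lB.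
  exists (M + N) => [|u]; first exact: addr_gt0.
  apply: le_trans (nrm_dsum_le _) _; rewrite mulrDl lerD //=.
    by apply: le_trans (hM _) _; rewrite ler_pM2l // nrm_fst_le.
  by apply: le_trans (hN _) _; rewrite ler_pM2l // nrm_snd_le.
- by move=> [x y]; rewrite /diag_op /= AA BB.
- move=> [x y]; rewrite /diag_op /=.
  have := A'A x; have := B'B y => /= e1 e2.
  by rewrite -[RHS]/(x, y) -{3}e1 -{3}e2.
Qed.

(** The coordinate embeddings x |-> (x, 0) and x |-> (0, x) intertwine A and B
with the diagonal operator, so [fcalc_intertwine] computes f on each
coordinate. *)
Lemma fcalc_diag A B f : hermop A -> hermop B ->
  approximable f (rspec A `|` rspec B) ->
  fcalc f (diag_op A B) = diag_op (fcalc f A) (fcalc f B).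
Proof.
move=> hA hB happ; have hD := diag_herm hA hB.
have fD : is_fcalc f (diag_op A B) (fcalc f (diag_op A B)).
  by apply: is_fcalc_ex => //; apply: approximable_sub happ; exact: diag_rspec.
have lD := (is_fcalc_herm hD fD).1.1.
apply/funext => -[x y].
have -> : ((x, y) : dsum H) = ((x, 0) : dsum H) + ((0, y) : dsum H).
  by rewrite dsum_addE /= addr0 add0r.
rewrite (opD lD).
have h1 : ((fcalc f A x, 0) : dsum H) = fcalc f (diag_op A B) (x, 0).
  apply: (@fcalc_intertwine _ _ _ A (diag_op A B) (fun x => (x, 0) : dsum H) f 1) => //.
  - by move=> a u v; rewrite dsum_scaleE dsum_addE /= scaler0 addr0.
  - by move=> u; rewrite mul1r; apply: le_trans (nrm_dsum_le _) _ => /=; rewrite nrm0 addr0.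
  - by move=> u; rewrite /diag_op /= (op0 hB.1.1).
  - apply: approximable_sub happ => t [|/diag_rspec//]; by left.
have h2 : ((0, fcalc f B y) : dsum H) = fcalc f (diag_op A B) (0, y).
  apply: (@fcalc_intertwine _ _ _ B (diag_op A B) (fun x => (0, x) : dsum H) f 1) => //.
  - by move=> a u v; rewrite dsum_scaleE dsum_addE /= scaler0 addr0.
  - by move=> u; rewrite mul1r; apply: le_trans (nrm_dsum_le _) _ => /=; rewrite nrm0 add0r.
  - by move=> u; rewrite /diag_op /= (op0 hA.1.1).
  - apply: approximable_sub happ => t [|/diag_rspec//]; by right.
by rewrite -h1 -h2 /diag_op !dsum_addE /= !addr0 !add0r.
Qed.
End diagonal.

(** * Approximation by Bernstein polynomials *)

Section weierstrass.
Context {R : realType}.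
Implicit Types (f : R -> R) (u t : R).

(** De Casteljau's recursion for the Bernstein polynomial with values phi 0, ...,
phi n. Its value at u is the mean of phi under the binomial law of parameters n
and u; the recursion lets the moments be computed by induction, without
binomial coefficients. *)
Fixpoint bernstein (n : nat) (phi : nat -> R) : {poly R} :=
  if n is n'.+1 then (1 - 'X) * bernstein n' phi + 'X * bernstein n' (phi \o S)
  else (phi 0%N)%:P.

Lemma bernsteinS n phi u : (bernstein n.+1 phi).[u] =
  (1 - u) * (bernstein n phi).[u] + u * (bernstein n (phi \o S)).[u].
Proof. by rewrite /= hornerD !hornerM hornerD hornerN hornerX hornerC. Qed.

(** A mean is monotone and reproduces constants. *)
Lemma bernstein_dist n phi psi c u : 0 <= u <= 1 ->
  (forall k, (k <= n)%N -> `|phi k - c| <= psi k) ->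
  `|(bernstein n phi).[u] - c| <= (bernstein n psi).[u].
Proof.
move=> /andP[u0 u1]; elim: n phi psi => [|n IH] phi psi h; first by rewrite !hornerC h.
rewrite !bernsteinS.
have h1 := IH phi psi (fun k kn => h k (leqW kn)).
have h2 := IH (phi \o S) (psi \o S) (fun k kn => h k.+1 kn).
have -> : (1 - u) * (bernstein n phi).[u] + u * (bernstein n (phi \o S)).[u] - c =
  (1 - u) * ((bernstein n phi).[u] - c) + u * ((bernstein n (phi \o S)).[u] - c) by ring.
apply: le_trans (ler_normD _ _) _; rewrite !normrM (ger0_norm u0) ger0_norm ?subr_ge0 //.
by rewrite lerD // ler_wpM2l // subr_ge0.
Qed.

(** The mean and the variance n u (1 - u) of the binomial law. *)
Lemma bernstein_quadratic n (e C a : R) u :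
  (bernstein n (fun k => e + C * (k%:R - a) ^+ 2)).[u] =
  e + C * ((n%:R * u - a) ^+ 2 + n%:R * (u * (1 - u))).
Proof.
elim: n a => [|n IH] a; first by rewrite hornerC; ring.
rewrite bernsteinS IH (_ : _ \o S = fun k => e + C * (k%:R - (a - 1)) ^+ 2); last first.
  by apply/funext => k /=; rewrite -natr1; ring.
by rewrite IH -natr1; ring.
Qed.

(** Chebyshev's form of Bernstein's proof. The hypothesis is uniform continuity
written with a quadratic penalty, so that the second moment bounds the mean of
the oscillation directly. *)
Lemma weierstrass01 f : (forall e : R, 0 < e -> exists2 C : R, 0 <= C &
    forall s t, 0 <= s <= 1 -> 0 <= t <= 1 -> `|f s - f t| <= e + C * (s - t) ^+ 2) ->
  approximable f [set t | 0 <= t <= 1].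
Proof.
move=> hf e e0; have [|C C0 hC] := hf (e / 2); first by rewrite divr_gt0.
pose n := (Num.truncn (2 * C / e)).+1.
have n0 : 0 < n%:R :> R by rewrite ltr0n.
exists (bernstein n (fun k => f (k%:R / n%:R))) => t t01.
apply: le_trans (@bernstein_dist n _
  (fun k => e / 2 + C / n%:R ^+ 2 * (k%:R - n%:R * t) ^+ 2) (f t) t t01 _) _.
  move=> k kn; apply: le_trans (hC _ _ _ t01) _.
    by rewrite divr_ge0 //= ler_pdivrMr // mul1r ler_nat.
  rewrite lerD2l le_eqVlt; apply/orP; left; apply/eqP.
  by field; rewrite gt_eqF.
rewrite bernstein_quadratic subrr expr0n add0r.
have -> : C / n%:R ^+ 2 * (n%:R * (t * (1 - t))) = C / n%:R * (t * (1 - t)).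
  by field; rewrite gt_eqF.
have tt : t * (1 - t) <= 1 by move: t01 => /andP[? ?]; nra.
have Cn : C / n%:R <= e / 2.
  have : 2 * C / e < n%:R by rewrite truncnS_gt.
  rewrite ltr_pdivrMr // ler_pdivrMr //; lra.
have C0' : 0 <= C / n%:R by rewrite divr_ge0.
have := ler_wpM2l C0' tt; lra.
Qed.

Lemma weierstrass (m M : R) f : m < M -> (forall e : R, 0 < e -> exists2 C : R, 0 <= C &
    forall s t, m <= s <= M -> m <= t <= M -> `|f s - f t| <= e + C * (s - t) ^+ 2) ->
  approximable f [set t | m <= t <= M].
Proof.
move=> mM hf e e0; have d0 : 0 < M - m by rewrite subr_gt0.
have [|q hq] := @weierstrass01 (fun u => f (m + (M - m) * u)) _ e e0.
  move=> e' /hf[C C0 hC]; exists (C * (M - m) ^+ 2); first by rewrite mulr_ge0 // sqr_ge0.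
  move=> s t s01 t01; apply: le_trans (hC _ _ _ _) _.
  - by move: s01 => /andP[? ?]; apply/andP; split; nra.
  - by move: t01 => /andP[? ?]; apply/andP; split; nra.
  by rewrite lerD2l le_eqVlt; apply/orP; left; apply/eqP; ring.
exists (q \Po ((M - m)^-1 *: ('X - m%:P))) => t /= /andP[tm tM].
rewrite horner_comp hornerZ hornerD hornerN hornerX hornerC.
have := hq ((M - m)^-1 * (t - m)) _.
have -> : m + (M - m) * ((M - m)^-1 * (t - m)) = t by field; rewrite gt_eqF.
apply=> /=; rewrite mulr_ge0 ?invr_ge0 ?subr_ge0 ?(ltW d0) ?(ltW mM) //=.
by rewrite ler_pdivrMl // mulr1 lerD2r.
Qed.

Lemma approximable_lipschitz (m M L : R) f :
  (forall s t, m <= s -> s < t -> t <= M -> `|f t - f s| <= L * (t - s)) ->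
  approximable f [set t | m <= t <= M].
Proof.
move=> hf; have [mM|mM] := ltP m M; last first.
  move=> e e0; exists (f m)%:P => t /= /andP[tm tM]; rewrite hornerC.
  have -> : t = m by lra.
  by rewrite subrr normr0 ltW.
have L0 : 0 <= L.
  have := hf m M (lexx _) mM (lexx _); move/(le_trans (normr_ge0 _)).
  by rewrite pmulr_lge0 // subr_gt0.
apply: weierstrass => // e e0; exists (L ^+ 2 / (4 * e)).
  by rewrite divr_ge0 ?sqr_ge0 // mulr_ge0 // ltW.
(* AM-GM turns the Lipschitz bound into the quadratic penalty. *)
have main (d : R) : 0 <= d -> L * d <= e + L ^+ 2 / (4 * e) * d ^+ 2.
  move=> d0; rewrite -subr_ge0.
  have -> : e + L ^+ 2 / (4 * e) * d ^+ 2 - L * d = (2 * e - L * d) ^+ 2 / (4 * e).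
    by field; rewrite gt_eqF.
  by rewrite divr_ge0 ?sqr_ge0 // mulr_ge0 // ltW.
move=> s t /andP[sm sM] /andP[tm tM].
have [st|ts|->] := ltgtP s t.
- rewrite distrC -[(s - t) ^+ 2]sqrrN opprB; apply: le_trans (hf _ _ _ st _) _ => //.
  by apply: main; rewrite subr_ge0 ltW.
- by apply: le_trans (hf _ _ _ ts _) _ => //; apply: main; rewrite subr_ge0 ltW.
- by rewrite !subrr normr0 expr0n mulr0 addr0 ltW.
Qed.

(** The square root is not Lipschitz at 0. For a = sqrt s <= b = sqrt t, either
b - a <= e, or e^3 (b - a) <= (b - a)^4 <= (b^2 - a^2)^2 = (t - s)^2. *)
Lemma approximable_sqrt (M : R) : approximable Num.sqrt [set t | 0 <= t <= M].
Proof.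
have [M0|M0] := ltP 0 M; last first.
  move=> e e0; exists 0 => t /= /andP[t0 tM]; have -> : t = 0 by lra.
  by rewrite horner0 sqrtr0 subrr normr0 ltW.
apply: weierstrass => // e e0; exists (e ^+ 3)^-1; first by rewrite invr_ge0 exprn_ge0 // ltW.
have main (s t : R) : 0 <= s -> s <= t ->
    `|Num.sqrt t - Num.sqrt s| <= e + (e ^+ 3)^-1 * (t - s) ^+ 2.
  move=> s0 st; have t0 := le_trans s0 st.
  have := sqr_sqrtr s0; have := sqr_sqrtr t0; have := ler_wsqrtr st.
  have := sqrtr_ge0 s; have := sqrtr_ge0 t.
  move: (Num.sqrt s) (Num.sqrt t) => a b b0 a0 ab <- <-.
  rewrite ger0_norm ?subr_ge0 //.
  have [h|h] := lerP (b - a) e.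
    by apply: le_trans h _; rewrite lerDl mulr_ge0 ?sqr_ge0 // invr_ge0 exprn_ge0 // ltW.
  rewrite -[leLHS]add0r lerD ?(ltW e0) //.
  rewrite ler_pdivlMl ?exprn_gt0 //.
  have e3 : e ^+ 3 <= (b - a) ^+ 3 by rewrite lerXn2r ?nnegrE ?(ltW e0) // ltW // (lt_trans e0).
  have ba : 0 <= b - a by rewrite subr_ge0.
  apply: le_trans (ler_wpM2r ba e3) _.
  have -> : (b ^+ 2 - a ^+ 2) ^+ 2 = (b - a) ^+ 2 * (b + a) ^+ 2 by ring.
  have -> : (b - a) ^+ 3 * (b - a) = (b - a) ^+ 2 * (b - a) ^+ 2 by ring.
  rewrite ler_wpM2l ?sqr_ge0 // ler_sqr ?nnegrE //; lra.
move=> s t /andP[sm sM] /andP[tm tM].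
have [st|ts] := leP s t; first by rewrite distrC -[(s - t) ^+ 2]sqrrN opprB main.
by rewrite main // ltW.
Qed.

Lemma powR_itv_bound (m M r x : R) : 0 < m -> m <= x <= M -> x `^ r <= m `^ r + M `^ r.
Proof.
move=> m0 /andP[mx xM]; have x0 := lt_le_trans m0 mx; have M0 := lt_le_trans x0 xM.
have [r0|r0] := leP 0 r.
  apply: le_trans (_ : x `^ r <= M `^ r) _; last by rewrite lerDr powR_ge0.
  by rewrite ge0_ler_powR ?nnegrE // ltW.
apply: le_trans (_ : x `^ r <= m `^ r) _; last by rewrite lerDl powR_ge0.
have : m `^ (- r) <= x `^ (- r) by rewrite ge0_ler_powR ?nnegrE // ltW // oppr_gt0.
by rewrite !powRN lef_pV2 ?posrE ?powR_gt0.
Qed.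

Lemma approximable_powR (m M r : R) : 0 < m ->
  approximable (fun t => t `^ r) [set t | m <= t <= M].
Proof.
move=> m0; pose L := `|r| * (m `^ (r - 1) + M `^ (r - 1)).
apply: (@approximable_lipschitz m M L) => s t ms st tM.
have pos x : s <= x -> 0 < x by move=> sx; lra.
have [||c ] := @MVT R (fun t => t `^ r) (fun t => r * t `^ (r - 1)) s t st.
- move=> x /[!in_itv] /andP[sx xt]; apply: is_derive1_powR; apply: pos; exact: ltW.
- apply: continuous_in_subspaceT => x; rewrite inE /= in_itv /= => /andP[sx xt].
  apply/differentiable_continuous/derivable1_diffP.
  exact: (@ex_derive _ _ _ _ _ _ _ (is_derive1_powR r (pos _ sx))).
rewrite in_itv /= => /andP[sc ct] ->.
rewrite normrM (ger0_norm (_ : 0 <= t - s)) ?subr_ge0 ?(ltW st) //.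
rewrite ler_wpM2r ?subr_ge0 ?(ltW st) // normrM (ger0_norm (powR_ge0 _ _)) ler_wpM2l //.
by apply: powR_itv_bound => //; lra.
Qed.

Lemma approximable_pair f (a b : R) : approximable f [set t | t = a \/ t = b].
Proof.
move=> e e0; have [ab|ab] := eqVneq a b.
  exists (f a)%:P => t /= h; have -> : t = a by case: h => ->.
  by rewrite hornerC subrr normr0 ltW.
exists ((f a)%:P + ((f b - f a) / (b - a)) *: ('X - a%:P)) => t /= h.
rewrite hornerD hornerZ hornerD hornerN !hornerC hornerX.
case: h => ->; first by rewrite subrr mulr0 addr0 subrr normr0 ltW.
by rewrite divfK ?subr_eq0 1?eq_sym // subrKC subrr normr0 ltW.
Qed.
End weierstrass.

Lemma powR_itv_lb (R : realType) (m M r x : R) : 0 < m -> m <= x <= M ->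
  (m `^ (- r) + M `^ (- r))^-1 <= x `^ r.
Proof.
move=> m0 mxM; have := powR_itv_bound (- r) m0 mxM.
have x0 : 0 < x by move: mxM => /andP[]; lra.
rewrite [x `^ _]powRN => h; rewrite -[leRHS]invrK lef_pV2 ?posrE ?invr_gt0 ?powR_gt0 //.
by rewrite (lt_le_trans _ h) // invr_gt0 powR_gt0.
Qed.

(** * Positive invertible operators and their powers *)

Section positive_invertible.
Context {R : realType} {H : hilbertType R}.
Implicit Types (x y : H) (A B F G : H -> H) (t r s : R) (f g : R -> R).

(** Coercive rather than positive and invertible: estimates use the lower bound
m. The two notions agree, by [posinv_posdef] and [posdef_invertible]. *)
Definition posdef A : Prop :=
  hermop A /\ exists2 m : R, 0 < m & forall x, m * '[x, x] <= '[A x, x].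

Lemma posdef_itv A : posdef A -> exists m M : R, [/\ 0 < m, 0 < M,
  rspec A `<=` [set t | m <= t <= M] &
  forall x, m * '[x, x] <= '[A x, x] /\ '[A x, x] <= M * '[x, x]].
Proof.
move=> [hA [m m0 hm]]; have [M M0 hM] := herm_bounds hA.
have hM' x : '[A x, x] <= M * '[x, x] by apply: le_trans (ler_norm _) (hM x).
exists m, M; split => // t tA /=; rewrite (spectrum_ge hA hm tA) /=.
exact: spectrum_le hA hM' tA.
Qed.

Lemma posdef_spectrum A (z : R[i]) : posdef A -> spectrum A z -> 0 < z.
Proof.
move=> [hA [m m0 hm]] hz; have zE := spectrum_real hA hz.
rewrite zE ltcR; apply: lt_le_trans m0 _.
by apply: (spectrum_ge hA hm); rewrite -zE.
Qed.

Lemma posdef_ge0 A x : posdef A -> 0 <= '[A x, x].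
Proof. by move=> [_ [m m0 hm]]; apply: le_trans (hm x); rewrite mulr_ge0 ?rdot_ge0 // ltW. Qed.

Lemma posdef_sym A x y : posdef A -> '[A x, y] = '[x, A y].
Proof. by move=> [/hermopP[_ h] _]. Qed.

Lemma posdef_lin A : posdef A -> linear A. Proof. by move=> [[[]]]. Qed.

Lemma posdef_invertible A : posdef A -> op_invertible A.
Proof. by move=> [[bA _] [m m0 hm]]; exact: coercive_invertible hm. Qed.

(** Invertibility gives c |x| <= |A x|, and Cauchy-Schwarz for the form of A
gives |A x|^2 <= M <A x, x>. *)
Lemma posinv_posdef A : posinv A -> posdef A.
Proof.
move=> [bA pA iA]; have sA := psd_selfadjoint bA.1 pA.
have hA : hermop A by [].
have pA' := (selfadjoint_psdP bA.1 sA).1 pA.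
split => //; have [c c0 hc] := op_invertible_below iA.
have [M M0 hM] := herm_bounds hA.
exists (c ^+ 2 / M) => [|x]; first by rewrite divr_gt0 ?exprn_gt0.
have := psd_CS x (A x) hA pA'.
have h1 : c ^+ 2 * '[x, x] <= '[A x, A x].
  have := hc x; rewrite -ler_sqr ?nnegrE ?mulr_ge0 ?nrm_ge0 ?(ltW c0) //.
  by rewrite exprMn !nrm_sqr.
have h2 := le_trans (ler_norm _) (hM (A x)).
have h3 := ler_wpM2l (pA' x) h2.
move=> /le_trans/(_ h3) h4.
rewrite mulrAC ler_pdivrMr // mulrC.
have [Ax0|Ax0] := eqVneq (A x) 0.
  by rewrite mulrC; apply: le_trans h1 _; rewrite Ax0 !rdot0l mul0r.
have Ap : 0 < '[A x, A x] by rewrite lt_def rdot_ge0 rdot_eq0 Ax0.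
rewrite mulrC; apply: le_trans h1 _; move: h4.
by rewrite expr2 mulrA ler_pM2r // mulrC.
Qed.

(** Continuity on the positive half-line, see [approximable]. *)
Definition locally_approximable f :=
  forall m M : R, 0 < m -> approximable f [set t | m <= t <= M].

Lemma locally_approximable_powR r : locally_approximable (fun t => t `^ r).
Proof. by move=> m M; exact: approximable_powR. Qed.

Lemma posdef_fcalc f A : locally_approximable f -> posdef A -> is_fcalc f A (fcalc f A).
Proof.
move=> hf pA; have [m [M [m0 _ mM _]]] := posdef_itv pA.
by apply: is_fcalc_ex pA.1 _; apply: approximable_sub mM _; exact: hf.
Qed.

Lemma pow_fcalc r A : posdef A -> is_fcalc (fun t => t `^ r) A (op_pow r A).
Proof. by apply: posdef_fcalc; exact: locally_approximable_powR. Qed.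

Lemma pow_posdef r A : posdef A -> posdef (op_pow r A).
Proof.
move=> pA; split; first exact: is_fcalc_herm pA.1 (pow_fcalc r pA).
have [m [M [m0 M0 mM _]]] := posdef_itv pA.
pose c := (m `^ (- r) + M `^ (- r))^-1.
have s0 : 0 < m `^ (- r) + M `^ (- r) by rewrite addr_gt0 // powR_gt0.
exists c; first by rewrite invr_gt0.
apply: is_fcalc_ge pA.1 (pow_fcalc r pA) _ => t /mM /= tm.
exact: powR_itv_lb.
Qed.

Lemma op_powD r s A x : posdef A -> op_pow r A (op_pow s A x) = op_pow (r + s) A x.
Proof.
move=> pA; have hA := pA.1.
have := is_fcalc_mul hA (pow_fcalc r pA) (pow_fcalc s pA).
have h := pow_fcalc (r + s) pA.
move=> /(is_fcalc_ext (g := fun t => t `^ (r + s))) h2.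
rewrite -[LHS]/((op_pow r A \o op_pow s A) x); congr (_ x).
apply: fcalc_uniq hA _ h; apply: h2 => t tA; rewrite powRD //.
apply/implyP => _; apply: lt0r_neq0; rewrite -ltcR; exact: (posdef_spectrum pA tA).
Qed.

Lemma op_pow0 A x : posdef A -> op_pow 0 A x = x.
Proof.
move=> pA; have hA := pA.1.
have e := fcalc_uniq hA (pow_fcalc 0 pA) (is_fcalc_ext _ (is_fcalc_cst 1 A)).
by rewrite e ?scale1r // => t _; rewrite powRr0.
Qed.

Lemma op_pow1 A x : posdef A -> op_pow 1 A x = A x.
Proof.
move=> pA; have hA := pA.1.
have e := fcalc_uniq hA (pow_fcalc 1 pA) (is_fcalc_ext _ (is_fcalc_id A)).
rewrite e // => t tA; rewrite powRr1 // ltW // -ltcR; exact: (posdef_spectrum pA tA).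
Qed.

Lemma op_powK r A x : posdef A -> op_pow r A (op_pow (- r) A x) = x.
Proof. by move=> pA; rewrite op_powD // subrr op_pow0. Qed.
Lemma op_powNK r A x : posdef A -> op_pow (- r) A (op_pow r A x) = x.
Proof. by move=> pA; rewrite op_powD // addNr op_pow0. Qed.

Lemma is_fcalc_pow_comp f s A : locally_approximable f -> posdef A ->
  is_fcalc (fun t => f (t `^ s)) A (fcalc f (op_pow s A)).
Proof.
move=> hf pA; have pG := pow_posdef s pA.
have [m [M [m0 M0 mM _]]] := posdef_itv pA.
have [m' [M' [m'0 M'0 mM' _]]] := posdef_itv pG.
(* The interval [a, b] contains the spectrum of A^s and the powers t^s of the
   points t in the spectrum of A. *)
have s0 : 0 < m `^ (- s) + M `^ (- s) by rewrite addr_gt0 // powR_gt0.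
pose a := Num.min m' (m `^ (- s) + M `^ (- s))^-1; pose b := Num.max M' (m `^ s + M `^ s).
have a0 : 0 < a by rewrite lt_min m'0 invr_gt0.
apply: (@is_fcalc_comp _ _ f (fun t => t `^ s) A (op_pow s A)
  [set t | a <= t <= b] pA.1 (pow_fcalc s pA) _ _ (hf a b a0)).
  move=> t /mM tm /=; rewrite le_max ge_min (powR_itv_bound _ m0 tm) orbT andbT.
  by rewrite (powR_itv_lb _ m0 tm) orbT.
by move=> t /mM' /= /andP[h1 h2]; rewrite ge_min h1 le_max h2.
Qed.

Lemma op_pow_pow r s A : posdef A -> op_pow r (op_pow s A) = op_pow (s * r) A.
Proof.
move=> pA; apply/esym; apply: (fcalc_uniq pA.1 (pow_fcalc _ pA)).
apply: is_fcalc_ext (is_fcalc_pow_comp _ (locally_approximable_powR r) pA).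
by move=> t _ /=; rewrite powRrM.
Qed.

Lemma pow_sym r A x y : posdef A -> '[op_pow r A x, y] = '[x, op_pow r A y].
Proof. by move=> pA; exact/posdef_sym/pow_posdef. Qed.

Lemma pow_half_sq r A x : posdef A ->
  '[op_pow (r / 2) A x, op_pow (r / 2) A x] = '[op_pow r A x, x].
Proof. by move=> pA; rewrite -pow_sym // op_powD // -splitr. Qed.

(** Cauchy-Schwarz for the form of A at P = A^(-1) x and u = B^(-1) x gives
<x, u>^2 <= <x, P> <A u, u> <= <x, P> <x, u>. *)
Lemma inverse_antitone A B : posdef A -> posdef B -> (forall x, '[A x, x] <= '[B x, x]) ->
  forall x, '[op_pow (-1) B x, x] <= '[op_pow (-1) A x, x].
Proof.
move=> pA pB AB x; set P := op_pow (-1) A x; set u := op_pow (-1) B x.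
have AP : A P = x by rewrite -op_pow1 // op_powK.
have Bu : B u = x by rewrite -op_pow1 // op_powK.
have := psd_CS P u pA.1 (fun y => posdef_ge0 y pA).
rewrite AP => h; have h1 : '[A u, u] <= '[x, u] by rewrite -[in leRHS]Bu.
have P0 : 0 <= '[x, P] by rewrite -AP posdef_ge0.
have {}h := le_trans h (ler_wpM2l P0 h1).
rewrite (rdotC u) (rdotC P).
have [xu|xu] := leP '[x, u] 0; first exact: le_trans xu P0.
by rewrite -(ler_pM2r xu) -expr2.
Qed.

Lemma posdef_below A : posdef A -> exists2 c : R, 0 < c & forall x, c * nrm x <= nrm (A x).
Proof. by move=> pA; exact/op_invertible_below/posdef_invertible. Qed.

Lemma posdef_congr (T T' C : H -> H) (c : R) : posdef C ->
  bounded_operator T -> bounded_operator T' -> adjoint_pair T T' ->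
  0 < c -> (forall x, c * nrm x <= nrm (T x)) -> posdef (T' \o C \o T).
Proof.
move=> pC bT bT' TT c0 hc; split.
  apply/hermopP; split; first by do 2! apply: bounded_comp => //; exact: pC.1.1.
  move=> x y /=; rewrite -[RHS]TT -(posdef_sym _ _ pC).
  by rewrite [LHS]rdotC -TT [LHS]rdotC.
have [m m0 hm] := pC.2; exists (m * c ^+ 2) => [|x]; first by rewrite mulr_gt0 ?exprn_gt0.
rewrite /= rdotC -TT rdotC; apply: le_trans (hm _).
rewrite -mulrA ler_pM2l // -!nrm_sqr -exprMn ler_sqr ?nnegrE ?mulr_ge0 ?nrm_ge0 //.
exact: ltW.
Qed.

End positive_invertible.

(** * The inequalities of Loewner-Heinz and Hansen *)

Section loewner_heinz_hansen.
Context {R : realType} {H : hilbertType R}.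
Implicit Types (x y : H) (A B F G : H -> H) (t r s : R).

Lemma nrm_le_sqr (x y : H) : '[x, x] <= '[y, y] -> nrm x <= nrm y.
Proof. exact: ler_wsqrtr. Qed.

(** For tau > 1 the operator tau - T' is coercive, so tau - T, which is similar
to it, is invertible. Hence the spectrum of the self-adjoint T lies below 1. *)
Lemma similar_contraction_le T T' P : hermop T -> bounded_operator T' ->
  bounded_operator P -> op_invertible P -> (forall x, P (T x) = T' (P x)) ->
  (forall x, nrm (T' x) <= nrm x) -> forall x, '[T x, x] <= '[x, x].
Proof.
move=> hT bT' bP iP PT hT' x; have [->|x0] := eqVneq x 0.
  by rewrite [leLHS]rdotC !rdot0l.
have /hermopP[bT sT] := hT.
have bD : bounded_operator (fun x => (-1) *: (T x - 1%:C *: x)).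
  exact/bounded_scale/bounded_shift.
have hD : hermop (fun x => (-1) *: (T x - 1%:C *: x)).
  apply/hermopP; split => // u v.
  by rewrite !scaleN1r !(rdotNl, rdotNr, rdotDl, rdotDr, rdotZl, rdotZr) sT.
have [mu mus hmu] := bottom_spectrum hD x0.
have := hmu x; rewrite scaleN1r rdotNl rdotDl rdotNl rdotZl mul1r.
have [mu0|mu0] := leP 0 mu; first by have := mulr_ge0 mu0 (rdot_ge0 x); lra.
exfalso; apply: mus.
have iS : op_invertible (fun x => (1 - mu)%:C *: x - T' x).
  apply: (@coercive_invertible _ _ _ (- mu)); last first.
  - move=> u; rewrite rdotDl rdotNl rdotZl.
    have := le_trans (ler_norm _) (nrm_CS (T' u) u).
    have := ler_wpM2r (nrm_ge0 u) (hT' u).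
    rewrite -expr2 nrm_sqr; lra.
  - by rewrite oppr_gt0.
  have := bounded_scale (-1) (bounded_shift (1 - mu)%:C bT').
  congr bounded_operator; apply/funext => u.
  by rewrite scaleN1r opprB.
have [Q [bQ PQ QP]] := iP; have lQ := bQ.1.
have iQ : op_invertible Q by exists P.
apply: op_invertible_ext (op_invertible_comp (op_invertible_comp iQ iS) iP) => u /=.
rewrite -PT (opB lQ) (opZ lQ) !PQ scaleN1r opprB scale1r.
by rewrite rmorphB /= scalerBl scale1r addrAC.
Qed.

(** A^r <= B^r says that A^(r/2) B^(-r/2) is a contraction. *)
Lemma pow_ratio_contraction A B r x : posdef A -> posdef B ->
  (forall x, '[op_pow r A x, x] <= '[op_pow r B x, x]) ->
  nrm (op_pow (r / 2) A (op_pow (- (r / 2)) B x)) <= nrm x.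
Proof.
move=> pA pB h; apply: nrm_le_sqr; rewrite pow_half_sq //.
by apply: le_trans (h _) _; rewrite -pow_half_sq // op_powK.
Qed.

(** Pedersen's argument. For m = (r + s)/2 the self-adjoint operator
T = B^(-m/2) A^m B^(-m/2) is similar to T' = B^(-r/2) A^m B^(-s/2), the product
of the contraction A^(s/2) B^(-s/2) and the adjoint of the contraction
A^(r/2) B^(-r/2). By [similar_contraction_le] T <= 1, that is A^m <= B^m. *)
Lemma loewner_midpoint A B r s : posdef A -> posdef B ->
  (forall x, '[op_pow r A x, x] <= '[op_pow r B x, x]) ->
  (forall x, '[op_pow s A x, x] <= '[op_pow s B x, x]) ->
  forall x, '[op_pow ((r + s) / 2) A x, x] <= '[op_pow ((r + s) / 2) B x, x].
Proof.
move=> pA pB hr hs x; set m := (r + s) / 2.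
have lB q := posdef_lin (pow_posdef q pB).
have lA q := posdef_lin (pow_posdef q pA).
pose T u := op_pow (- (m / 2)) B (op_pow m A (op_pow (- (m / 2)) B u)).
pose T' u := op_pow (- (r / 2)) B (op_pow m A (op_pow (- (s / 2)) B u)).
have bpA q := (pow_posdef q pA).1.1.
have bpB q := (pow_posdef q pB).1.1.
have hT : hermop T.
  apply/hermopP; split; first exact: bounded_comp (bpB _) (bounded_comp (bpA _) (bpB _)).
  by move=> u v; rewrite /T !(pow_sym _ _ _ pB, pow_sym _ _ _ pA).
have T'le u : nrm (T' u) <= nrm u.
  have [->|T0] := eqVneq (T' u) 0; first by rewrite nrm0 nrm_ge0.
  have T0' : 0 < nrm (T' u) by rewrite nrm_gt0.
  rewrite -(ler_pM2r T0') -{1}expr2 nrm_sqr.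
  have -> : '[T' u, T' u] = '[op_pow (s / 2) A (op_pow (- (s / 2)) B u),
      op_pow (r / 2) A (op_pow (- (r / 2)) B (T' u))].
    rewrite {1}/T' pow_sym // -(pow_sym (r / 2)) // op_powD //.
    by rewrite -mulrDl -/m.
  apply: le_trans (ler_norm _) (le_trans (nrm_CS _ _) _).
  by apply: ler_pM; rewrite ?nrm_ge0 // pow_ratio_contraction.
have Tle := @similar_contraction_le T T' (op_pow ((m - r) / 2) B) hT _ (bpB _)
  (posdef_invertible (pow_posdef _ pB)) _ T'le.
have {}Tle : forall u, '[T u, u] <= '[u, u].
  apply: Tle; first exact: bounded_comp (bpB _) (bounded_comp (bpA _) (bpB _)).
  move=> u; rewrite /T /T' !op_powD //.
  by congr (op_pow _ B (op_pow _ A (op_pow _ B u))); rewrite /m; field.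
have -> : '[op_pow m A x, x] = '[T (op_pow (m / 2) B x), op_pow (m / 2) B x].
  by rewrite /T op_powNK // -pow_sym // op_powK.
by apply: le_trans (Tle _) _; rewrite pow_half_sq.
Qed.

(** k / 2^(n+1) is the midpoint of the two halves of k, both taken over 2^n. *)
Lemma loewner_dyadic A B n k : posdef A -> posdef B ->
  (forall x, '[A x, x] <= '[B x, x]) -> (k <= 2 ^ n)%N ->
  forall x, '[op_pow (k%:R / 2 ^+ n) A x, x] <= '[op_pow (k%:R / 2 ^+ n) B x, x].
Proof.
move=> pA pB AB; elim: n k => [|n IH] k.
  rewrite expn0 expr0 divr1; case: k => [|[|//]] _ x; first by rewrite !op_pow0.
  by rewrite !op_pow1.
move=> kn; have E : k%:R / 2 ^+ n.+1 = (k./2%:R / 2 ^+ n + (uphalf k)%:R / 2 ^+ n) / 2 :> R.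
  rewrite -mulrDl -natrD uphalf_half addnCA addnn [in LHS](esym (odd_double_half k)).
  by rewrite exprS; field; rewrite expf_neq0.
rewrite E; apply: loewner_midpoint => //; apply: IH.
  by have := half_leq kn; rewrite expnS mul2n doubleK.
by have := uphalf_leq kn; rewrite expnS mul2n uphalf_double.
Qed.

Lemma bernoulli_ineq (y : R) n : 1 <= y -> 1 + n%:R * (y - 1) <= y ^+ n.
Proof.
move=> y1; elim: n => [|n IH]; first by rewrite mul0r addr0 expr0.
rewrite exprS -natr1; have := ler_wpM2l (le_trans ler01 y1) IH.
have : 0 <= n%:R * (y - 1) ^+ 2 by rewrite mulr_ge0 ?sqr_ge0.
by rewrite expr2; lra.
Qed.

(** Bernoulli's inequality for y = K^(1/2^n): 1 + 2^n (y - 1) <= K. *)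
Lemma powR_near1 (K : R) n : 1 <= K -> K `^ (2 ^+ n)^-1 <= 1 + K / 2 ^+ n.
Proof.
move=> K1; set y := _ `^ _.
have y1 : 1 <= y.
  by rewrite -[leLHS](powRr0 K) ler_powR // invr_ge0 exprn_ge0.
have := bernoulli_ineq (2 ^ n) y1.
rewrite -powR_mulrn ?(le_trans ler01) // /y -powRrM -/y natrX
  mulVf ?expf_neq0 // powRr1 ?(le_trans ler01) //.
have p0 : 0 < 2 ^+ n :> R by rewrite exprn_gt0.
move=> h; rewrite -lerBlDl ler_pdivlMr //; lra.
Qed.

Lemma powR_split (t r q : R) : 0 < t -> t `^ r = t `^ (r - q) * t `^ q.
Proof. by move=> t0; rewrite -powRD ?subrK //; apply/implyP => _; rewrite gt_eqF. Qed.

(** For exponents between the dyadic ones, q is the largest k / 2^n below r.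
Passing from r to q for A and back for B costs the factor K^(r - q), where K
bounds the quotient of spectral values of A and B; it tends to 1 by
[powR_near1]. *)
Theorem loewner_heinz A B r : posdef A -> posdef B ->
  (forall x, '[A x, x] <= '[B x, x]) -> 0 <= r <= 1 ->
  forall x, '[op_pow r A x, x] <= '[op_pow r B x, x].
Proof.
move=> pA pB AB /andP[r0 r1] x.
have [a [a' [a0 a'0 aA _]]] := posdef_itv pA; have [b [b' [b0 b'0 bB _]]] := posdef_itv pB.
pose C := Num.max 1 a'; pose c := Num.min 1 b.
have C1 : 1 <= C by rewrite le_max lexx.
have C0 : 0 < C by apply: lt_le_trans C1.
have c1 : c <= 1 by rewrite ge_min lexx.
have c0 : 0 < c by rewrite lt_min ltr01.
pose K := C / c; have K1 : 1 <= K by rewrite ler_pdivlMr // mul1r (le_trans c1).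
have K0 : 0 < K := lt_le_trans ltr01 K1.
apply: (@ler_eps _ _ _ (K * '[op_pow r B x, x])).
  by rewrite mulr_ge0 ?(ltW K0) // posdef_ge0 //; exact: pow_posdef.
move=> e e0; have [|n hn] := @geometric_small R 2^-1 e _ e0.
  by rewrite invr_ge0 ltW //= invf_lt1 // ltr1n.
have p0 : 0 < 2 ^+ n :> R by rewrite exprn_gt0.
pose k := Num.truncn (r * 2 ^+ n).
have kr : k%:R / 2 ^+ n <= r by rewrite ler_pdivrMr // truncn_le ?mulr_ge0 // ltW.
have rk : r - k%:R / 2 ^+ n <= (2 ^+ n)^-1.
  have : r * 2 ^+ n < k.+1%:R by exact: truncnS_gt.
  rewrite -ltr_pdivlMr // -natr1 mulrDl mul1r; lra.
have kn : (k <= 2 ^ n)%N.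
  rewrite -(ler_nat R) natrX; apply: le_trans (_ : r * 2 ^+ n <= _).
    by rewrite truncn_le ?mulr_ge0 // ltW.
  by rewrite ler_piMl // ltW.
set q := k%:R / 2 ^+ n in kr rk.
have d0 : 0 <= r - q by rewrite subr_ge0.
have hA : '[op_pow r A x, x] <= C `^ (r - q) * '[op_pow q A x, x].
  rewrite -rdotZl.
  apply: (is_fcalc_mono pA.1 (pow_fcalc r pA) (is_fcalc_scale _ pA.1 (pow_fcalc q pA)) _ x).
  move=> t /aA /= /andP[ta ta']; have t0 : 0 < t := lt_le_trans a0 ta.
  rewrite (powR_split r q t0) ler_pM2r ?powR_gt0 //.
  by rewrite ge0_ler_powR ?nnegrE ?(ltW t0) ?(ltW C0) // le_max ta' orbT.
have hB : '[op_pow q B x, x] <= (c `^ (r - q))^-1 * '[op_pow r B x, x].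
  rewrite -rdotZl.
  apply: (is_fcalc_mono pB.1 (pow_fcalc q pB) (is_fcalc_scale _ pB.1 (pow_fcalc r pB)) _ x).
  move=> t /bB /= /andP[tb tb']; have t0 : 0 < t := lt_le_trans b0 tb.
  rewrite (powR_split r q t0) ler_pdivlMl ?powR_gt0 // ler_pM2r ?powR_gt0 //.
  by rewrite ge0_ler_powR ?nnegrE ?(ltW t0) ?(ltW c0) // ge_min tb orbT.
have hq := loewner_dyadic pA pB AB kn x.
apply: le_trans hA _; apply: le_trans (ler_wpM2l (powR_ge0 _ _) (le_trans hq hB)) _.
have rB0 : 0 <= '[op_pow r B x, x] by rewrite posdef_ge0 //; exact: pow_posdef.
have -> : C `^ (r - q) * ((c `^ (r - q))^-1 * '[op_pow r B x, x]) =
    K `^ (r - q) * '[op_pow r B x, x].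
  rewrite /K powRM ?(ltW C0) ?invr_ge0 ?(ltW c0) // mulrA.
  by rewrite -[c^-1]powR_inv1 ?(ltW c0) // -powRrM mulN1r powRN.
have hK : K `^ (r - q) <= 1 + K / 2 ^+ n.
  by apply: le_trans (powR_near1 _ K1); rewrite ler_powR.
have := ler_wpM2r rB0 hK.
have : (2 ^+ n)^-1 <= e by have := hn n (leqnn _); rewrite exprVn.
move=> h1; have := ler_wpM2r (mulr_ge0 (ltW K0) rB0) h1; lra.
Qed.

Lemma posdef_id : posdef (@id H).
Proof.
split; last by exists 1 => // x; rewrite mul1r.
by split; [exact: bounded_id | move=> x y].
Qed.

Lemma posdef_common_itv A B : posdef A -> posdef B -> exists m M : R,
  0 < m /\ rspec A `|` rspec B `<=` [set t | m <= t <= M].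
Proof.
move=> /posdef_itv[a [a' [a0 _ aA _]]] /posdef_itv[b [b' [b0 _ bB _]]].
exists (Num.min a b), (Num.max a' b'); split; first by rewrite lt_min a0.
by move=> t [/aA|/bB] /= /andP[h1 h2]; rewrite ge_min le_max h1 h2 ?orbT.
Qed.

(** Let h = A^(p/2), V = h K K h and W = K h h K. The operator K h intertwines V
and W, whence W^(1/p) = K h V^(-s) h K with s = 1 - 1/p. As K is a contraction,
V <= A^p, so that V^s <= A^(p s) by Loewner-Heinz and V^(-s) >= A^(-p s). The
outer factors h turn the exponent - p s into p - p s = 1. *)
Lemma hansen A K p : posdef A -> posdef K -> (forall x, nrm (K x) <= nrm x) -> 1 <= p ->
  posdef (K \o op_pow p A \o K) /\
  forall x, '[K (A (K x)), x] <= '[op_pow p^-1 (K \o op_pow p A \o K) x, x].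
Proof.
move=> pA pK hK p1; have p0 : 0 < p := lt_le_trans ltr01 p1.
have symK : adjoint_pair K K by move=> u v; exact: posdef_sym.
have [cK cK0 hcK] := posdef_below pK.
set W := K \o op_pow p A \o K.
have pW : posdef W.
  exact: posdef_congr (pow_posdef p pA) pK.1.1 pK.1.1 symK cK0 hcK.
split => // x.
pose h := op_pow (p / 2) A; have ph : posdef h := pow_posdef _ pA.
have hh u : h (h u) = op_pow p A u by rewrite /h op_powD // -splitr.
have [ch ch0 hch] := posdef_below ph.
pose V := h \o (K \o id \o K) \o h.
have pV : posdef V.
  apply: (@posdef_congr _ _ h h _ ch) ph.1.1 ph.1.1 _ ch0 hch.
    exact: posdef_congr posdef_id pK.1.1 pK.1.1 symK cK0 hcK.
  by move=> u v; exact: posdef_sym.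
pose s := 1 - p^-1.
have s01 : 0 <= s <= 1.
  by rewrite subr_ge0 invf_le1 // p1 /= lerBlDr lerDl invr_ge0 ltW.
have VA u : '[V u, u] <= '[op_pow p A u, u].
  rewrite /V /= (posdef_sym _ _ ph) (posdef_sym _ _ pK) -pow_half_sq // -!nrm_sqr.
  by rewrite ler_sqr ?nnegrE ?nrm_ge0.
have pAp := pow_posdef p pA.
have lh := loewner_heinz pV pAp VA s01.
have {lh} inv := inverse_antitone (pow_posdef s pV) (pow_posdef s pAp) lh.
have {}inv u : '[op_pow (p * s * -1) A u, u] <= '[op_pow (- s) V u, u].
  by have := inv u; rewrite (op_pow_pow s p pA) (op_pow_pow (-1) (p * s) pA)
    (op_pow_pow (-1) s pV) !mulrN1.
have tw u : K (h (op_pow (- s) V u)) = op_pow (- s) W (K (h u)).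
  have [m [M [m0 mM]]] := posdef_common_itv pV pW.
  have /bounded_nrmP[lKh [N N0 hN]] := bounded_comp pK.1.1 ph.1.1.
  apply: (@fcalc_intertwine _ _ _ V W (K \o h) _ N pV.1 pW.1 lKh (ltW N0) hN).
    by move=> v; rewrite /V /W /= hh.
  by apply: approximable_sub mM _; exact: approximable_powR.
have -> : op_pow p^-1 W x = K (h (op_pow (- s) V (h (K x)))).
  rewrite tw hh -[K (op_pow p A (K x))]/(W x) -(op_pow1 x pW) op_powD //.
  by congr (op_pow _ _ _); rewrite /s; ring.
rewrite [leRHS](posdef_sym _ _ pK) [leRHS](posdef_sym _ _ ph); apply: le_trans (inv _).
rewrite [leLHS](posdef_sym _ _ pK) -[leRHS](posdef_sym _ _ ph) /h !op_powD //.
have -> : p / 2 + p * s * -1 + p / 2 = 1 by rewrite /s; field; rewrite gt_eqF.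
by rewrite op_pow1.
Qed.

End loewner_heinz_hansen.

(** * Jensen's operator inequality *)

Lemma zmod_cancel1 (V : zmodType) (a b x : V) : a + b + (x - a - b) = x.
Proof. by rewrite -[x - a - b]addrA -opprD subrKC. Qed.
Lemma zmod_cancel2 (V : zmodType) (a b y : V) : a + (y - b) - (a - b) = y.
Proof. by rewrite opprB addrA -[a + (y - b) + b]addrA subrK addrAC subrr add0r. Qed.

Section scalar_operators.
Context {R : realType} {H : hilbertType R}.
Implicit Types (x y : H) (A B : H -> H).

Definition scal (c : R) : H -> H := fun x => c%:C *: x.

Lemma scal_herm c : hermop (scal c).
Proof.
apply/hermopP; split; first exact: bounded_scale bounded_id.
by move=> x y; rewrite /scal rdotZl rdotZr.
Qed.

Lemma scal_posdef c : 0 < c -> posdef (scal c).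
Proof. by move=> c0; split; [exact: scal_herm | exists c => // x; rewrite rdotZl]. Qed.

Lemma scal_rspec c : rspec (scal c) `<=` [set c].
Proof.
move=> t tc /=; apply/eqP; rewrite eq_le.
rewrite (spectrum_le (scal_herm c) _ tc) ?(spectrum_ge (scal_herm c) _ tc) //.
all: by move=> x; rewrite rdotZl.
Qed.

Lemma scal_fcalc f c : is_fcalc f (scal c) (scal (f c)).
Proof.
apply/is_fcalc_nrmP => e e0; exists (f c)%:P; split=> [t /scal_rspec ->|x].
  by rewrite hornerC subrr normr0 ltW.
by rewrite poly_opC subrr nrm0 mulr_ge0 ?nrm_ge0 // ltW.
Qed.

Lemma opmon_le h A B : operator_monotone h -> posdef A -> posdef B ->
  (forall x, '[B x, x] <= '[A x, x]) ->
  forall x, '[fcalc h B x, x] <= '[fcalc h A x, x].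
Proof.
move=> hm pA pB BA x.
have : op_le (fcalc h B) (fcalc h A).
  apply: hm.
  - exact: pA.1.1.
  - exact: pA.1.2.
  - by move=> z; exact: posdef_spectrum.
  - exact: pB.1.1.
  - exact: pB.1.2.
  - by move=> z; exact: posdef_spectrum.
  have lD : linear (fun x => A x - B x).
    by move=> a u v /=; rewrite (posdef_lin pA) (posdef_lin pB) scalerBr opprD addrACA.
  apply/selfadjoint_psdP => //; last first.
    by move=> u; rewrite rdotDl rdotNl subr_ge0.
  apply/selfadjoint_pairP => // u v.
  by rewrite rdotDl rdotNl rdotDr rdotNr !posdef_sym.
move=> /(_ x); rewrite lecE => /andP[_].
by rewrite -[X in _ <= X]/('[fcalc h A x - fcalc h B x, x]) rdotDl rdotNl subr_ge0.
Qed.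

(** The defect 1 - K' K of a contraction has a square root, as its spectrum lies
in the unit interval; [dilation] uses it. *)
Lemma contraction_defect K K' : bounded_operator K -> bounded_operator K' ->
  adjoint_pair K K' -> (forall x, nrm (K x) <= nrm x) ->
  hermop (fun x => x - K' (K x)) /\ rspec (fun x => x - K' (K x)) `<=` [set t | 0 <= t <= 1].
Proof.
move=> bK bK' KK hK.
have hD : hermop (fun x => x - K' (K x)).
  apply/hermopP; split.
    have := bounded_add bounded_id (bounded_scale (-1) (bounded_comp bK' bK)).
    by congr bounded_operator; apply/funext => x; rewrite scaleN1r.
  move=> x y; rewrite rdotDl rdotNl rdotDr rdotNr -KK.
  by congr (_ - _); rewrite rdotC -KK rdotC.
have DE x : '[x - K' (K x), x] = '[x, x] - '[K x, K x].
  by rewrite rdotDl rdotNl [X in _ - X]rdotC -KK.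
split => // t tD; apply/andP; split.
  apply: spectrum_ge hD _ tD => x; rewrite DE mul0r subr_ge0 -!nrm_sqr.
  by rewrite ler_sqr ?nnegrE ?nrm_ge0.
by apply: spectrum_le hD _ tD => x; rewrite DE mul1r gerBl rdot_ge0.
Qed.

Lemma adjoint_contraction K K' : adjoint_pair K K' -> (forall x, nrm (K x) <= nrm x) ->
  forall x, nrm (K' x) <= nrm x.
Proof.
move=> KK hK x; have [->|h] := eqVneq (K' x) 0; first by rewrite nrm0 nrm_ge0.
have h' : 0 < nrm (K' x) by rewrite nrm_gt0.
rewrite -(ler_pM2l h') -expr2 nrm_sqr -KK.
apply: le_trans (ler_norm _) (le_trans (nrm_CS _ _) _).
by rewrite ler_wpM2r ?nrm_ge0.
Qed.

Lemma sqrt_op D : hermop D -> rspec D `<=` [set t | 0 <= t <= 1] ->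
  hermop (fcalc Num.sqrt D) /\ forall x, fcalc Num.sqrt D (fcalc Num.sqrt D x) = D x.
Proof.
move=> hD Dspec.
have fD : is_fcalc Num.sqrt D (fcalc Num.sqrt D).
  by apply: is_fcalc_ex => //; apply: approximable_sub Dspec _; exact: approximable_sqrt.
split; first exact: is_fcalc_herm hD fD.
move=> x; rewrite -[LHS]/((fcalc Num.sqrt D \o fcalc Num.sqrt D) x); congr (_ x).
apply: (fcalc_uniq hD _ (is_fcalc_id D)).
apply: is_fcalc_ext (is_fcalc_mul hD fD fD) => t /Dspec /= /andP[t0 _].
by rewrite -expr2 sqr_sqrtr.
Qed.

Lemma rspec_conj (T U U' : H -> H) : bounded_operator U -> bounded_operator U' ->
  cancel U U' -> cancel U' U -> rspec (fun x => U' (T (U x))) `<=` rspec T.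
Proof.
move=> bU bU' UK U'K t; rewrite /rspec /spectrum /=; apply: contra_not => iT.
have iU : op_invertible U by exists U'.
have iU' : op_invertible U' by exists U.
apply: op_invertible_ext (op_invertible_comp (op_invertible_comp iU' iT) iU) => x /=.
by rewrite (opB bU'.1) (opZ bU'.1) UK.
Qed.

End scalar_operators.

Section unitary_dilation.
Context {R : realType} {H : hilbertType R}.
Variables (K K' : H -> H).
Hypotheses (bK : bounded_operator K) (bK' : bounded_operator K').
Hypotheses (KK : adjoint_pair K K') (cK : forall x, nrm (K x) <= nrm x).

Let KK' : adjoint_pair K' K.
Proof. by move=> x y; rewrite rdotC -KK rdotC. Qed.
Let cK' : forall x, nrm (K' x) <= nrm x.
Proof. exact: adjoint_contraction KK cK. Qed.

Let D x := x - K' (K x).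
Let D' x := x - K (K' x).
Let hD : hermop D. Proof. exact: (contraction_defect bK bK' KK cK).1. Qed.
Let hD' : hermop D'. Proof. exact: (contraction_defect bK' bK KK' cK').1. Qed.
Let sD : rspec D `<=` [set t | 0 <= t <= 1].
Proof. exact: (contraction_defect bK bK' KK cK).2. Qed.
Let sD' : rspec D' `<=` [set t | 0 <= t <= 1].
Proof. exact: (contraction_defect bK' bK KK' cK').2. Qed.
Let S := fcalc Num.sqrt D.
Let S' := fcalc Num.sqrt D'.
Let hS : hermop S. Proof. exact: (sqrt_op hD sD).1. Qed.
Let hS' : hermop S'. Proof. exact: (sqrt_op hD' sD').1. Qed.
Let SS x : S (S x) = D x. Proof. exact: (sqrt_op hD sD).2. Qed.
Let SS' x : S' (S' x) = D' x. Proof. exact: (sqrt_op hD' sD').2. Qed.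

Let KS x : K (S x) = S' (K x).
Proof.
have /bounded_nrmP[lK [M M0 hM]] := bK.
apply: (@fcalc_intertwine _ _ _ D D' K Num.sqrt M hD hD' lK (ltW M0) hM).
  by move=> u; rewrite /D /D' (opB lK).
apply: approximable_sub (approximable_sqrt 1) => t [/sD|/sD'] //.
Qed.

Let KS' x : K' (S' x) = S (K' x).
Proof.
have /bounded_nrmP[lK [M M0 hM]] := bK'.
apply: (@fcalc_intertwine _ _ _ D' D K' Num.sqrt M hD' hD lK (ltW M0) hM).
  by move=> u; rewrite /D /D' (opB lK).
apply: approximable_sub (approximable_sqrt 1) => t [/sD'|/sD] //.
Qed.

(** Halmos' dilation of K to a unitary on H + H, with the square roots S of
1 - K' K and S' of 1 - K K' as off-diagonal entries. It is unitary because K S =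
S' K and K' S' = S K'. *)
Definition dilation : dsum H -> dsum H := fun u => (K u.1 + S' u.2, S u.1 - K' u.2).
Definition dilation' : dsum H -> dsum H := fun u => (K' u.1 + S u.2, S' u.1 - K u.2).

Let dilK : cancel dilation dilation'.
Proof.
move=> [x y]; rewrite /dilation /dilation' /=.
rewrite (opD bK'.1) (opB hS.1.1) (opD hS'.1.1) (opB bK.1) SS SS' KS KS' /D /D'.
by rewrite zmod_cancel1 zmod_cancel2.
Qed.
Let dilK' : cancel dilation' dilation.
Proof.
move=> [x y]; rewrite /dilation /dilation' /=.
rewrite (opD bK.1) (opB hS'.1.1) (opD hS.1.1) (opB bK'.1) SS SS' KS KS' /D /D'.
by rewrite zmod_cancel1 zmod_cancel2.
Qed.
Lemma dilation_adj : adjoint_pair dilation dilation'.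
Proof.
move=> u v; rewrite !rdot_dsum /=.
have /hermopP[_ sS] := hS; have /hermopP[_ sS'] := hS'.
rewrite !(rdotDl, rdotDr, rdotNl, rdotNr) KK KK' sS sS'.
by ring.
Qed.

Let bU : bounded_operator dilation.
Proof.
have /bounded_nrmP[lK [M M0 hM]] := bK; have /bounded_nrmP[lK' [M' M'0 hM']] := bK'.
have /bounded_nrmP[lS [N N0 hN]] := hS.1; have /bounded_nrmP[lS' [N' N'0 hN']] := hS'.1.
apply/bounded_nrmP; split.
  move=> a u v; rewrite /dilation /= lK lK' lS lS' dsum_scaleE dsum_addE /=.
  by congr pair; [rewrite scalerDr addrACA | rewrite scalerBr opprD addrACA].
exists (M + N' + (N + M')) => [|u]; first by rewrite !addr_gt0.
apply: le_trans (nrm_dsum_le _) _ => /=.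
have h1 := nrm_fst_le u; have h2 := nrm_snd_le u.
have := nrmD (K u.1) (S' u.2); have := nrmD (S u.1) (- K' u.2).
rewrite nrmN.
have := le_trans (hM u.1) (ler_wpM2l (ltW M0) h1).
have := le_trans (hM' u.2) (ler_wpM2l (ltW M'0) h2).
have := le_trans (hN u.1) (ler_wpM2l (ltW N0) h1).
have := le_trans (hN' u.2) (ler_wpM2l (ltW N'0) h2).
lra.
Qed.

Let bU' : bounded_operator dilation'.
Proof.
have /bounded_nrmP[lK [M M0 hM]] := bK; have /bounded_nrmP[lK' [M' M'0 hM']] := bK'.
have /bounded_nrmP[lS [N N0 hN]] := hS.1; have /bounded_nrmP[lS' [N' N'0 hN']] := hS'.1.
apply/bounded_nrmP; split.
  move=> a u v; rewrite /dilation' /= lK lK' lS lS' dsum_scaleE dsum_addE /=.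
  by congr pair; [rewrite scalerDr addrACA | rewrite scalerBr opprD addrACA].
exists (M' + N + (N' + M)) => [|u]; first by rewrite !addr_gt0.
apply: le_trans (nrm_dsum_le _) _ => /=.
have h1 := nrm_fst_le u; have h2 := nrm_snd_le u.
have := nrmD (K' u.1) (S u.2); have := nrmD (S' u.1) (- K u.2).
rewrite nrmN.
have := le_trans (hM' u.1) (ler_wpM2l (ltW M'0) h1).
have := le_trans (hM u.2) (ler_wpM2l (ltW M0) h2).
have := le_trans (hN' u.1) (ler_wpM2l (ltW N'0) h1).
have := le_trans (hN u.2) (ler_wpM2l (ltW N0) h2).
lra.
Qed.

Let nU u : nrm (dilation u) = nrm u.
Proof. by rewrite /nrm dilation_adj dilK. Qed.

Lemma diag_posdef (A B : H -> H) : posdef A -> posdef B -> posdef (diag_op A B).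
Proof.
move=> [hA [a a0 ha]] [hB [b b0 hb]]; split; first exact: diag_herm.
exists (Num.min a b) => [|u]; first by rewrite lt_min a0.
rewrite !rdot_dsum /= mulrDr lerD //.
  by apply: le_trans (ha _); rewrite ler_wpM2r ?rdot_ge0 // ge_min lexx.
by apply: le_trans (hb _); rewrite ler_wpM2r ?rdot_ge0 // ge_min lexx orbT.
Qed.

Let dil1 x : dilation (x, 0) = (K x, S x).
Proof. by rewrite /dilation /= (op0 hS'.1.1) (op0 bK'.1) addr0 subr0. Qed.

Let SxSx x : '[S x, S x] = '[x, x] - '[K x, K x].
Proof.
have /hermopP[_ sS] := hS.
by rewrite sS SS /D rdotDr rdotNr -KK.
Qed.

(** With U the dilation and T = diag(C, eps), the operator W = U' T U has upper
left entry K' C K + eps (1 - K' K). The slack d absorbs the off-diagonal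
entries, so W <= diag(E, N) for a large N. Monotony of h on H + H gives
U' h(T) U = h(W) <= diag(h(E), h(N)), and the upper left entries of both sides
are the claim. The positive eps replaces the 0 of the classical proof, which
lies outside the domain of h. *)
Lemma operator_jensen (h : R -> R) (C E : H -> H) (eps d : R) :
  operator_monotone h -> posdef C -> posdef E -> 0 < eps -> 0 < d ->
  approximable h [set t | rspec C t \/ t = eps] ->
  (forall N, 0 < N -> approximable h [set t | rspec E t \/ t = N]) ->
  (forall x, '[C (K x), K x] + eps * ('[x, x] - '[K x, K x]) + d * '[x, x] <= '[E x, x]) ->
  forall x, '[fcalc h C (K x), K x] + h eps * ('[x, x] - '[K x, K x]) <= '[fcalc h E x, x].
Proof.
move=> hm pC pE e0 d0 hC hE hCE x.
pose T := diag_op C (scal eps); have pT : posdef T by apply: diag_posdef => //; exact: scal_posdef.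
pose W := dilation' \o T \o dilation.
have pW : posdef W.
  apply: (posdef_congr pT bU bU' dilation_adj ltr01) => u.
  by rewrite mul1r nU.
have /bounded_nrmP[lT [M M0 hM]] := pT.1.1.
(* M bounds T, so N exceeds the lower right entry of W by M^2 / d, the amount by
   which AM-GM and d dominate the off-diagonal entries. *)
pose N := M ^+ 2 / d + M; have N0 : 0 < N by rewrite addr_gt0 // divr_gt0 ?exprn_gt0.
have pG : posdef (diag_op E (scal N)) by apply: diag_posdef => //; exact: scal_posdef.
have WG u : '[W u, u] <= '[diag_op E (scal N) u, u].
  rewrite /W /= rdotC -dilation_adj rdotC.
  pose a := dilation (u.1, 0); pose b := dilation (0, u.2).
  have -> : dilation u = a + b.
    by rewrite -(opD bU.1) dsum_addE /= addr0 add0r; case: (u).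
  rewrite (opD lT) !(rdotDl, rdotDr) (posdef_sym b a pT) (rdotC b).
  have -> : '[diag_op E (scal N) u, u] = '[E u.1, u.1] + N * '[u.2, u.2].
    by rewrite rdot_dsum /= rdotZl.
  have ha : '[T a, a] <= '[E u.1, u.1] - d * '[u.1, u.1].
    have := hCE u.1; rewrite /a dil1 rdot_dsum /= /scal rdotZl SxSx; lra.
  have na : nrm a = nrm u.1.
    by rewrite /a nU /nrm rdot_dsum /= rdot0l addr0.
  have nb : nrm b = nrm u.2.
    by rewrite /b nU /nrm rdot_dsum /= rdot0l add0r.
  have hb : '[T b, b] <= M * '[u.2, u.2].
    apply: le_trans (ler_norm _) (le_trans (nrm_CS _ _) _).
    apply: le_trans (ler_wpM2r (nrm_ge0 _) (hM b)) _.
    by rewrite nb -mulrA -expr2 nrm_sqr.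
  have hab : '[T a, b] <= M * nrm u.1 * nrm u.2.
    apply: le_trans (ler_norm _) (le_trans (nrm_CS _ _) _).
    by rewrite nb -na ler_wpM2r ?nrm_ge0.
  have amgm : 2 * (M * nrm u.1 * nrm u.2) <= d * '[u.1, u.1] + M ^+ 2 / d * '[u.2, u.2].
    rewrite -!nrm_sqr -subr_ge0.
    have -> : d * nrm u.1 ^+ 2 + M ^+ 2 / d * nrm u.2 ^+ 2 - 2 * (M * nrm u.1 * nrm u.2) =
      (d * nrm u.1 - M * nrm u.2) ^+ 2 / d by field; rewrite gt_eqF.
    by rewrite divr_ge0 ?sqr_ge0 // ltW.
  rewrite /N mulrDl; lra.
have key := opmon_le hm pG pW WG (x, 0).
have approxT : approximable h (rspec C `|` rspec (@scal _ H eps)).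
  by apply: approximable_sub hC => t [|/scal_rspec]; [left|right].
have tw u : dilation' (fcalc h T u) = fcalc h W (dilation' u).
  have /bounded_nrmP[lU' [P P0 hP]] := bU'.
  apply: (@fcalc_intertwine _ _ _ T W dilation' h P pT.1 pW.1 lU' (ltW P0) hP).
    by move=> v; rewrite /W /= dilK'.
  apply: approximable_sub approxT => t [/diag_rspec//|].
  by move=> /(rspec_conj bU bU' dilK dilK')/diag_rspec.
move: key; rewrite -[X in fcalc h W X]dilK -tw.
rewrite [in X in X -> _]rdotC -dilation_adj rdotC.
rewrite (fcalc_diag pC.1 (scal_herm eps) approxT).
rewrite (fcalc_diag pE.1 (scal_herm N)); last first.
  by apply: approximable_sub (hE N N0) => t [|/scal_rspec]; [left|right].
rewrite dil1 !rdot_dsum /= (fcalcE (scal_herm eps) (scal_fcalc _ _)) /scal rdotZl SxSx.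
by rewrite [X in _ <= _ + X]rdotC rdot0l addr0.
Qed.
End unitary_dilation.

(** * Scalar properties of operator monotone functions *)

Section order_by_forms.
Context {R : realType} {H : hilbertType R}.
Implicit Types (x y : H) (A B : H -> H).

Lemma op_leP A B : hermop A -> hermop B ->
  op_le A B <-> forall x, '[A x, x] <= '[B x, x].
Proof.
move=> /hermopP[bA sA] /hermopP[bB sB].
have lD : linear (fun x => B x - A x).
  by move=> a u v /=; rewrite bA.1 bB.1 scalerBr opprD addrACA.
have sD : selfadjoint (fun x => B x - A x).
  by apply/selfadjoint_pairP => // u v; rewrite rdotDl rdotNl rdotDr rdotNr sA sB.
split=> [/(selfadjoint_psdP lD sD) h x|h].
  by have := h x; rewrite rdotDl rdotNl subr_ge0.
by apply/(selfadjoint_psdP lD sD) => x; rewrite rdotDl rdotNl subr_ge0.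
Qed.

Lemma posdef_of_spectrum A : bounded_operator A -> selfadjoint A ->
  (forall z, spectrum A z -> 0 < z) -> posdef A.
Proof.
move=> bA sA hz; have hA : hermop A by [].
split => //; have [[x0 x00]|H0] := pselect (exists x : H, x != 0).
  have [m mA hm] := bottom_spectrum hA x00.
  by exists m => //; rewrite -ltcR; apply: hz.
exists 1 => // x; have -> : x = 0.
  by apply/eqP; apply: contrapT => /negP x0; apply: H0; exists x.
by rewrite [leLHS]mul1r [leRHS]rdotC !rdot0l.
Qed.
End order_by_forms.

Lemma scalE (R : realType) (H : hilbertType R) (c : R) (x y : H) : '[scal c x, y] = c * '[x, y].
Proof. exact: rdotZl. Qed.

Section scalar_functions.
Context {R : realType}.
Implicit Types (g h : R -> R).

(** To prove h operator monotone, compare the forms of operators F that are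
known to compute h. *)
Lemma opmon_of_forms h (F : forall H : hilbertType R, (H -> H) -> H -> H) :
  (forall (H : hilbertType R) (A : H -> H), posdef A -> is_fcalc h A (F H A)) ->
  (forall (H : hilbertType R) (A B : H -> H), posdef A -> posdef B ->
     (forall x, '[B x, x] <= '[A x, x]) ->
     forall x, '[F H B x, x] <= '[F H A x, x]) -> operator_monotone h.
Proof.
move=> hF hmon H A B bA sA zA bB sB zB BA.
have pA := posdef_of_spectrum bA sA zA; have pB := posdef_of_spectrum bB sB zB.
rewrite (fcalcE pA.1 (hF _ _ pA)) (fcalcE pB.1 (hF _ _ pB)).
have fh (C : H -> H) (pC : posdef C) := is_fcalc_herm pC.1 (hF _ _ pC).
apply/op_leP; [exact: fh | exact: fh |].
by apply: hmon => //; apply/op_leP.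
Qed.

Let one : cplx R := (1 : R[i]).
Let one_sq : '[one, one] = 1.
Proof. by rewrite -[LHS]/(Re (cip one one)) cipE /= expr1n expr0n addr0. Qed.

Lemma opmon_nondecreasing h : operator_monotone h -> forall x y, 0 < x -> x <= y -> h x <= h y.
Proof.
move=> hm x y x0 xy; have y0 := lt_le_trans x0 xy.
have := @opmon_le R (cplx R) h (scal y) (scal x) hm (scal_posdef y0) (scal_posdef x0).
rewrite !(fcalcE (scal_herm _) (scal_fcalc _ _)) => /(_ _ one).
rewrite /scal !rdotZl one_sq !mulr1; apply => u.
by rewrite /scal !rdotZl ler_wpM2r ?rdot_ge0.
Qed.

(** [operator_jensen] on the complex line, for K = sqrt t, C = a and eps = b.
The spectra involved have at most two points, where approximation by polynomials
is linear interpolation: the lemma is available before h is known to be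
continuous. *)
Lemma opmon_concave_slack h : operator_monotone h -> forall a b t d,
  0 < a -> 0 < b -> 0 <= t <= 1 -> 0 < d ->
  t * h a + (1 - t) * h b <= h (t * a + (1 - t) * b + d).
Proof.
move=> hm a b t d a0 b0 /andP[t0 t1] d0; set e := _ + d.
have e0 : 0 < e by rewrite ltr_wpDl // addr_ge0 // mulr_ge0 ?subr_ge0 // ltW.
have hK : hermop (scal (Num.sqrt t) : cplx R -> cplx R) := scal_herm _.
have /hermopP[bK sK] := hK.
have KE (x : cplx R) : '[scal (Num.sqrt t) x, scal (Num.sqrt t) x] = t * '[x, x].
  by rewrite rdotZl rdotZr mulrA -expr2 sqr_sqrtr.
have := @operator_jensen R (cplx R) (scal (Num.sqrt t)) (scal (Num.sqrt t)) bK bK sK _ h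
  (scal a) (scal e) b d hm (scal_posdef a0) (scal_posdef e0) b0 d0.
rewrite !(fcalcE (scal_herm _) (scal_fcalc _ _)) => /(_ _ _ _ _ one).
rewrite (scalE (h a)) (scalE (h e)) !KE !one_sq !mulr1 => key.
have -> : t * h a + (1 - t) * h b = h a * t + h b * (1 - t) by ring.
apply: key.
- move=> x; apply: nrm_le_sqr; rewrite KE; have := rdot_ge0 x; nra.
- by apply: approximable_sub (approximable_pair h a b) => u [/scal_rspec|]; [left|right].
- move=> N _; apply: approximable_sub (approximable_pair h e N) => u.
  by case=> [/scal_rspec|]; [left|right].
- move=> x; rewrite (scalE a) (scalE e) !KE /e.
  by rewrite le_eqVlt; apply/orP; left; apply/eqP; ring.
Qed.
End scalar_functions.

Section concavity.
Context {R : realType}.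
Implicit Types (g h : R -> R).

(** Write x = t (x/2) + (1 - t) y + d. Concavity with slack d then bounds
h y - h x by t (h y - h (x/2)), and t is at most (y - x + d) / (x/2); the slack d
tends to 0. *)
Lemma opmon_lipschitz h (m M : R) : operator_monotone h -> 0 < m -> exists2 L : R, 0 <= L &
  forall x y, m <= x -> x < y -> y <= M -> `|h y - h x| <= L * (y - x).
Proof.
move=> hm m0; have [mM|Mm] := ltP m M; last by exists 0 => // x y mx xy yM; lra.
have m20 : 0 < m / 2 by rewrite divr_gt0.
pose V := h M - h (m / 2).
have V0 : 0 <= V by rewrite subr_ge0; apply: opmon_nondecreasing => //; lra.
exists (2 / m * V); first by rewrite mulr_ge0 // divr_ge0 // ltW.
move=> x y mx xy yM; have x0 : 0 < x := lt_le_trans m0 mx.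
have y0 := lt_trans x0 xy.
rewrite ger0_norm ?subr_ge0; last by apply: opmon_nondecreasing => //; exact: ltW.
apply: (@ler_eps _ _ _ (x * (2 / m * V))).
  by rewrite mulr_ge0 ?(ltW x0) // mulr_ge0 // divr_ge0 // ltW.
move=> e e0; pose d := Num.min (x / 2) (e * x).
have d0 : 0 < d by rewrite lt_min divr_gt0 //= mulr_gt0.
have dx : d <= x / 2 by rewrite ge_min lexx.
have de : d <= e * x by rewrite ge_min lexx orbT.
have q0 : 0 < y - x / 2 by lra.
pose t := (y - x + d) / (y - x / 2).
have t0 : 0 <= t by rewrite divr_ge0 //; lra.
have t1 : t <= 1 by rewrite ler_pdivrMr //; lra.
have tle : t <= (y - x + d) * (2 / m).
  rewrite ler_wpM2l //; first by lra.
  by rewrite -[2 / m]invf_div lef_pV2 ?posrE //; lra.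
have x20 : 0 < x / 2 by rewrite divr_gt0.
have := opmon_concave_slack hm x20 y0 (_ : 0 <= t <= 1) d0; rewrite t0 t1 => /(_ isT).
have -> : t * (x / 2) + (1 - t) * y + d = x by rewrite /t; field; apply: lt0r_neq0; lra.
have hV : h y - h (x / 2) <= V.
  have := opmon_nondecreasing hm y0 yM.
  have : h (m / 2) <= h (x / 2) by apply: opmon_nondecreasing => //; lra.
  by rewrite /V; lra.
have h1 := ler_wpM2l t0 hV; have h2 := ler_wpM2r V0 tle.
have h3 := ler_wpM2r (mulr_ge0 (ltW (divr_gt0 (ltr0n R 2) m0)) V0) de.
by rewrite /= in h3; lra.
Qed.

Lemma opmon_approximable h : operator_monotone h -> locally_approximable h.
Proof.
move=> hm m M m0; have [L _ hL] := opmon_lipschitz M hm m0.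
exact: approximable_lipschitz hL.
Qed.

(** Continuity of h lets the slack in [opmon_concave_slack] tend to 0. *)
Lemma opmon_concave h : operator_monotone h -> forall a b t,
  0 < a -> 0 < b -> 0 <= t <= 1 -> t * h a + (1 - t) * h b <= h (t * a + (1 - t) * b).
Proof.
move=> hm a b t a0 b0 t01; set c := _ + _ * b.
have c0 : 0 < c.
  rewrite /c; have [->|tn0] := eqVneq t 0; first by rewrite mul0r add0r subr0 mul1r.
  rewrite ltr_pwDl //; last by rewrite mulr_ge0 ?(ltW b0) // subr_ge0; case/andP: t01.
  by rewrite mulr_gt0 // lt_def tn0; case/andP: t01.
have [L L0 hL] := opmon_lipschitz (c + 1) hm c0.
apply: (ler_eps L0) => e e0; pose d := Num.min 1 e.
have d0 : 0 < d by rewrite lt_min ltr01.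
have d1 : d <= 1 by rewrite ge_min lexx.
have de : d <= e by rewrite ge_min lexx orbT.
have h1 := opmon_concave_slack hm a0 b0 t01 d0.
have := hL c (c + d) (lexx _) _ _; rewrite ltrDl d0 lerD2l d1 => /(_ isT isT).
move=> /(le_trans (ler_norm _)); have := ler_wpM2r L0 de; rewrite -/c in h1; lra.
Qed.

Lemma concave_slopes h : operator_monotone h ->
  forall t u v w : R, 0 < t -> t <= u -> u <= v -> v < w ->
  (u - t) * (h w - h v) <= (w - v) * (h u - h t).
Proof.
move=> hm t u v w t0 tu uv vw.
have u0 : 0 < u by lra. have w0 : 0 < w by lra.
have mono1 : h u <= h w by apply: opmon_nondecreasing => //; lra.
have q : 0 < w - t by lra. have r : 0 < w - u by lra.
have s1 : (w - u) * h t + (u - t) * h w <= (w - t) * h u.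
  have := opmon_concave hm t0 w0 (_ : 0 <= (w - u) / (w - t) <= 1).
  have -> : 0 <= (w - u) / (w - t) <= 1.
    by rewrite divr_ge0 /= ?ler_pdivrMr //; lra.
  move=> /(_ isT); have -> : (w - u) / (w - t) * t + (1 - (w - u) / (w - t)) * w = u.
    by field; rewrite gt_eqF.
  rewrite -[X in _ -> _ <= X]mulrC -ler_pdivrMr // => h1.
  apply: le_trans h1; rewrite le_eqVlt; apply/orP; left; apply/eqP.
  by field; rewrite gt_eqF.
have s2 : (w - v) * h u + (v - u) * h w <= (w - u) * h v.
  have := opmon_concave hm u0 w0 (_ : 0 <= (w - v) / (w - u) <= 1).
  have -> : 0 <= (w - v) / (w - u) <= 1.
    by rewrite divr_ge0 /= ?ler_pdivrMr //; lra.
  move=> /(_ isT); have -> : (w - v) / (w - u) * u + (1 - (w - v) / (w - u)) * w = v.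
    by field; rewrite gt_eqF.
  rewrite -[X in _ -> _ <= X]mulrC -ler_pdivrMr // => h1.
  apply: le_trans h1; rewrite le_eqVlt; apply/orP; left; apply/eqP.
  by field; rewrite gt_eqF.
rewrite -(ler_pM2l r).
have ut : 0 <= u - t by lra. have wv : 0 <= w - v by lra.
have := ler_wpM2l ut s2; have := ler_wpM2l wv s1; lra.
Qed.

Lemma opmon_g_ h p : operator_monotone h -> 1 <= p -> operator_monotone (g_ p h).
Proof.
move=> hm p1; have p0 : 0 < p := lt_le_trans ltr01 p1.
have hl := opmon_approximable hm.
apply: (@opmon_of_forms _ _ (fun H A x => p%:C *: fcalc h (op_pow p^-1 A) x)).
  by move=> H A pA; exact: (is_fcalc_scale p pA.1 (is_fcalc_pow_comp p^-1 hl pA)).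
move=> H A B pA pB BA x; rewrite !rdotZl ler_wpM2l ?(ltW p0) //.
apply: opmon_le hm _ _ _ x; [exact: pow_posdef | exact: pow_posdef |].
by apply: loewner_heinz => //; rewrite invr_ge0 (ltW p0) invf_le1.
Qed.

Lemma fcalc_g_ h p (H : hilbertType R) (A : H -> H) : operator_monotone h -> posdef A ->
  fcalc (g_ p h) A = (fun x => p%:C *: fcalc h (op_pow p^-1 A) x).
Proof.
move=> hm pA; apply: fcalcE pA.1 _.
exact: (is_fcalc_scale p pA.1 (is_fcalc_pow_comp p^-1 (opmon_approximable hm) pA)).
Qed.

Lemma opmon_dual h : operator_monotone h -> operator_monotone (fun x => - h x^-1).
Proof.
move=> hm; have hl := opmon_approximable hm.
apply: (@opmon_of_forms _ _ (fun H A x => (-1)%:C *: fcalc h (op_pow (-1) A) x)).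
  move=> H A pA; apply: is_fcalc_ext (is_fcalc_scale (-1) pA.1 (is_fcalc_pow_comp (-1) hl pA)).
  move=> t tA; rewrite mulN1r powR_inv1 // ltW // -ltcR; exact: (posdef_spectrum pA tA).
move=> H A B pA pB BA x; rewrite !rdotZl !mulN1r lerN2.
apply: opmon_le hm _ _ _ x; [exact: pow_posdef | exact: pow_posdef |].
exact: inverse_antitone.
Qed.

(** A nondecreasing concave function that is flat on an interval stays constant
to the right of it. *)
Lemma opmon_const_tail h x y : operator_monotone h -> 0 < x -> x < y -> h x = h y ->
  forall z, x <= z -> h z = h x.
Proof.
move=> hm x0 xy hxy z xz; have z0 : 0 < z := lt_le_trans x0 xz.
apply/eqP; rewrite eq_le (opmon_nondecreasing hm x0 xz) andbT.
have [zy|yz] := leP z y; first by rewrite hxy opmon_nondecreasing.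
have := concave_slopes hm x0 (ltW xy) (lexx y) yz.
by rewrite -hxy subrr mulr0 pmulr_rle0 ?subr_gt0 // subr_le0.
Qed.

(** To the left of the flat interval, [opmon_const_tail] applies to the dual
function - h(1/x), which is operator monotone as well. *)
Lemma opmon_const h x y : operator_monotone h -> 0 < x -> x < y -> h x = h y ->
  forall z, 0 < z -> h z = h x.
Proof.
move=> hm x0 xy hxy z z0.
have tail := opmon_const_tail hm x0 xy hxy.
have [xz|zx] := leP x z; first exact: tail.
have km := opmon_dual hm.
have y0 : 0 < y := lt_trans x0 xy.
have iyx : y^-1 < x^-1 by rewrite ltf_pV2 ?posrE.
have := @opmon_const_tail _ y^-1 x^-1 km _ iyx _ z^-1.
rewrite !invrK invr_gt0 => /(_ y0) h1; apply: oppr_inj; rewrite hxy h1 ?hxy //.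
by rewrite lef_pV2 ?posrE //; exact: ltW (lt_trans zx xy).
Qed.

Lemma classL_increasing g : classL g -> forall x y, 0 < x -> x < y -> g x < g y.
Proof.
move=> [gm g1 dg] x y x0 xy; rewrite lt_neqAle (opmon_nondecreasing gm x0 (ltW xy)) andbT.
apply/negP => /eqP /(opmon_const gm x0 xy) gc.
have near1 : \forall z \near (1 : R), g z = cst (g x) z.
  by near=> z; apply: gc; near: z; exact: lt_nbhsr.
have [_] := near_eq_is_derive near1 dg.
by rewrite derive_cst => /esym/eqP; rewrite oner_eq0.
Unshelve. all: by end_near. Qed.

Lemma g_increasing g p : classL g -> 1 <= p -> forall x y, 0 < x -> x < y -> g_ p g x < g_ p g y.
Proof.
move=> gL p1 x y x0 xy; have p0 : 0 < p := lt_le_trans ltr01 p1.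
rewrite /g_ ltr_pM2l //; apply: classL_increasing => //; first exact: powR_gt0.
by rewrite gt0_ltr_powR ?invr_gt0 ?nnegrE // ltW // (lt_trans x0).
Qed.

End concavity.

(** * Comparison of subsolutions and solutions of the Karcher equation *)

Section karcher_equation.
Context {R : realType}.

(** Since slopes decrease, the increment of h from t to c t is at least the one
from c M to 2 c M scaled by the ratio of the lengths. *)
Lemma increasing_gap (h : R -> R) (m M c : R) : operator_monotone h ->
  (forall x y, 0 < x -> x < y -> h x < h y) -> 0 < m -> 0 < M -> 1 < c ->
  exists2 d : R, 0 < d & forall t, m <= t <= M -> h t + d <= h (c * t).
Proof.
move=> hm hi m0 M0 c1; have c0 : 0 < c := lt_trans ltr01 c1.
have cM0 : 0 < c * M by rewrite mulr_gt0.
have g0 : 0 < h (2 * (c * M)) - h (c * M) by rewrite subr_gt0 hi //; lra.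
exists ((c - 1) * m * (h (2 * (c * M)) - h (c * M)) / (c * M)).
  by rewrite divr_gt0 // mulr_gt0 // mulr_gt0 // subr_gt0.
move=> t /andP[mt tM]; have t0 : 0 < t := lt_le_trans m0 mt.
rewrite -lerBrDl ler_pdivrMr //.
have tct : t <= c * t by rewrite ler_peMl // ltW.
have ctcM : c * t <= c * M by rewrite ler_pM2l.
have := concave_slopes hm t0 tct ctcM (_ : c * M < 2 * (c * M)).
have -> : c * M < 2 * (c * M) by lra.
move=> /(_ isT); have -> : 2 * (c * M) - c * M = c * M by ring.
move=> h1; rewrite [leRHS]mulrC; apply: le_trans h1.
rewrite ler_wpM2r ?(ltW g0) //.
have -> : c * t - t = (c - 1) * t by ring.
by rewrite ler_pM2l // subr_gt0.
Qed.

Section karcher_comparison.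
Context {H : hilbertType R}.

Lemma posdef_scale (c : R) (B : H -> H) : 0 < c -> posdef B -> posdef (fun x => c%:C *: B x).
Proof.
move=> c0 pB; split.
  apply/hermopP; split; first exact/bounded_scale/pB.1.1.
  by move=> x y; rewrite rdotZl rdotZr posdef_sym.
have [m m0 hm] := pB.2; exists (c * m) => [|x]; first exact: mulr_gt0.
by rewrite rdotZl -mulrA ler_pM2l.
Qed.

Lemma opmon_scale_gap (h : R -> R) (m M c d : R) (B : H -> H) : operator_monotone h -> 1 < c ->
  0 < m -> posdef B -> rspec B `<=` [set t | m <= t <= M] ->
  (forall t, m <= t <= M -> h t + d <= h (c * t)) ->
  forall x, '[fcalc h B x, x] + d * '[x, x] <= '[fcalc h (fun x => c%:C *: B x) x, x].
Proof.
move=> hm c1 m0 pB Bs hd x; have c0 : 0 < c := lt_trans ltr01 c1.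
have hl := opmon_approximable hm.
have pcB := posdef_scale c0 pB.
have [a [b [a0 [b0 ab _]]]] := posdef_itv pcB.
have f1 := posdef_fcalc hl pB.
have f2 : is_fcalc (h \o (fun t => c * t)) B (fcalc h (fun x => c%:C *: B x)).
  apply: (@is_fcalc_comp _ _ h (fun t => c * t) B _
    [set t | Num.min a (c * m) <= t <= Num.max b (c * M)] pB.1
    (is_fcalc_scale c pB.1 (is_fcalc_id B))).
  - by move=> t /Bs /= /andP[mt tM]; rewrite ge_min le_max !ler_pM2l // mt tM !orbT.
  - by move=> t /ab /= /andP[h1 h2]; rewrite ge_min le_max h1 h2.
  - by apply: hl; rewrite lt_min a0 mulr_gt0.
rewrite -rdotZl -rdotDl.
apply: (is_fcalc_mono pB.1 (is_fcalc_add f1 (is_fcalc_cst d B)) f2 _ x).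
by move=> t /Bs /hd.
Qed.

Lemma posdef_family n (B : 'I_n -> H -> H) : (forall i, posdef (B i)) -> exists m M : R,
  [/\ 0 < m, 0 < M, forall i, rspec (B i) `<=` [set t | m <= t <= M] &
     forall i x, m * '[x, x] <= '[B i x, x]].
Proof.
move=> pB; have /choice[p hp] : forall i, exists p : R * R, [/\ 0 < p.1, 0 < p.2,
    rspec (B i) `<=` [set t | p.1 <= t <= p.2] & forall x, p.1 * '[x, x] <= '[B i x, x]].
  move=> i; have [m [M [m0 M0 mM hm]]] := posdef_itv (pB i); exists (m, M); split => //= x.
  by have [] := hm x.
(* Sums of positive bounds replace the extremal bounds; the summand 1 keeps them
   positive when the family is empty. *)
pose s := \sum_i (p i).1^-1; pose S := \sum_i (p i).2.
have s0 : 0 <= s by apply: sumr_ge0 => i _; rewrite invr_ge0 ltW //; case: (hp i).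
have S0 : 0 <= S by apply: sumr_ge0 => i _; rewrite ltW //; case: (hp i).
have lo i : (1 + s)^-1 <= (p i).1.
  have [p0 _ _ _] := hp i; rewrite invf_ple ?posrE ?ltr_wpDr //.
  rewrite /s (bigD1 i) //= addrCA lerDl addr_ge0 // sumr_ge0 // => j _.
  by rewrite invr_ge0 ltW //; case: (hp j).
have hi i : (p i).2 <= 1 + S.
  rewrite /S (bigD1 i) //= addrCA lerDl addr_ge0 // sumr_ge0 // => j _.
  by rewrite ltW //; case: (hp j).
exists (1 + s)^-1, (1 + S); split => //; [by rewrite invr_gt0 ltr_wpDr | by rewrite ltr_wpDr | |].
  move=> i t; have [_ _ h _] := hp i; move=> /h /= /andP[h1 h2].
  by rewrite (le_trans (lo i) h1) (le_trans h2 (hi i)).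
move=> i x; have [_ _ _ h] := hp i; apply: le_trans (h x).
by rewrite ler_wpM2r ?rdot_ge0.
Qed.

(** Assume mu = |M| > 1 and put K = M / mu. For 1 < c < mu^2 the operator
M' B_i M = mu^2 K' B_i K dominates K' (c B_i) K + eps (1 - K' K) + eps, and
[operator_jensen] gives

  <h(c B_i) K x, K x> + h(eps) (|x|^2 - |K x|^2) <= <h(M' B_i M) x, x>.

Here h(c B_i) >= h(B_i) + d by [increasing_gap]. Weighted sums over i and the
two sign hypotheses leave d |K x|^2 <= |h(eps)| (|x|^2 - |K x|^2), so that |K| < 1,
contrary to the choice of mu. *)
Lemma karcher_contraction (h : R -> R) n (w : 'I_n -> R) (B : 'I_n -> H -> H)
  (M M' : H -> H) (l : R) : operator_monotone h ->
  (forall x y, 0 < x -> x < y -> h x < h y) -> weights w -> (forall i, posdef (B i)) ->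
  bounded_operator M -> bounded_operator M' -> adjoint_pair M M' ->
  0 < l -> (forall x, l * nrm x <= nrm (M x)) ->
  (forall x, 0 <= \sum_i w i * '[fcalc h (B i) x, x]) ->
  (forall x, \sum_i w i * '[fcalc h (M' \o B i \o M) x, x] <= 0) ->
  forall x, nrm (M x) <= nrm x.
Proof.
move=> hm hi [w0 w1] pB bM bM' MM l0 hc hB hD x1.
rewrite leNgt; apply/negP => x1M.
have lM := bM.1; have lM' := bM'.1.
have pD i : posdef (M' \o B i \o M) by exact: posdef_congr (pB i) bM bM' MM l0 hc.
have x1p : 0 < nrm x1.
  by rewrite nrm_gt0; apply: contraTneq x1M => ->; rewrite (op0 lM) !nrm0 ltxx.
pose S := [set nrm (M x) | x in [set x | nrm x = 1]].
have normalize x : 0 < nrm x -> nrm ((nrm x)^-1%:C *: x) = 1.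
  by move=> xp; rewrite nrm_real ger0_norm ?invr_ge0 ?nrm_ge0 // mulVf // gt_eqF.
have inS x : 0 < nrm x -> S (nrm (M x) / nrm x).
  move=> xp; exists ((nrm x)^-1%:C *: x); first exact: normalize.
  by rewrite (opZ lM) nrm_real ger0_norm ?invr_ge0 ?nrm_ge0 // mulrC.
have supS : has_sup S.
  split; first by exists (nrm (M x1) / nrm x1); exact: inS.
  have /bounded_nrmP[_ [N N0 hN]] := bM.
  by exists N => _ [x /= xn <-]; rewrite -[N]mulr1 -xn hN.
pose mu := sup S.
have mu1 : 1 < mu.
  apply: lt_le_trans (_ : nrm (M x1) / nrm x1 <= _); first by rewrite ltr_pdivlMr // mul1r.
  by apply: (sup_upper_bound supS); exact: inS.
have mu0 : 0 < mu := lt_trans ltr01 mu1.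
have Mmu x : nrm (M x) <= mu * nrm x.
  have [x0|x0] := ltP 0 (nrm x).
    by rewrite -ler_pdivrMr //; apply: (sup_upper_bound supS); exact: inS.
  have : nrm x == 0 by rewrite eq_le x0 nrm_ge0.
  by rewrite nrm_eq0 => /eqP ->; rewrite (op0 lM) nrm0 mulr0.
pose K x := mu^-1%:C *: M x; pose K' x := mu^-1%:C *: M' x.
have bK : bounded_operator K by exact: bounded_scale.
have bK' : bounded_operator K' by exact: bounded_scale.
have KK : adjoint_pair K K' by move=> x y; rewrite rdotZl rdotZr MM.
have cK x : nrm (K x) <= nrm x.
  by rewrite nrm_real ger0_norm ?invr_ge0 ?(ltW mu0) // ler_pdivrMl.
have mu21 : 1 < mu ^+ 2 by rewrite exprn_egt1.
have mu20 : 0 < mu ^+ 2 by rewrite exprn_gt0.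
pose c := (1 + mu ^+ 2) / 2.
have c1 : 1 < c by rewrite /c; lra.
have cmu : c < mu ^+ 2 by rewrite /c; lra.
have c0 : 0 < c by lra.
have [m [N [m0 N0 BmN _]]] := posdef_family pB.
have [m' [_ [m'0 _ _ Dm']]] := posdef_family pD.
have [d d0 hd] := increasing_gap hm hi m0 N0 c1.
(* K' (c B_i) K is the fraction c / mu^2 of M' B_i M >= m'. One half of the
   remaining fraction pays for eps (1 - K' K), the other half for the slack. *)
pose eps := (1 - c / mu ^+ 2) * m' / 2.
have eps0 : 0 < eps.
  by rewrite divr_gt0 // mulr_gt0 // subr_gt0 ltr_pdivrMr // mul1r.
have hl := opmon_approximable hm.
have jen i x : '[fcalc h (fun x => c%:C *: B i x) (K x), K x] + h eps * ('[x, x] - '[K x, K x])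
    <= '[fcalc h (M' \o B i \o M) x, x].
  have pC := posdef_scale c0 (pB i).
  apply: (operator_jensen bK bK' KK cK hm pC (pD i) eps0 eps0).
  - have [a [b [a0 [_ ab _]]]] := posdef_itv pC.
    apply: approximable_sub (hl (Num.min a eps) (Num.max b eps) _).
      by move=> t /= [/ab /andP[h1 h2]|->]; rewrite ge_min le_max ?h1 ?h2 ?lexx ?orbT.
    by rewrite lt_min a0.
  - move=> L L0; have [a [b [a0 [_ ab _]]]] := posdef_itv (pD i).
    apply: approximable_sub (hl (Num.min a L) (Num.max b L) _).
      by move=> t /= [/ab /andP[h1 h2]|->]; rewrite ge_min le_max ?h1 ?h2 ?lexx ?orbT.
    by rewrite lt_min a0.
  - move=> y; have -> : '[c%:C *: B i (K y), K y] = c / mu ^+ 2 * '[(M' \o B i \o M) y, y].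
      rewrite rdotZl /K (opZ (posdef_lin (pB i))) rdotZl rdotZr /= [in RHS]rdotC -MM [in RHS]rdotC.
      by field; rewrite gt_eqF.
    have h1 := Dm' i y; have h2 := rdot_ge0 (K y); have h3 := rdot_ge0 y.
    have h4 : 0 <= 1 - c / mu ^+ 2 by rewrite subr_ge0 ler_pdivrMr // mul1r ltW.
    have h5 := ler_wpM2l h4 h1; have h6 := mulr_ge0 (ltW eps0) h2.
    have h7 : 2 * eps = (1 - c / mu ^+ 2) * m' by rewrite /eps; field; rewrite gt_eqF.
    rewrite mulrA -h7 in h5; lra.
have gap i := opmon_scale_gap hm c1 m0 (pB i) (BmN i) hd.
have main x : d * '[K x, K x] <= `|h eps| * ('[x, x] - '[K x, K x]).
  have dK : 0 <= '[x, x] - '[K x, K x].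
    by rewrite subr_ge0 -!nrm_sqr ler_sqr ?nnegrE ?nrm_ge0.
  have : \sum_i w i * ('[fcalc h (B i) (K x), K x] + d * '[K x, K x] +
      h eps * ('[x, x] - '[K x, K x]))
     <= \sum_i w i * '[fcalc h (M' \o B i \o M) x, x].
    by apply: ler_sum => i _; rewrite ler_pM2l //; have := jen i x; have := gap i (K x); lra.
  move=> /le_trans/(_ (hD x)).
  under eq_bigr => i _ do rewrite -addrA mulrDr.
  rewrite big_split /= -mulr_suml w1 mul1r.
  have := hB (K x); have := ler_wpM2r dK (ler_norm (- h eps)) ; rewrite normrN; lra.
pose th := `|h eps| / (d + `|h eps|).
have s0 : 0 < d + `|h eps| by rewrite ltr_wpDr.
have th0 : 0 <= th by rewrite divr_ge0 // ltW.
have th1 : th < 1 by rewrite ltr_pdivrMr // mul1r ltrDr.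
have Kth x : nrm (K x) <= Num.sqrt th * nrm x.
  rewrite /nrm -sqrtrM // ler_wsqrtr // /th mulrAC ler_pdivlMr //.
  by have := main x; lra.
(* The bound for K makes mu sqrt(th) an upper bound for the norms |M x|, |x| = 1,
   whose supremum is mu. *)
have : mu <= mu * Num.sqrt th.
  apply: ge_sup; first exact: supS.1.
  move=> _ [x /= xn <-]; have := Kth x; rewrite nrm_real ger0_norm ?invr_ge0 ?(ltW mu0) //.
  by rewrite ler_pdivrMl // xn mulr1.
rewrite leNgt => /negP; apply; rewrite gtr_pMr // -sqrtr1 ltr_sqrt //.
Qed.
End karcher_comparison.
End karcher_equation.

(** * The Ando-Hiai inequality and representing functions *)

Section ando_hiai_inequality.
Context {R : realType}.

Lemma karcher_form (H : hilbertType R) n (w : 'I_n -> R) (F : 'I_n -> H -> H) :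
  (forall x : H, \sum_(i < n) (w i)%:C *: F i x = 0) ->
  forall x, \sum_i w i * '[F i x, x] = 0.
Proof.
move=> h x; have := rdot0l x; rewrite -(h x).
rewrite (big_morph (fun u => '[u, x]) (fun u v => rdotDl u v x) (rdot0l x)).
by move=> e; rewrite -[RHS]e; apply: eq_bigr => i _; rewrite rdotZl.
Qed.

(** X is a subsolution of the equation that Y solves: this is [hansen] under the
monotone g. Then [karcher_contraction] for M = X^(1/2) Y^(-1/2) gives X <= Y. *)
Theorem ando_hiai (g : R -> R) (H : hilbertType R) (n : nat) (A : 'I_n -> H -> H) (w : 'I_n -> R)
  (X : H -> H) : classL g -> (forall i, posinv (A i)) -> weights w ->
  is_sigma g w A X -> op_le id X -> forall (p : R) (Y : H -> H), 1 <= p ->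
  is_sigma (g_ p g) w (fun i => op_pow p (A i)) Y -> op_le id Y.
Proof.
move=> gL pA hw [pX hX] IX p Y p1 [pY hY]; have gm : operator_monotone g by case: gL.
have p0 : 0 < p := lt_le_trans ltr01 p1.
have {}pA i := posinv_posdef (pA i); have {}pX := posinv_posdef pX.
have {}pY := posinv_posdef pY.
have hid : hermop (@id H) := posdef_id.1.
have {}IX := (op_leP hid pX.1).1 IX.
pose K := op_pow (- 2^-1) X; have pK : posdef K := pow_posdef _ pX.
pose Ki := op_pow 2^-1 X; have pKi : posdef Ki := pow_posdef _ pX.
pose L := op_pow (- 2^-1) Y; have pL : posdef L := pow_posdef _ pY.
have half2 : 2^-1 + 2^-1 = 1 :> R by field.
have KiKi x : Ki (Ki x) = X x by rewrite /Ki op_powD // half2 op_pow1.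
have KiK x : Ki (K x) = x by rewrite /K /Ki op_powK.
have KKi x : K (Ki x) = x by rewrite /K /Ki op_powNK.
have cK x : nrm (K x) <= nrm x.
  apply: nrm_le_sqr; apply: le_trans (IX (K x)) _.
  by rewrite -KiKi (posdef_sym _ _ pKi) !KiK.
pose B i := K \o op_pow p (A i) \o K.
have hans i := hansen (pA i) pK cK p1.
have [cL cL0 hcL] := posdef_below pL; have [ci ci0 hci] := posdef_below pKi.
have [ck ck0 hck] := posdef_below pK.
have bKi := pKi.1.1; have bL := pL.1.1; have bK := pK.1.1.
have := @karcher_contraction R H (g_ p g) n w B (Ki \o L) (L \o Ki) (ci * cL)
  (opmon_g_ gm p1) (g_increasing gL p1) hw (fun i => (hans i).1)
  (bounded_comp bKi bL) (bounded_comp bL bKi).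
have adj : adjoint_pair (Ki \o L) (L \o Ki).
  by move=> x y /=; rewrite (posdef_sym _ _ pKi) (posdef_sym _ _ pL).
have below x : ci * cL * nrm x <= nrm ((Ki \o L) x).
  by rewrite -mulrA; apply: le_trans (hci _); rewrite ler_pM2l.
move=> /(_ adj (mulr_gt0 ci0 cL0) below) key.
(* Conjugating B_i by X^(1/2) Y^(-1/2) turns the outer factors X^(-1/2) into
   Y^(-1/2), so the second sum is the equation of Y. *)
have contr : forall x, nrm ((Ki \o L) x) <= nrm x.
  apply: key => x; last first.
    rewrite le_eqVlt; apply/orP; left; apply/eqP; rewrite -[RHS](karcher_form hY x).
    apply: eq_bigr => i _; congr (_ * '[fcalc _ _ x, x]).
    by apply/funext => u; rewrite /B /= KKi KiK.
  rewrite -[leLHS](_ : p * \sum_i w i * '[fcalc g (K \o A i \o K) x, x] = 0); last first.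
    by rewrite (karcher_form hX x) mulr0.
  rewrite [leLHS]mulr_sumr; apply: ler_sum => i _.
  rewrite mulrCA ler_pM2l ?hw.1 // (fcalc_g_ p gm (hans i).1) rdotZl ler_pM2l //.
  apply: opmon_le gm _ _ _ x.
  - exact: pow_posdef (hans i).1.
  - exact: (posdef_congr (pA i) bK bK (fun u v => posdef_sym u v pK) ck0 hck).
  - exact: (hans i).2.
apply/(op_leP hid pY.1) => u; apply: le_trans (IX u) _.
have LL x : L (op_pow 2^-1 Y x) = x by rewrite /L op_powNK.
have := contr (op_pow 2^-1 Y u); rewrite /= LL.
rewrite -ler_sqr ?nnegrE ?nrm_ge0 // !nrm_sqr -(posdef_sym _ _ pKi) KiKi.
by rewrite -pow_sym // op_powD // half2 op_pow1.
Qed.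

Lemma opmon_continuous (h : R -> R) (t : R) : operator_monotone h -> 0 < t ->
  h x @[x --> t] --> h t.
Proof.
move=> hm t0; have t20 : 0 < t / 2 by rewrite divr_gt0.
have [L L0 hL] := opmon_lipschitz (2 * t) hm t20.
apply/cvgrPdist_le => e e0; pose d := Num.min (t / 2) (e / (L + 1)).
have d0 : 0 < d by rewrite lt_min t20 divr_gt0 // ltr_wpDl.
have dt : d <= t / 2 by rewrite ge_min lexx.
have de : d * (L + 1) <= e by rewrite -ler_pdivlMr ?ltr_wpDl // ge_min lexx orbT.
apply: filterS (nbhsx_ballx t _ d0) => x; rewrite -ball_normE /= ltr_distl => /andP[h1 h2].
have main (u v : R) : t / 2 <= u -> u < v -> v <= 2 * t -> v - u <= d -> `|h v - h u| <= e.
  move=> tu uv vt vud; apply: le_trans (hL u v tu uv vt) _.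
  have := ler_wpM2l L0 vud; nra.
have [tx|xt|->] := ltgtP t x; last by rewrite subrr normr0 ltW.
  by rewrite distrC; apply: main => //; lra.
by apply: main => //; lra.
Qed.

(** The expression has opposite signs at y = 1 and y = z. *)
Lemma scalar_mean_exists (g : R -> R) (lam z : R) : classL g -> 0 <= lam -> lam <= 1 -> 0 < z ->
  exists2 y, 0 < y & (1 - lam) * g y^-1 + lam * g (z / y) = 0.
Proof.
move=> [gm g1 _] lam0 lam1 z0; pose F (y : R) : R := (1 - lam) * g y^-1 + lam * g (z / y).
have Fcont (y : R) : 0 < y -> F x @[x --> y] --> F y.
  move=> y0; have cinv : x^-1 @[x --> y] --> y^-1 by apply: inv_continuous; rewrite gt_eqF.
  apply: cvgD; apply: cvgM; try exact: cvg_cst.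
    by apply: cvg_comp cinv _; apply: opmon_continuous; rewrite ?invr_gt0.
  apply: cvg_comp (cvgM (cvg_cst z) cinv) _.
  by apply: opmon_continuous; rewrite ?divr_gt0.
have g_ge1 t : 1 <= t -> 0 <= g t by move=> t1; rewrite -g1 opmon_nondecreasing.
have g_le1 t : 0 < t -> t <= 1 -> g t <= 0 by move=> t0 t1; rewrite -g1 opmon_nondecreasing.
have F1 : F 1 = lam * g z by rewrite /F divr1 invr1 g1 mulr0 add0r.
have Fz : F z = (1 - lam) * g z^-1 by rewrite /F divff ?gt_eqF // g1 mulr0 addr0.
have l1 : 0 <= 1 - lam by rewrite subr_ge0.
have ivt (a b : R) : 0 < a -> a <= b -> Num.min (F a) (F b) <= 0 <= Num.max (F a) (F b) ->
    exists2 y, 0 < y & F y = 0.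
  move=> a0 ab F0; have [|y] := @IVT R F a b 0 ab _ F0.
    apply: continuous_in_subspaceT => y; rewrite inE /= in_itv /= => /andP[ay _].
    by apply: Fcont; exact: lt_le_trans ay.
  by rewrite in_itv /= => /andP[ay _] Fy; exists y => //; exact: lt_le_trans ay.
have [z1|z1] := leP 1 z.
  apply: (ivt 1 z) => //; have h1 : 0 <= F 1 by rewrite F1 mulr_ge0 ?g_ge1.
  have h2 : F z <= 0 by rewrite Fz mulr_ge0_le0 // g_le1 ?invr_gt0 // invf_le1.
  by rewrite ge_min h2 orbT le_max h1.
apply: (ivt z 1) => //; first exact: ltW.
have h1 : F 1 <= 0 by rewrite F1 mulr_ge0_le0 // g_le1 // ltW.
have h2 : 0 <= F z by rewrite Fz mulr_ge0 // g_ge1 // invf_ge1 // ltW.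
by rewrite ge_min h1 orbT le_max h2.
Qed.

(** y |-> y^p maps zeros of the equation of g at x^(1/p) to zeros of the equation
of g_p at x, and zeros are unique since g is strictly increasing. Both equations
do have a zero: otherwise the two sides would be a default value and its p-th
power. *)
Lemma repr_fun_g_ (g : R -> R) : classL g -> forall p lambda x : R,
  1 <= p -> 0 <= lambda <= 1 -> 0 < x ->
  repr_fun (g_ p g) lambda x = (repr_fun g lambda (x `^ p^-1)) `^ p.
Proof.
move=> gL p lam x p1 /andP[lam0 lam1] x0; have p0 : 0 < p := lt_le_trans ltr01 p1.
have gi := classL_increasing gL.
pose F z y := (1 - lam) * g y^-1 + lam * g (z / y).
have Fdec z y y' : 0 < z -> 0 < y -> y < y' -> F z y' < F z y.
  move=> z0 y0 yy; have y'0 := lt_trans y0 yy.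
  have h1 : g y'^-1 < g y^-1 by apply: gi; rewrite ?invr_gt0 ?ltf_pV2 ?posrE.
  have h2 : g (z / y') < g (z / y).
    by apply: gi; rewrite ?divr_gt0 // ltr_pM2l // ltf_pV2 ?posrE.
  rewrite /F; have [->|lamn0] := eqVneq lam 0; first by rewrite !mul0r !addr0 subr0 !mul1r.
  have lamp : 0 < lam by rewrite lt_def lamn0.
  apply: ler_ltD; first by rewrite ler_wpM2l ?subr_ge0 // ltW.
  by rewrite ltr_pM2l.
have Funiq z y y' : 0 < z -> 0 < y -> 0 < y' -> F z y = 0 -> F z y' = 0 -> y = y'.
  move=> z0 y0 y'0 h h'; have [yy|yy|//] := ltgtP y y'.
    by have := Fdec z y y' z0 y0 yy; rewrite h h' ltxx.
  by have := Fdec z y' y z0 y'0 yy; rewrite h h' ltxx.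
set z := x `^ p^-1; have z0 : 0 < z by rewrite powR_gt0.
have zp : z `^ p = x by rewrite /z -powRrM mulVf ?gt_eqF // powRr1 // ltW.
have Fg y : 0 < y -> (1 - lam) * g_ p g (y `^ p)^-1 + lam * g_ p g (x / y `^ p) = p * F z y.
  move=> y0; have yp : (y `^ p) `^ p^-1 = y by rewrite -powRrM divff ?gt_eqF // powRr1 // ltW.
  have e1 : ((y `^ p)^-1) `^ p^-1 = y^-1.
    by rewrite -powRN -powRrM mulNr divff ?gt_eqF // powR_inv1 // ltW.
  have e2 : (x / y `^ p) `^ p^-1 = z / y.
    by rewrite powRM ?(ltW x0) ?invr_ge0 ?powR_ge0 // e1.
  by rewrite /g_ e1 e2 /F; ring.
have root y : 0 < y -> y = (y `^ p^-1) `^ p.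
  by move=> y0; rewrite -powRrM mulVf ?gt_eqF // powRr1 // ltW.
have Froot y : 0 < y -> (1 - lam) * g_ p g y^-1 + lam * g_ p g (x / y) = 0 ->
    F z (y `^ p^-1) = 0.
  move=> y0; rewrite {1 2}(root y y0) Fg ?powR_gt0 // => /eqP.
  by rewrite mulf_eq0 gt_eqF //= => /eqP.
rewrite /repr_fun; case: xgetP => [y1 _ [y10 Fy1]|none1]; case: xgetP => [y2 _ [y20 Fy2]|none2].
- rewrite (root _ y10); congr (_ `^ p).
  by apply: (@Funiq z) => //; [exact: powR_gt0 | exact: Froot].
- by exfalso; apply: (none2 (y1 `^ p^-1)); split; [exact: powR_gt0 | exact: Froot].
- exfalso; apply: (none1 (y2 `^ p)); split; first exact: powR_gt0.
  by rewrite Fg // /F Fy2 mulr0.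
- by have [y y0 Fy] := scalar_mean_exists gL lam0 lam1 z0; exfalso; apply: (none2 y).
Qed.
End ando_hiai_inequality.

Theorem theorem7 (R : realType) (g : R -> R) (hg : classL g) :
  (forall (H : hilbertType R) (n : nat) (A : 'I_n -> H -> H) (w : 'I_n -> R)
      (X : H -> H),
    (1 <= n)%N -> (forall i, posinv (A i)) -> weights w ->
    is_sigma g w A X -> op_le id X ->
    forall (p : R) (Y : H -> H), 1 <= p ->
      is_sigma (g_ p g) w (fun i => op_pow p (A i)) Y -> op_le id Y) /\
  (forall p lambda x : R, 1 <= p -> 0 <= lambda <= 1 -> 0 < x ->
    repr_fun (g_ p g) lambda x = (repr_fun g lambda (x `^ p^-1)) `^ p).
Proof.
split=> [H n A w X n1 pA hw hX IX p Y p1 hY|]; last exact: repr_fun_g_.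
exact: (ando_hiai hg pA hw hX IX p1 hY).
Qed.
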